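(* Let $\mathcal{F}$ be a graph family admitting strongly sublinear separators. Then for every $H\in\mathcal{F}$, $c(H)=(1+o(1))c_f(H)$, where the $o(1)$ term depends only on $\mathcal{F}$ and tends to $0$ as $\mathsf{v}(H)\to\infty$.
   Context: All graphs are finite and simple. $\mathsf{d}(G)=\mathsf{e}(G)/\mathsf{v}(G)$ for non-null $G$. For $\mathsf{v}(H)\ge2$, $c(H)$ is the supremum of $\mathsf{d}(G)$ over non-null graphs $G$ with no $H$ minor. A jumbled model of a graph $H$ in a graph $G$ is a map $\mu$ from $V(H)$ to subsets of $V(G)$ such that each $G[\mu(v)]$ is connected (and nonempty) and for every edge $uv\in E(H)$ there is an edge of $G$ between $\mu(u)$ and $\mu(v)$ (the sets $\mu(v)$ may overlap). For $x\in V(G)$, $\mu^{\#}(x)$ is the number of $v\in V(H)$ with $x\in\mu(v)$. The $H$-volume $\mathrm{Vol}_H(G)$ is the supremum of $\sum_{i=1}^n\alpha_i$ over all $n\in\mathbb{N}$, reals $\alpha_1,\dots,\alpha_n\ge0$ and jumbled models $\mu_1,\dots,\mu_n$ of $H$ in $G$ with $\sum_i\alpha_i\mu_i^{\#}(x)\le1$ for all $x\in V(G)$. The fractional extremal function is $c_f(H)=\sup_G \mathsf{d}(G)/\mathrm{Vol}_H(G)$ over non-null graphs $G$. A separation of $G$ is a pair $(A_1,A_2)$ of subsets of $V(G)$ with $G=G[A_1]\cup G[A_2]$, $A_1\setminus A_2\ne\emptyset\ne A_2\setminus A_1$, of order $|A_1\cap A_2|$, balanced if $|A_1|,|A_2|\ge\mathsf{v}(G)/3$.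 A family $\mathcal{F}$ admits strongly sublinear separators if it is closed under subgraphs and there are $\beta<1$, $c>0$ such that every $G\in\mathcal{F}$ has a balanced separation of order at most $c\,\mathsf{v}(G)^\beta$. *)

(* Defs.v *)
From HB Require Import structures.
From mathcomp Require Import all_boot all_order all_algebra.
From mathcomp Require Import all_classical all_reals all_analysis.

Set Implicit Arguments.
Unset Strict Implicit.
Unset Printing Implicit Defensive.

Import Order.TTheory GRing.Theory Num.Theory.

Local Open Scope ring_scope.

(** Finite simple graphs; the null graph (no vertices) is allowed. *)
Record sgraph : Type := SGraph {
  vertex :> finType;
  adj : rel vertex;
  adj_sym : symmetric adj;
  adj_irr : irreflexive adj }.

Definition num_vertices (G : sgraph) : nat := #|vertex G|.

Definition edges (G : sgraph) : {set {set G}} :=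
  [set e : {set G} | [exists x : G, exists y : G, adj x y && (e == [set x; y])]].

Definition num_edges (G : sgraph) : nat := #|edges G|.

Definition density (R : realType) (G : sgraph) : R :=
  (num_edges G)%:R / (num_vertices G)%:R.

(** [K] is isomorphic to a (not necessarily induced) subgraph of [G]. *)
Definition subgraph (K G : sgraph) : Prop :=
  exists2 f : K -> G, injective f & forall x y : K, adj x y -> adj (f x) (f y).

(** The induced subgraph [G[A]] is nonempty and connected. *)
Definition connected_in (G : sgraph) (A : {set G}) : Prop :=
  A != finset.set0 /\
  forall x y : G, x \in A -> y \in A ->
    connect [rel u v : G | [&& u \in A, v \in A & adj u v]] x y.

Definition jumbled_model (H G : sgraph) (mu : H -> {set G}) : Prop :=
  (forall v : H, connected_in (mu v)) /\
  (forall u v : H, adj u v ->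
     exists x y : G, [/\ x \in mu u, y \in mu v & adj x y]).

(** [H] is a minor of [G], via pairwise disjoint branch sets. *)
Definition minor (H G : sgraph) : Prop :=
  exists2 mu : H -> {set G}, jumbled_model mu &
    forall u v : H, u != v -> [disjoint mu u & mu v].

(** The number of [v] with [x] in [mu v]. *)
Definition multiplicity (H G : sgraph) (mu : H -> {set G}) (x : G) : nat :=
  #|[set v : H | x \in mu v]|.

(** The [H]-volume of [G], as an extended real. *)
Definition volume (R : realType) (H G : sgraph) : \bar R :=
  ereal_sup (fun t : \bar R =>
    exists (n : nat) (alpha : 'I_n -> R) (mu : 'I_n -> H -> {set G}),
      [/\ forall i, 0 <= alpha i,
          forall i, jumbled_model (mu i),
          forall x : G, \sum_(i < n) alpha i * (multiplicity (mu i) x)%:R <= 1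
        & t = (\sum_(i < n) alpha i)%:E]).

(** The extremal function [c(H)]. *)
Definition extremal (R : realType) (H : sgraph) : \bar R :=
  ereal_sup (fun t : \bar R =>
    exists G : sgraph,
      [/\ (0 < num_vertices G)%N, ~ minor H G & t = (density R G)%:E]).

(** The fractional extremal function [c_f(H)].  When [H] has an edge and [G] has
    none, both the density and the volume vanish; in [\bar R] the quotient is
    then [0 * +oo = 0], so that such [G] do not affect the supremum. *)
Definition frac_extremal (R : realType) (H : sgraph) : \bar R :=
  ereal_sup (fun t : \bar R =>
    exists G : sgraph,
      (0 < num_vertices G)%N /\ t = ((density R G)%:E / volume R H G)%E).

(** [G = G[A1] \cup G[A2]] with both differences nonempty. *)
Definition separation (G : sgraph) (A1 A2 : {set G}) : Prop :=
  [/\ A1 :|: A2 = [set: G],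
      forall x y : G, adj x y ->
        (x \in A1) && (y \in A1) || (x \in A2) && (y \in A2),
      A1 :\: A2 != finset.set0
    & A2 :\: A1 != finset.set0].

Definition order_sep (G : sgraph) (A1 A2 : {set G}) : nat := #|A1 :&: A2|.

Definition balanced (R : realType) (G : sgraph) (A1 A2 : {set G}) : Prop :=
  (num_vertices G)%:R / 3 <= #|A1|%:R :> R /\
  (num_vertices G)%:R / 3 <= #|A2|%:R :> R.

Definition subgraph_closed (F : sgraph -> Prop) : Prop :=
  forall K G : sgraph, F G -> subgraph K G -> F K.

(** The separation is only required of graphs with at least [n0] vertices:
    complete graphs, in particular the one-vertex graph, have no separation at
    all, so that asking one of every member of a subgraph-closed family would
    leave only the empty family. *)
Definition strongly_sublinear_separators
    (R : realType) (F : sgraph -> Prop) : Prop :=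
  subgraph_closed F /\
  exists (beta c : R) (n0 : nat),
    [/\ beta < 1, 0 < c
      & forall G : sgraph, F G -> (n0 <= num_vertices G)%N ->
          exists A1 A2 : {set G},
            [/\ separation A1 A2, balanced R A1 A2
              & (order_sep A1 A2)%:R <= c * (num_vertices G)%:R `^ beta]].

(* Main.v *)
(** The inequality [c_f(H) <= (1 + o(1)) c(H)] holds for every [H]: in a graph [G]
    whose density is large, [m = (1 + eps) c(H) v(G) / d(G)] independent random
    vertices span, by Chebyshev's inequality, a graph of density more than [c(H)],
    hence with an [H] minor, and averaging the resulting jumbled models gives
    [Vol_H(G) >= (1 - eps) v(G) / m].

    For the converse, separators cut [H] into pieces of bounded size which overlap
    in few vertices.  Replacing each vertex by one clone per piece and joining every
    clone to the clone in a home piece, it suffices to find the graph of clones as a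
    minor.  A graph of density above [(1 + eps) c_f(H)] has a minor [G] which is
    critical in Mader's sense: it has minimum degree [D] and stays connected after
    the deletion of [b = delta D] vertices, and its edges lie in many triangles.
    Either [G] contains many disjoint dense pieces of linear size, and the pieces of
    [H] are put into these and joined by paths obtained from Menger's theorem and a
    transversal dense piece; or it contains a subgraph on [O(D)] vertices which is
    almost as dense.  In the latter a random reserve of vertices keeps enough short
    links between all pairs, and the rest is regularised.  By linear programming
    duality, for any weights on the cells of the regular partition there is a
    jumbled model of [H] in a bounded random sample of vertices that is cheap for
    these weights; a potential argument (approachability) turns this into a choice
    of one model for each piece of [H] which does not overload any cell.  The pieces
    are then embedded greedily, and the clones are joined through the reserve. *)
Require Import Defs.
From HB Require Import structures.
From mathcomp Require Import boolp.
From mathcomp Require Import all_boot all_order all_algebra.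
From mathcomp Require Import zify ring lra.

Set Implicit Arguments.
Unset Strict Implicit.
Unset Printing Implicit Defensive.

(** A jumbled model may use a vertex many times, a minor may not. Models are therefore chosen only
    up to cells of a regular partition: every use of a cell is served by a fresh vertex of that
    cell, and the load constraint in the volume becomes a bound on how full the cells get. The
    factor 1 + eps is spent on keeping a fixed share of every cell free, which is what the greedy
    embedding consumes.

    The constants would be circular in any other order. [r] stands for 1/eps; [r] and the sparsity
    constant [C0] of the family fix the number of dense pieces sought, hence the ratio [K] between
    the size of the small dense subgraph and its degree; [K] and [r] fix the overlap 1/[E] that is
    tolerated; the overlap fixes the size [k] of the pieces of [H]; only then is v(H) taken large.
    This is why [dense_case] produces [E] before it receives [k].

    Large v(H) is usable because c_f(H) >= v(H) / 4, seen on the graph with one edge: it makes the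
    degree [D] large, and it makes the host large enough compared with [H] for a few overlaps of
    pieces to cost little. *)

Definition rel_connected (T : finType) (e : rel T) (A : {set T}) : Prop :=
  A != set0 /\
  forall x y : T, x \in A -> y \in A ->
    connect [rel u v : T | [&& u \in A, v \in A & e u v]] x y.

(** Connectivity is handled through edges leaving a proper subset, here and in [cut_rel_connected].
    It is stated for arbitrary relations because branch sets are first connected by virtual edges;
    for [adj] it unfolds to [connected_in]. *)
Lemma rel_connected_cut (T : finType) (e : rel T) (A C : {set T}) :
  rel_connected e A -> C \subset A -> C != set0 -> C != A ->
  exists x y, [/\ x \in C, y \in A, y \notin C & e x y].
Proof.
move=> [_ conA] CA /set0Pn[c cC] CnA.
have /set0Pn[d] : A :\: C != set0.
  by rewrite setD_eq0; apply: contra CnA => AC; rewrite eqEsubset CA.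
rewrite inE => /andP[dC dA].
have /connectP[p] := conA c d (subsetP CA _ cC) dA.
elim: p c cC => [|z p IH] c cC /=; first by move=> _ Ed; rewrite Ed cC in dC.
case/andP=> /and3P[cA zA ecz] pp Ed.
have [zC|zC] := boolP (z \in C); first exact: (IH z).
by exists c, z.
Qed.

Lemma cut_rel_connected (T : finType) (e : rel T) (A : {set T}) :
  symmetric e -> A != set0 ->
  (forall C : {set T}, C \subset A -> C != set0 -> C != A ->
     exists x y, [/\ x \in C, y \in A, y \notin C & e x y]) ->
  rel_connected e A.
Proof.
move=> syme A0 H; split=> // x y xA yA; set e' := [rel _ _ | _].
pose C := [set z in A | connect e' x z].
have xC : x \in C by rewrite inE xA connect0.
have [CA|CnA] := eqVneq C A; first by move: yA; rewrite -CA inE => /andP[].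
have [||u [v [uC vA vC euv]]] := H C _ _ CnA.
- by apply/subsetP=> z; rewrite inE => /andP[].
- by apply/set0Pn; exists x.
case/negP: vC; move: uC; rewrite !inE vA /= => /andP[uA xu].
by apply: connect_trans xu (connect1 _); rewrite /= uA vA.
Qed.

Lemma rel_connected1 (T : finType) (e : rel T) (x : T) : rel_connected e [set x].
Proof.
split; first by apply/set0Pn; exists x; rewrite inE.
by move=> y z /set1P-> /set1P->; exact: connect0.
Qed.

Lemma rel_connected_mono (T : finType) (e e' : rel T) (A : {set T}) :
  {in A &, forall x y, e x y -> connect [rel u v : T | [&& u \in A, v \in A & e' u v]] x y} ->
  rel_connected e A -> rel_connected e' A.
Proof.
move=> sub [A0 cA]; split=> // x y xA yA; have := cA x y xA yA.
apply: connect_sub => u v /= /and3P[uA vA euv]; exact: sub.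
Qed.

Lemma rel_connected_sub (T : finType) (e e' : rel T) (A : {set T}) :
  {in A &, subrel e e'} -> rel_connected e A -> rel_connected e' A.
Proof.
move=> sub; apply: rel_connected_mono => x y xA yA exy.
by apply: connect1; rewrite /= xA yA sub.
Qed.

(** Let [C] cut the union. If [C] splits some [F i], an edge inside [F i] crosses it. Otherwise
    every [F i] lies in [C] or misses it, and an [f]-edge leaving the set of indices of the first
    kind yields the crossing edge. *)
Lemma rel_connected_bigcup (I T : finType) (f : rel I) (e : rel T) (J : {set I})
    (F : I -> {set T}) :
  symmetric e -> rel_connected f J -> (forall i, i \in J -> rel_connected e (F i)) ->
  (forall i j, i \in J -> j \in J -> f i j ->
     exists x y, [/\ x \in F i, y \in F j & (x == y) || e x y]) ->
  rel_connected e (\bigcup_(i in J) F i).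
Proof.
move=> syme cJ cF touch.
have [i0 i0J] : exists i, i \in J by case: cJ => /set0Pn.
apply: cut_rel_connected => //.
  have [/set0Pn[x xF] _] := cF _ i0J.
  by apply/set0Pn; exists x; apply/bigcupP; exists i0.
move=> C CA C0 CnA.
have [/existsP[i /and4P[iJ /set0Pn[x]]]|] := boolP [exists i, [&& i \in J, F i :&: C != set0,
   ~~ (F i \subset C) & true]].
  rewrite inE => /andP[xF xC] nFC _.
  have [||| u [v [uC vF vC euv]]] := rel_connected_cut (C := F i :&: C) (cF i iJ).
  - exact: subsetIl.
  - by apply/set0Pn; exists x; rewrite inE xF.
  - by apply: contraNneq nFC => <-; rewrite subsetIr.
  exists u, v; split=> //; first by move: uC; rewrite inE => /andP[].
    by apply/bigcupP; exists i.
  by apply: contra vC; rewrite inE vF.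
move=> /existsPn noi.
have all_or i : i \in J -> F i :&: C != set0 -> F i \subset C.
  by move=> iJ Fi; have := noi i; rewrite iJ Fi /= andbT negbK.
pose J' := [set i in J | F i \subset C].
have [||| i [j [iJ' jJ jJ' fij]]] := rel_connected_cut (C := J') cJ.
- by apply/subsetP=> i; rewrite inE => /andP[].
- case/set0Pn: C0 => x xC; have /bigcupP[i iJ xF] := subsetP CA _ xC.
  apply/set0Pn; exists i; rewrite inE iJ all_or //.
  by apply/set0Pn; exists x; rewrite inE xF.
- apply: contraNneq CnA => J'J; rewrite eqEsubset CA; apply/bigcupsP=> i.
  by rewrite -J'J inE => /andP[].
move: iJ'; rewrite inE => /andP[iJ FiC].
have [x [y [xF yF xy]]] := touch _ _ iJ jJ fij.
have nyC : y \notin C.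
  apply: contra jJ' => yC; rewrite inE jJ all_or //.
  by apply/set0Pn; exists y; rewrite inE yF.
exists x, y; split=> //; first exact: subsetP FiC _ xF.
  by apply/bigcupP; exists j.
by case/orP: xy => // /eqP xy; rewrite -xy (subsetP FiC _ xF) in nyC.
Qed.

Lemma rel_connectedU (T : finType) (e : rel T) (A B : {set T}) :
  symmetric e -> rel_connected e A -> rel_connected e B ->
  (exists x y, [/\ x \in A, y \in B & (x == y) || e x y]) ->
  rel_connected e (A :|: B).
Proof.
move=> syme cA cB [x [y [xA yB xy]]].
have -> : A :|: B = \bigcup_(b in [set: bool]) (if b then A else B).
  apply/setP=> z; rewrite inE; apply/orP/bigcupP.
    by case=> zI; [exists true | exists false]; rewrite ?inE.
  by case=> -[] _; [left|right].
apply: (rel_connected_bigcup (f := fun _ _ => true)) => //.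
- split; first by apply/set0Pn; exists true; rewrite inE.
  by move=> b b' _ _; apply: connect1; rewrite /= !inE.
- by case.
move=> [] [] _ _ _; [exists x, x|exists x, y|exists y, x|exists y, y] => //.
- by rewrite eqxx.
- by rewrite eq_sym syme.
by rewrite eqxx.
Qed.

Lemma connected_path (T : finType) (e : rel T) (a : T) (p : seq T) :
  symmetric e -> path e a p -> rel_connected e [set x in a :: p].
Proof.
move=> syme; elim: p a => [|b p IH] a /=.
  by move=> _; rewrite (_ : [set x in _] = [set a]); [exact: rel_connected1|apply/setP=> x; rewrite !inE].
case/andP=> eab pb; rewrite (_ : [set x in _] = [set a] :|: [set x in b :: p]); last first.
  by apply/setP=> x; rewrite !inE.
apply: (rel_connectedU syme (rel_connected1 e a) (IH b pb)).
by exists a, b; rewrite !inE !eqxx eab orbT.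
Qed.

(** * Neighbourhoods and edge counts *)

Definition nbhd (G : sgraph) (A : {set G}) (x : G) : {set G} := [set y in A | adj x y].

(* Twice the number of edges inside [A]. *)
Definition arcs (G : sgraph) (A : {set G}) : nat := \sum_(x in A) #|nbhd A x|.

Lemma nbhdS (G : sgraph) (A B : {set G}) x : A \subset B -> nbhd A x \subset nbhd B x.
Proof. by move=> AB; apply/subsetP=> y; rewrite !inE => /andP[/(subsetP AB)-> ->]. Qed.

Lemma arcs_exchange (G : sgraph) (A B : {set G}) :
  \sum_(x in A) #|nbhd B x| = \sum_(x in B) #|nbhd A x|.
Proof.
have E (C D : {set G}) : \sum_(x in C) #|nbhd D x| = \sum_(x in C) \sum_(y in D) (adj x y : nat).
  apply: eq_bigr => x _; rewrite -sum1_card big_mkcond [RHS]big_mkcond /=.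
  by apply: eq_bigr => y _; rewrite !inE; case: (y \in D); case: (adj x y).
rewrite !E exchange_big /=; apply: eq_bigr => x _; apply: eq_bigr => y _.
by rewrite adj_sym.
Qed.

Lemma arcs_setD1 (G : sgraph) (A : {set G}) x :
  x \in A -> arcs A = arcs (A :\ x) + 2 * #|nbhd A x|.
Proof.
move=> xA; rewrite /arcs (big_setD1 x) //= addnC mul2n -addnn addnA; congr (_ + _).
have Ex : #|nbhd A x| = \sum_(y in A :\ x) (adj y x : nat).
  rewrite -sum1_card big_mkcond [RHS]big_mkcond /=; apply: eq_bigr => y _.
  rewrite !inE; have [->|_] := eqVneq y x; first by rewrite adj_irr andbF.
  by rewrite /= adj_sym; case: (y \in A); case: (adj _ _).
rewrite Ex -big_split /=; apply: eq_bigr => y yA.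
have -> : nbhd A y = (if adj y x then [set x] else set0) :|: nbhd (A :\ x) y.
  apply/setP=> z; rewrite !inE; have [->|nzx] := eqVneq z x.
    by case: (adj y x); rewrite !inE ?eqxx ?xA.
  by case: (adj y x); rewrite !inE ?(negPf nzx).
rewrite cardsU (_ : _ :&: _ = set0); last first.
  by apply/setP=> z; rewrite !inE; case: (adj y x); rewrite !inE; case: eqP.
by rewrite cards0 subn0 addnC; case: (adj y x); rewrite ?cards1 ?cards0.
Qed.

Lemma arcs_leq (G : sgraph) (A : {set G}) : arcs A <= #|A| * #|A|.-1.
Proof.
rewrite /arcs -sum_nat_const; apply: leq_sum => x xA.
have : nbhd A x \subset A :\ x.
  apply/subsetP=> y; rewrite !inE => /andP[-> xy]; rewrite andbT.
  by apply: contraTneq xy => ->; rewrite adj_irr.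
by move/subset_leq_card; rewrite [#|A|](cardsD1 x) xA.
Qed.

Lemma num_edges_arcs (G : sgraph) : 2 * num_edges G = arcs [set: G].
Proof.
rewrite /num_edges; pose E2 := [set p : G * G | adj p.1 p.2].
have -> : arcs [set: G] = #|E2|.
  rewrite /arcs /= -sum1_card [RHS](eq_bigl (fun p => true && adj p.1 p.2)); last first.
    by move=> p; rewrite inE.
  rewrite -(pair_big_dep xpredT (fun x y => adj x y) (fun _ _ => 1)) /=.
  apply: eq_big => [x|x _]; first by rewrite inE.
  by rewrite -sum1_card; apply: eq_bigl => y; rewrite !inE.
pose g (p : G * G) := [set p.1; p.2].
have -> : #|E2| = \sum_(e in edges G) #|[set p in E2 | g p == e]|.
  rewrite -sum1_card (partition_big g (mem (edges G))) /=.
    by apply: eq_bigr => e _; rewrite -sum1_card; apply: eq_bigl => p; rewrite !inE.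
  move=> [x y]; rewrite !inE /= => xy; apply/existsP; exists x; apply/existsP; exists y.
  by rewrite xy /=.
rewrite mulnC -sum_nat_const; apply: eq_bigr => e; rewrite inE.
case/existsP=> x /existsP[y /andP[xy /eqP->]].
have nxy : x != y by apply: contraTneq xy => ->; rewrite adj_irr.
have -> : [set p in E2 | g p == [set x; y]] = [set (x, y); (y, x)].
  apply/setP=> -[a b]; rewrite !inE /g /= !xpair_eqE; apply/andP/orP.
    case=> ab /eqP Eab.
    have : a \in [set x; y] by rewrite -Eab !inE eqxx.
    have : b \in [set x; y] by rewrite -Eab !inE eqxx orbT.
    have nab : a != b by apply: contraTneq ab => ->; rewrite adj_irr.
    rewrite !inE => /orP[] /eqP Eb /orP[] /eqP Ea; subst; rewrite ?eqxx ?orbT //;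
      by [left|right|rewrite eqxx in nab].
  by case=> /andP[/eqP-> /eqP->]; rewrite ?xy ?(adj_sym y) ?xy ?(setUC [set y]).
by rewrite cards2 xpair_eqE (negPf nxy).
Qed.

(** * Minors *)

Lemma minor_trans (H G K : sgraph) : minor H G -> minor G K -> minor H K.
Proof.
move=> [mu [mucon muadj] mudis] [nu [nucon nuadj] nudis].
exists (fun v => \bigcup_(x in mu v) nu x); first split.
- move=> v; apply: (rel_connected_bigcup (f := @adj G)); first exact: adj_sym.
  + exact: mucon.
  + by move=> x _; apply: nucon.
  by move=> x y _ _ /nuadj[a [b [aA bB ab]]]; exists a, b; rewrite ab orbT.
- move=> u v /muadj[x [y [xA yB /nuadj[a [b [aA bB ab]]]]]].
  by exists a, b; split=> //; apply/bigcupP; [exists x|exists y].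
move=> u v /mudis uv; apply/pred0P=> z /=; apply/negP=> /andP[/bigcupP[x xu zx] /bigcupP[y yv zy]].
have [Exy|/nudis] := eqVneq x y; last by move/pred0P/(_ z); rewrite /= zx zy.
by move/pred0P: uv => /(_ x); rewrite /= xu Exy yv.
Qed.

Lemma minor_subgraph (K G : sgraph) : subgraph K G -> minor K G.
Proof.
move=> [f finj fadj]; exists (fun x => [set f x]); first split.
- by move=> v; apply: rel_connected1.
- by move=> u v /fadj uv; exists (f u), (f v); rewrite !inE.
by move=> u v uv; rewrite disjoints1 inE inj_eq.
Qed.

Definition ind_adj (G : sgraph) (A : {set G}) : rel {x : G | x \in A} :=
  fun x y => adj (val x) (val y).

Lemma ind_adj_sym (G : sgraph) (A : {set G}) : symmetric (@ind_adj G A).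
Proof. by move=> x y; rewrite /ind_adj adj_sym. Qed.

Lemma ind_adj_irr (G : sgraph) (A : {set G}) : irreflexive (@ind_adj G A).
Proof. by move=> x; rewrite /ind_adj adj_irr. Qed.

Definition induced_graph (G : sgraph) (A : {set G}) : sgraph :=
  SGraph (@ind_adj_sym G A) (@ind_adj_irr G A).

Lemma induced_subgraph (G : sgraph) (A : {set G}) : subgraph (induced_graph A) G.
Proof. by exists val => //; apply: val_inj. Qed.

Lemma num_vertices_induced (G : sgraph) (A : {set G}) : num_vertices (induced_graph A) = #|A|.
Proof. by rewrite /num_vertices card_sig. Qed.

Lemma card_nbhd_induced (G : sgraph) (A : {set G}) (x : induced_graph A) :
  #|nbhd [set: induced_graph A] x| = #|nbhd A (val x)|.
Proof.
rewrite -(card_imset _ val_inj); apply: eq_card => y; apply/imsetP/idP.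
  by case=> z; rewrite !inE /= => xz ->; rewrite (valP z).
by rewrite inE => /andP[yA xy]; exists (Sub y yA : induced_graph A); rewrite ?inE.
Qed.

Lemma arcs_induced (G : sgraph) (A : {set G}) : arcs [set: induced_graph A] = arcs A.
Proof.
rewrite /arcs (eq_bigr (fun x : induced_graph A => #|nbhd A (val x)|)); last first.
  by move=> x _; rewrite card_nbhd_induced.
rewrite (eq_bigl xpredT); last by move=> x; rewrite inE.
rewrite [RHS](reindex_omap (val : induced_graph A -> G) insub) /=; last first.
  by move=> x xA; rewrite insubT.
by apply: eq_bigl => x; rewrite (valP x) valK eqxx.
Qed.

(** * Shortest paths *)

Definition inside (T : finType) (e : rel T) (W : {set T}) : rel T :=
  [rel u v | [&& u \in W, v \in W & e u v]].

Lemma path_inside (T : finType) (e : rel T) (W : {set T}) a p :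
  path (inside e W) a p -> path e a p /\ {subset p <= W}.
Proof.
elim: p a => //= b p IH a /andP[/and3P[_ bW ->] /IH[-> sub]]; split=> //.
by move=> x; rewrite inE => /orP[/eqP->|/sub].
Qed.

Lemma shortest_path (T : finType) (e : rel T) (W : {set T}) a b :
  rel_connected e W -> a \in W -> b \in W ->
  exists2 p, path (inside e W) a p /\ last a p = b &
    forall q, path (inside e W) a q -> last a q = b -> size p <= size q.
Proof.
move=> [_ cW] aW bW.
pose P n := [exists t : n.-tuple T, path (inside e W) a t && (last a t == b)].
have exP : exists n, P n.
  have /connectP[p pp Eb] := cW a b aW bW.
  by exists (size p); apply/existsP; exists (in_tuple p); rewrite /= pp Eb eqxx.
case: (ex_minnP exP) => n /existsP[u /andP[pu /eqP lu]] minn.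
exists u => // q pq lq; rewrite size_tuple; apply: minn.
by apply/existsP; exists (in_tuple q); rewrite /= pq lq eqxx.
Qed.

(** Replacing the stretch between the indices [i] and [j] by the walk [r] keeps both ends of [p], so
    minimality of [p] applies. Indices refer to [a :: p], so index 0 is [a]. *)
Lemma shortest_path_shortcut (T : finType) (e : rel T) (W : {set T}) a p :
  path (inside e W) a p ->
  (forall q, path (inside e W) a q -> last a q = last a p -> size p <= size q) ->
  forall i j r, i <= j -> j <= size p ->
    path (inside e W) (nth a (a :: p) i) r ->
    last (nth a (a :: p) i) r = nth a (a :: p) j -> j - i <= size r.
Proof.
move=> pp minp i j r ij jp pr lr.
have lastt k : k <= size p -> last a (take k p) = nth a (a :: p) k.
  case: k => [|k] kp; first by rewrite take0.
  by rewrite (last_nth a) size_takel // -[a :: take _ _]/(take k.+2 (a :: p)) nth_take.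
have ip := leq_trans ij jp.
have Elp : last a p = last (nth a (a :: p) j) (drop j p).
  by rewrite -[in LHS](cat_take_drop j p) last_cat lastt.
have := minp (take i p ++ r ++ drop j p).
rewrite !cat_path !last_cat lastt // pr lr.
have := pp; rewrite -{1}(cat_take_drop i p) cat_path => /andP[-> _].
have := pp; rewrite -{1}(cat_take_drop j p) cat_path lastt // => /andP[_ ->] /=.
rewrite -Elp => /(_ isT erefl).
rewrite !size_cat size_takel // size_drop; lia.
Qed.

Lemma card_ord_window n (S : {set 'I_n}) d :
  (forall i j : 'I_n, i \in S -> j \in S -> i <= j -> j - i <= d) -> #|S| <= d.+1.
Proof.
move=> H; have [->|/set0Pn[i0 i0S]] := eqVneq S set0; first by rewrite cards0.
case: (arg_minnP (fun i : 'I_n => i : nat) i0S) => i iS mini.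
have us : uniq [seq val j | j <- enum S] by rewrite map_inj_uniq ?enum_uniq //; apply: val_inj.
have -> : #|S| = size [seq val j | j <- enum S] by rewrite size_map -cardE.
rewrite -(size_iota i d.+1); apply: uniq_leq_size => // x /mapP[j].
rewrite mem_enum => jS ->; rewrite mem_iota /=.
by have := mini j jS; have := H i j iS jS; lia.
Qed.

(** [I] is the interior of a connection from [a] to [b]. *)
Definition links (G : sgraph) (I : {set G}) (a b : G) : Prop :=
  connected_in (a |: I) /\ exists2 z, z \in a |: I & adj z b.

(** On a shortest path the neighbours of a given vertex have indices at most 2 apart, so there are
    at most three. Counting pairs of a path vertex and a neighbour in [W] in both ways gives (size p
    + 1) m <= 3 |W|. *)
Lemma short_link (G : sgraph) (W : {set G}) a b m :
  connected_in W -> a \in W -> b \in W -> a != b ->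
  (forall x, x \in W -> m <= #|nbhd W x|) ->
  exists I : {set G}, [/\ I \subset W, a \notin I, b \notin I,
    #|I| * m <= 3 * #|W| & links I a b].
Proof.
move=> cW aW bW nab mindeg.
have [p [pp lp] minp] := shortest_path cW aW bW.
have short := shortest_path_shortcut pp (fun q pq lq => minp q pq (etrans lq lp)).
have [p_adj pW] := path_inside pp.
have sW i : i <= size p -> nth a (a :: p) i \in W.
  by case: i => [|i] ip //=; apply: pW; apply: mem_nth.
have deg_sum : (size p).+1 * m <= 3 * #|W|.
  apply: (leq_trans (n := \sum_(i < (size p).+1) #|nbhd W (nth a (a :: p) i)|)).
    rewrite -{1}[(size p).+1]card_ord -sum_nat_const; apply: leq_sum => i _.
    by apply: mindeg; apply: sW; apply: leq_ord.
  apply: (leq_trans (n := \sum_(w in W) #|[set i : 'I_(size p).+1 | adj (nth a (a :: p) i) w]|)).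
    have E1 x : #|nbhd W x| = \sum_(w in W) (adj x w : nat).
      rewrite -sum1_card big_mkcond [RHS]big_mkcond /=.
      by apply: eq_bigr => w _; rewrite !inE; case: (w \in W); case: (adj x w).
    have E2 w : #|[set i : 'I_(size p).+1 | adj (nth a (a :: p) i) w]| =
        \sum_(i < (size p).+1) (adj (nth a (a :: p) i) w : nat).
      rewrite -sum1_card big_mkcond /=.
      by apply: eq_bigr => i _; rewrite !inE; case: (adj _ w).
    by rewrite (eq_bigr _ (fun i _ => E1 _)) [leqRHS](eq_bigr _ (fun w _ => E2 w)) exchange_big.
  rewrite mulnC -sum_nat_const; apply: leq_sum => w wW.
  apply: card_ord_window => i j; rewrite !inE => iw jw ij.
  have := short i j [:: w; nth a (a :: p) j] ij; rewrite /inside /= wW !sW ?leq_ord // iw (adj_sym w) jw.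
  by apply.
have inj i j : i < j -> j <= size p -> nth a (a :: p) i != nth a (a :: p) j.
  move=> ij jp; apply/eqP=> Eij.
  by have := short i j [::] (ltnW ij) jp isT Eij; rewrite leqn0 subn_eq0 leqNgt ij.
case/lastP: p => [|q b'] in pp lp minp short p_adj pW sW deg_sum inj *.
  by move: lp => /= Eab; rewrite Eab eqxx in nab.
move: lp; rewrite last_rcons => Eb; subst b'.
(* The interior: [q] no longer contains the final vertex [b], by [inj], and [a] is taken out
   explicitly. *)
exists ([set x in q] :\ a); split.
- by apply/subsetP=> x; rewrite !inE => /andP[_ xq]; apply: pW; rewrite mem_rcons inE xq orbT.
- by rewrite !inE eqxx.
- rewrite !inE; apply/nandP; right; apply/negP=> bq.
  have /(nthP a)[i iq Ei] := bq.
  have := inj i.+1 (size q).+1; rewrite size_rcons ltnS iq leqnn => /(_ isT isT).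
  by rewrite /= !nth_rcons iq ltnn eqxx Ei eqxx.
- apply: leq_trans deg_sum; rewrite leq_mul2r; apply/orP; right.
  rewrite size_rcons; apply: (leq_trans (n := #|[set x in q]|)).
    by apply: subset_leq_card; apply: subsetDl.
  have : #|[set x in q]| <= size q by rewrite cardsE card_size.
  lia.
move: p_adj; rewrite rcons_path => /andP[pq lq].
rewrite /links (_ : a |: [set x in q] :\ a = [set x in a :: q]); last first.
  by apply/setP=> x; rewrite !inE; case: eqP.
split; first exact: (connected_path (@adj_sym G) pq).
by exists (last a q) => //; rewrite inE mem_last.
Qed.

(** A shortest path has at most two vertices in a clique. Once the dense pieces are turned into
    cliques, this prevents a connecting path from using up a piece that it merely crosses. *)
Lemma thin_connector (G : sgraph) (J : finType) (P : J -> {set G}) (Q A B : {set G}) :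
  (forall j, {in P j &, forall x y, x != y -> adj x y}) ->
  connected_in Q -> Q :&: A != set0 -> Q :&: B != set0 ->
  exists2 Q' : {set G}, Q' \subset Q &
    [/\ connected_in Q', Q' :&: A != set0, Q' :&: B != set0
      & forall j, #|Q' :&: P j| <= 2].
Proof.
move=> clq cQ /set0Pn[a]; rewrite inE => /andP[aQ aA] /set0Pn[b]; rewrite inE => /andP[bQ bB].
have [p [pp lp] minp] := shortest_path cQ aQ bQ.
have short := shortest_path_shortcut pp (fun q pq lq => minp q pq (etrans lq lp)).
have [p_adj pW] := path_inside pp.
have sW i : i <= size p -> nth a (a :: p) i \in Q.
  by case: i => [|i] ip //=; apply: pW; apply: mem_nth.
exists [set x in a :: p].
  by apply/subsetP=> x; rewrite !inE => /orP[/eqP->|/pW].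
split; first exact: (connected_path (@adj_sym G) p_adj).
- by apply/set0Pn; exists a; rewrite !inE eqxx.
- by apply/set0Pn; exists b; rewrite !inE bB -lp -in_cons mem_last.
move=> j; pose S := [set i : 'I_(size p).+1 | nth a (a :: p) i \in P j].
have sub : [set x in a :: p] :&: P j \subset (fun i : 'I_(size p).+1 => nth a (a :: p) i) @: S.
  apply/subsetP=> x; rewrite in_setI in_set => /andP[/(nthP a)[i ip Ex] xP].
  by apply/imsetP; exists (Ordinal ip); rewrite ?inE /= Ex.
apply: leq_trans (subset_leq_card sub) _; apply: leq_trans (leq_imset_card _ _) _.
apply: card_ord_window => i i'; rewrite !inE => iP i'P ii'.
have [Eii|nii] := eqVneq (nth a (a :: p) i) (nth a (a :: p) i').
  by apply: leq_trans (short i i' [::] ii' (leq_ord _) isT Eii) _.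
apply: (short i i' [:: nth a (a :: p) i'] ii') => //; first exact: leq_ord.
by rewrite /inside /= !sW ?leq_ord // (clq j).
Qed.

(** * Greedy choice of disjoint connections *)

(** Every request is served inside its own piece, so requests of different pieces do not compete:
    [kappa] has to cover [U0] and [l] vertices for each request of that piece. *)
Lemma greedy_links (G : sgraph) (Rq J : finType) (pc : Rq -> J) (P : J -> {set G})
    (src tgt : Rq -> G) (U0 : {set G}) (kappa l : nat) :
  (forall i j, i != j -> [disjoint P i & P j]) ->
  (forall r (U : {set G}), #|U :&: P (pc r)| <= kappa ->
     exists I : {set G}, [/\ I \subset P (pc r), [disjoint I & U], #|I| <= l
                           & links I (src r) (tgt r)]) ->
  (forall j, #|U0 :&: P j| + l * #|[set r | pc r == j]| <= kappa) ->
  exists I : Rq -> {set G}, [/\ forall r, I r \subset P (pc r),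
     forall r, [disjoint I r & U0], forall r, #|I r| <= l,
     forall r, links (I r) (src r) (tgt r)
   & forall r r', r != r' -> [disjoint I r & I r']].
Proof.
move=> disP avail cap.
(* The induction on the list of served requests carries the load of every piece, which is what
   [avail] asks for at the next request. *)
suff [I [H1 H2 H3]] : exists I : Rq -> {set G},
    [/\ forall r, r \in enum Rq -> [/\ I r \subset P (pc r), [disjoint I r & U0],
           #|I r| <= l & links (I r) (src r) (tgt r)],
        {in enum Rq &, forall r r', r != r' -> [disjoint I r & I r']}
      & forall j, #|(U0 :|: \bigcup_(r <- enum Rq) I r) :&: P j| <=
                  #|U0 :&: P j| + l * count (fun r => pc r == j) (enum Rq)].
  have inE' r : r \in enum Rq by rewrite mem_enum.
  exists I; split=> [r|r|r|r|r r'].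
  - by case: (H1 r (inE' r)).
  - by case: (H1 r (inE' r)).
  - by case: (H1 r (inE' r)).
  - by case: (H1 r (inE' r)).
  exact: H2.
have sub_cap (s : seq Rq) j : uniq s -> #|U0 :&: P j| + l * count (fun r => pc r == j) s <= kappa.
  move=> us; apply: leq_trans (cap j); rewrite leq_add2l leq_mul2l; apply/orP; right.
  rewrite -size_filter cardE; apply: uniq_leq_size; first exact: filter_uniq.
  by move=> r; rewrite mem_filter mem_enum inE => /andP[].
elim: (enum Rq) (enum_uniq Rq) => [_|r s IH /= /andP[rs us]].
  exists (fun _ => set0); split=> // j.
  by rewrite big_nil setU0 muln0 addn0.
have [I [H1 H2 H3]] := IH us.
set U := U0 :|: \bigcup_(r <- s) I r in H3.
have [Ir [IrP IrU Irl Irlk]] := avail r U (leq_trans (H3 _) (sub_cap _ _ us)).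
have IU r' : r' \in s -> I r' \subset U.
  move=> r's; apply: subset_trans (subsetUr _ _).
  by rewrite bigcup_seq; apply: (bigcup_sup r').
exists (fun r' => if r' == r then Ir else I r'); split.
- move=> r'; rewrite inE; case: eqP => [-> _|_ /= /H1 //]; split=> //.
  by apply: disjointWr IrU; apply: subsetUl.
- move=> r1 r2; rewrite !inE; case: eqP => [->|_] /=; case: eqP => [->|_] //=; rewrite ?eqxx //.
  + by move=> _ r2s _; apply: disjointWr IrU; apply: IU.
  + by move=> r1s _ _; rewrite disjoint_sym; apply: disjointWr IrU; apply: IU.
  by move=> *; apply: H2.
move=> j; rewrite big_cons eqxx.
have -> : \bigcup_(j0 <- s) (if j0 == r then Ir else I j0) = \bigcup_(r <- s) I r.
  apply: eq_big_seq => r' r's; case: eqP => // Er; by rewrite -Er r's in rs.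
rewrite setUCA setIUl mulnDr -[l * _ + _]addnC addnA -/U.
apply: leq_trans (leq_card_setU _ _) _; rewrite addnC; apply: leq_add; first exact: H3.
case: eqP => [Ej|/eqP nEj]; first by rewrite muln1 (leq_trans _ Irl) // subset_leq_card // subsetIl.
have /disjoint_setI0 : [disjoint Ir & P j] by apply: disjointWl (disP _ _ nEj).
by rewrite muln0 => ->; rewrite cards0.
Qed.

(** [mu] is a minor model for a relation [e] with virtual edges. Merging each link into the source
    of its request makes the virtual edge a real one towards the target. Since links avoid each
    other and all of [mu], the branch sets stay disjoint. *)
Lemma patch_minor (G K : sgraph) (e : rel G) (mu : K -> {set G}) (Rq : finType)
    (src tgt : Rq -> G) (I : Rq -> {set G}) :
  (forall c, rel_connected e (mu c)) ->
  (forall c d, adj c d -> exists x y, [/\ x \in mu c, y \in mu d & e x y]) ->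
  (forall c d, c != d -> [disjoint mu c & mu d]) ->
  (forall x y, e x y -> adj x y \/
     exists r, (src r = x /\ tgt r = y) \/ (src r = y /\ tgt r = x)) ->
  (forall r, links (I r) (src r) (tgt r)) ->
  (forall r r', r != r' -> [disjoint I r & I r']) ->
  (forall r c, [disjoint I r & mu c]) ->
  minor K G.
Proof.
move=> mucon muadj mudis eM lk disI disImu.
pose F x := x |: \bigcup_(r | src r == x) I r.
have xF x : x \in F x by rewrite !inE eqxx.
have conF x : connected_in (F x).
  pose J := [set o : option Rq | if o is Some r then src r == x else true].
  pose F' (o : option Rq) := if o is Some r then x |: I r else [set x].
  have -> : F x = \bigcup_(o in J) F' o.
    apply/setP=> z; rewrite !inE; apply/orP/bigcupP.
      case=> [/eqP->|/bigcupP[r rx zI]]; first by exists None; rewrite ?inE.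
      by exists (Some r); rewrite ?inE //= zI orbT.
    case=> -[r|] /=; rewrite !inE; last by left.
    by move=> rx /orP[]; [left|right; apply/bigcupP; exists r].
  have xF' o : x \in F' o by case: o => [r|]; rewrite !inE ?eqxx.
  apply: (rel_connected_bigcup (f := fun _ _ => true)); first exact: adj_sym.
  - split; first by apply/set0Pn; exists None; rewrite inE.
    by move=> o o' oJ o'J; apply: connect1; rewrite /= oJ o'J.
  - case=> [r|] /=; last by move=> _; apply: rel_connected1.
    by rewrite inE => /eqP Er; have [] := lk r; rewrite Er.
  by move=> o o' _ _ _; exists x, x; rewrite eqxx.
have touch x y : e x y -> exists a b, [/\ a \in F x, b \in F y & adj a b].
  have half r : exists2 a, a \in F (src r) & adj a (tgt r).
    have [_ [z zI zt]] := lk r; exists z => //; move: zI; rewrite !inE => /orP[->//|zI].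
    by apply/orP; right; apply/bigcupP; exists r.
  move=> /eM[xy|[r [] [<- <-]]]; first by exists x, y.
  - by have [a aF at_] := half r; exists a, (tgt r).
  by have [a aF at_] := half r; exists (tgt r), a; rewrite adj_sym.
exists (fun c => \bigcup_(x in mu c) F x); first split.
- move=> c; apply: (rel_connected_bigcup (f := e) (@adj_sym G) (mucon c)).
    by move=> x _; apply: conF.
  by move=> x y _ _ /touch[a [b [aF bF ab]]]; exists a, b; rewrite ab orbT.
- move=> c d /muadj[x [y [xc yd /touch[a [b [aF bF ab]]]]]].
  by exists a, b; split=> //; apply/bigcupP; [exists x|exists y].
move=> c d ncd; apply/pred0P=> z /=; apply/negP=> /andP[/bigcupP[x xc zx] /bigcupP[y yd zy]].
have dcd := mudis _ _ ncd.
have nxy : x != y by apply: contraTneq xc => ->; rewrite (disjointFl dcd).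
move: zx zy; rewrite !inE => /orP[/eqP Ezx|/bigcupP[r /eqP Er zr]].
  case/orP=> [/eqP Ezy|/bigcupP[r' _ zr']]; first by rewrite -Ezx Ezy eqxx in nxy.
  by have /disjointFr/(_ zr') := disImu r' c; rewrite Ezx xc.
case/orP=> [/eqP Ezy|/bigcupP[r' /eqP Er' zr']].
  by have /disjointFr/(_ zr) := disImu r d; rewrite Ezy yd.
have nrr : r != r' by apply: contraNneq nxy => Err; rewrite -Er -Er' Err.
by have /disjointFr/(_ zr) := disI _ _ nrr; rewrite zr'.
Qed.

(** * Menger's theorem *)

(** Says without paths that [S] meets every path from [A] to [B]: [C] contains the rest of [A],
    misses [B], and can be left only through [S]. *)
Definition separates (T : finType) (e : rel T) (A B S : {set T}) : Prop :=
  exists C : {set T}, [/\ A :\: S \subset C, [disjoint C & S], [disjoint C & B]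
    & forall u v, u \in C -> e u v -> v \in C :|: S].

(** The [k] disjoint sets use [k] different points of [S], hence all of them, so none of the sets
    can meet [S] twice. *)
Lemma disjoint_transversal (T : finType) k (P : 'I_k -> {set T}) (S : {set T}) :
  #|S| = k -> (forall i j, i != j -> [disjoint P i & P j]) ->
  (forall i, P i :&: S != set0) ->
  exists g : 'I_k -> T, [/\ forall i, P i :&: S = [set g i], injective g & g @: setT = S].
Proof.
move=> cS disP PS.
have PS' i : exists x, x \in P i :&: S by apply/set0Pn.
pose g i := xchoose (PS' i); have gP i : g i \in P i :&: S by apply: xchooseP.
have ginj : injective g.
  move=> i j Eg; apply/eqP; apply/negPn/negP => nij.
  have := gP i; have := gP j; rewrite Eg !inE => /andP[gj _] /andP[gi _].
  by have := disjointFr (disP _ _ nij) gi; rewrite gj.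
have gS : g @: setT = S.
  apply/eqP; rewrite eqEcard card_imset // cardsT card_ord cS leqnn andbT.
  by apply/subsetP=> _ /imsetP[i _ ->]; have := gP i; rewrite inE => /andP[].
exists g; split=> // i; apply/setP=> x; rewrite !inE; apply/andP/eqP => [[xP xS]|->]; last first.
  by have := gP i; rewrite inE => /andP.
move: xS; rewrite -gS => /imsetP[j _ Ex].
have [->//|nij] := eqVneq i j.
have := gP j; rewrite inE -Ex => /andP[xj _].
by have := disjointFr (disP _ _ nij) xP; rewrite xj.
Qed.

(* Göring's argument: if deleting the edge [xy] creates a separator [S] with
   fewer than [k] vertices, then the two sides, with [x |: S] and [y |: S] as
   targets, have fewer edges and still satisfy the hypothesis. *)
Theorem menger (T : finType) (e : rel T) (A B : {set T}) k :
  symmetric e -> irreflexive e ->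
  (forall S, separates e A B S -> k <= #|S|) ->
  exists P : 'I_k -> {set T},
    [/\ forall i, rel_connected e (P i), forall i, P i :&: A != set0,
        forall i, P i :&: B != set0 & forall i j, i != j -> [disjoint P i & P j]].
Proof.
have [n] := ubnP #|[set p | e p.1 p.2]|; elim: n e A B => // n IH e A B ltn syme irre sepk.
have [/set0Pn[[x0 y0]]|] := boolP ([set p | e p.1 p.2] != set0); last first.
  (* Without edges [A :&: B] separates, so it has at least [k] points, and singletons serve as
     connectors. *)
  rewrite negbK => /eqP e0.
  have ne u v : e u v = false by move/setP: e0 => /(_ (u, v)); rewrite !inE.
  have kAB : k <= #|A :&: B|.
    apply: sepk; exists (A :\: B); split.
    - by apply/subsetP=> z; rewrite !inE; case: (z \in A); case: (z \in B).
    - by apply/pred0P=> z /=; rewrite !inE; case: (z \in A); case: (z \in B).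
    - by apply/pred0P=> z /=; rewrite !inE; case: (z \in A); case: (z \in B).
    by move=> u v _; rewrite ne.
  pose g (i : 'I_k) := enum_val (widen_ord kAB i).
  have gAB i : g i \in A :&: B := enum_valP _.
  exists (fun i => [set g i]); split=> [i|i|i|i j nij].
  - exact: rel_connected1.
  - by apply/set0Pn; exists (g i); have := gAB i; rewrite !inE eqxx => /andP[].
  - by apply/set0Pn; exists (g i); have := gAB i; rewrite !inE eqxx => /andP[].
  rewrite disjoints1 inE; apply: contra nij => /eqP/enum_val_inj/(congr1 val) /= Eij.
  exact/eqP/val_inj.
rewrite inE /= => exy0.
pose e' := [rel u v | e u v && ((u, v) != (x0, y0)) && ((u, v) != (y0, x0))].
have syme' : symmetric e'.
  by move=> u v; rewrite /= syme !xpair_eqE (andbC (u == _)) (andbC (u == _)) -!andbA;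
     congr (_ && _); rewrite andbC.
have irre' : irreflexive e' by move=> u; rewrite /= irre.
have ltn' (f : rel T) : subrel f e -> ~~ f x0 y0 -> #|[set p | f p.1 p.2]| < n.
  move=> sub nf; rewrite -ltnS; apply: leq_trans ltn; rewrite ltnS; apply: proper_card; apply/properP; split.
    by apply/subsetP=> p; rewrite !inE => /sub.
  by exists (x0, y0); rewrite inE.
have [sepk'|] := pselect (forall S, separates e' A B S -> k <= #|S|).
  have sub : subrel e' e by move=> u v /= /andP[/andP[]].
  have [|P [P1 P2 P3 P4]] := IH e' A B _ syme' irre' sepk'.
    by apply: ltn' => //=; rewrite eqxx andbF.
  exists P; split=> // i; apply: rel_connected_sub (P1 i) => u v _ _; exact: sub.
case/existsNP => S /not_implyP[[C [AC CS CB clo]] /negP]; rewrite -ltnNge => Sk.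
have [x [y [exy xC yC yS exy_only]]] : exists x y, [/\ e x y, x \in C, y \notin C, y \notin S
    & forall u v, u \in C -> e u v -> v \in C :|: S \/ (u = x /\ v = y)].
  (* [S] is too small to separate for [e], so some edge leaves [C] outside [S]; as [C] is closed for
     [e'], this is the deleted edge in one of its orientations. *)
  have cross : ~ forall u v, u \in C -> e u v -> v \in C :|: S.
    by move=> cl; have := sepk S (ex_intro _ C (And4 AC CS CB cl)); rewrite leqNgt Sk.
  case/existsNP: cross => u /existsNP[v /not_implyP[uC /not_implyP[euv nv]]].
  have key a b : a \in C -> e a b -> b \in C :|: S \/ (a = x0 /\ b = y0) \/ (a = y0 /\ b = x0).
    move=> aC eab; have [E1|n1] := eqVneq (a, b) (x0, y0); first by right; left; case: E1.
    have [E2|n2] := eqVneq (a, b) (y0, x0); first by right; right; case: E2.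
    by left; apply: (clo a b aC); rewrite /= eab n1 n2.
  move: nv; rewrite inE => /negP/norP[vC vS].
  exists u, v; split=> // a b aC eab.
  case: (key u v uC euv) => [|[[? ?]|[? ?]]]; first by rewrite inE (negPf vC) (negPf vS).
    subst u v; case: (key a b aC eab) => [|[[-> ->]|[? ?]]]; [by left|by right|].
    by subst a; rewrite aC in vC.
  subst u v; case: (key a b aC eab) => [|[[? ?]|[-> ->]]]; [by left| |by right].
  by subst a; rewrite aC in vC.
have xS : x \notin S by rewrite (disjointFr CS xC).
(* Adding [x] to [S] blocks the deleted edge too, so [x |: S] separates for [e] and has at least [k]
   points. *)
have kS : #|S| = k.-1 /\ 0 < k.
  suff : k <= #|x |: S| by rewrite cardsU1 xS; lia.
  apply: sepk; exists (C :\ x); split.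
  - apply/subsetP=> z; rewrite !inE negb_or => /andP[/andP[-> zS] zA] /=.
    by apply: (subsetP AC); rewrite inE zS.
  - apply/pred0P=> z /=; rewrite !inE; apply/negP=> /andP[/andP[nzx zC]].
    by rewrite (negPf nzx) (disjointFr CS zC).
  - by apply: disjointWl CB; apply: subsetDl.
  move=> u v; rewrite !inE => /andP[nux uC] euv; case: (exy_only u v uC euv).
    by rewrite inE => /orP[->|->]; rewrite ?orbT // andbT; case: eqP.
  by case=> Eu; rewrite Eu eqxx in nux.
case: kS => cS k0.
have cxS : #|x |: S| = k by rewrite cardsU1 xS cS add1n prednK.
have cyS : #|y |: S| = k by rewrite cardsU1 yS cS add1n prednK.
pose e1 := [rel u v | [&& u \in C :|: S, v \in C :|: S & e u v]].
pose e2 := [rel u v | [&& u \notin C, v \notin C & e u v]].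
have ltn2 (f : rel T) : symmetric f -> subrel f e -> ~~ (f x y : bool) -> #|[set p | f p.1 p.2]| < n.
  move=> symf sub nf; rewrite -ltnS; apply: leq_trans ltn; rewrite ltnS; apply: proper_card; apply/properP; split.
    by apply/subsetP=> p; rewrite !inE => /sub.
  by exists (x, y); rewrite inE.
have sub1 : subrel e1 e by move=> u v /= /and3P[].
have sub2 : subrel e2 e by move=> u v /= /and3P[].
have sy1 : symmetric e1 by move=> u v /=; rewrite syme andbCA.
have sy2 : symmetric e2 by move=> u v /=; rewrite syme andbCA.
have ir1 : irreflexive e1 by move=> u /=; rewrite irre !andbF.
have ir2 : irreflexive e2 by move=> u /=; rewrite irre !andbF.
have m1 : #|[set p | e1 p.1 p.2]| < n.
  by apply: (ltn2 e1 sy1 sub1); rewrite /= !inE (negPf yC) (negPf yS) /= andbF.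
have m2 : #|[set p | e2 p.1 p.2]| < n by apply: (ltn2 e2 sy2 sub2); rewrite /= xC.
(* Whatever leaves [C] passes through [x |: S], so separating [A] from that set separates [A] from
   [B]. The statement [h2] for the other side is symmetric in spirit, with [C] added to the
   reachable set. *)
have h1 S' : separates e1 A (x |: S) S' -> k <= #|S'|.
  move=> [C' [AC' CS' CB' clo']]; apply: sepk; exists (C' :&: C); split.
  + apply/subsetP=> z zA; have zC' := subsetP AC' _ zA; rewrite inE zC'.
    apply: (subsetP AC); move: zA; rewrite !inE => /andP[_ ->]; rewrite andbT.
    by have := disjointFr CB' zC'; rewrite !inE => /norP[].
  + by apply: disjointWl CS'; apply: subsetIl.
  + by apply: disjointWl CB; apply: subsetIr.
  move=> u v; rewrite inE => /andP[uC' uC] euv.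
  have := disjointFr CB' uC'; rewrite !inE => /norP[nux _].
  case: (exy_only u v uC euv) => [vCS|[Eu]]; last by rewrite Eu eqxx in nux.
  have : v \in C' :|: S' by apply: (clo' u v uC'); rewrite /= vCS inE uC.
  rewrite !inE => /orP[vC'|->]; last by rewrite orbT.
  have := disjointFr CB' vC'; rewrite !inE => /norP[_ vS].
  by move: vCS; rewrite inE (negPf vS) orbF vC' => ->.
have h2 S' : separates e2 (y |: S) B S' -> k <= #|S'|.
  move=> [C' [AC' CS' CB' clo']]; apply: sepk; exists ((C :|: C') :\: S'); split.
  + apply/subsetP=> z; rewrite !inE => /andP[zS' zA]; rewrite zS' /=.
    have [zS|zS] := boolP (z \in S); last by rewrite (subsetP AC) ?inE ?zS.
    by rewrite orbC (subsetP AC') // !inE zS zS' orbT.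
  + by apply/pred0P=> z /=; rewrite !inE; case: (z \in S'); rewrite ?andbF.
  + apply/pred0P=> z /=; rewrite !inE; apply/negP=> /andP[/andP[_ /orP[zC|zC]]].
      by rewrite (disjointFr CB zC).
    by rewrite (disjointFr CB' zC).
  have ySC' z : z \in y |: S -> z \in C' :|: S'.
    by move=> zy; rewrite inE; case: (boolP (z \in S')) => zS'; rewrite ?orbT // (subsetP AC') // inE zS'.
  have fin z : z \in C :|: (C' :|: S') -> z \in (C :|: C') :\: S' :|: S'.
    by rewrite !inE; case: (z \in S'); rewrite ?orbT ?orbF.
  move=> u v; rewrite in_setD in_setU => /andP[uS' uCC'] euv; apply: fin; rewrite in_setU.
  have [vC//|vC /=] := boolP (v \in C).
  have [uC|uC] := boolP (u \in C).
    case: (exy_only u v uC euv) => [|[_ ->]]; last by apply: ySC'; rewrite !inE eqxx.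
    by rewrite inE (negPf vC) /= => vS; apply: ySC'; rewrite inE vS orbT.
  by apply: (clo' u v); [move: uCC'; rewrite (negPf uC)|rewrite /= uC vC].
have [P [P1 P2 P3 P4]] := IH e1 A (x |: S) m1 sy1 ir1 h1.
have [Q [Q1 Q2 Q3 Q4]] := IH e2 (y |: S) B m2 sy2 ir2 h2.
have [gp [gpE gpI gpS]] := disjoint_transversal cxS P4 P3.
have [gq [gqE gqI gqS]] := disjoint_transversal cyS Q4 Q2.
(* A vertex of [P i] other than [gp i] has an [e1]-neighbour in the connected set [P i], so it lies
   where [e1] lives. *)
have PinCS i z : z \in P i -> z \in C :|: S.
  move=> zP; have giP : gp i \in P i :&: (x |: S) by rewrite gpE inE.
  have [->|nz] := eqVneq z (gp i).
    by move: giP; rewrite !inE => /andP[_ /orP[/eqP->|->]]; rewrite ?xC ?orbT.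
  have [||| a [b [/set1P-> _ _ /= /and3P[]//]]] := rel_connected_cut (C := [set z]) (P1 i).
  - by rewrite sub1set.
  - by apply/set0Pn; exists z; rewrite inE.
  by apply: contraNneq nz => Ez; move: giP; rewrite inE -Ez => /andP[/set1P->].
have QinC i z : z \in Q i -> z \notin C.
  move=> zQ; have giQ : gq i \in Q i :&: (y |: S) by rewrite gqE inE.
  have [->|nz] := eqVneq z (gq i).
    by move: giQ; rewrite !inE => /andP[_ /orP[/eqP->//|zS]]; rewrite (disjointFl CS zS).
  have [||| a [b [/set1P-> _ _ /= /and3P[]//]]] := rel_connected_cut (C := [set z]) (Q1 i).
  - by rewrite sub1set.
  - by apply/set0Pn; exists z; rewrite inE.
  by apply: contraNneq nz => Ez; move: giQ; rewrite inE -Ez => /andP[/set1P->].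
(* Matches the ends of the two halves: a point of [S] with itself, and [x] with [y] across the
   deleted edge. *)
pose sg z := if z == x then y else z.
have sgS i : sg (gp i) \in y |: S.
  have : gp i \in x |: S by rewrite -gpS imset_f ?inE.
  by rewrite /sg !inE; case: eqP => //=; rewrite ?eqxx // => _ ->; rewrite orbT.
have ex_h i : exists j, gq j == sg (gp i).
  by have := sgS i; rewrite -gqS => /imsetP[j _ ->]; exists j.
pose h i := xchoose (ex_h i); have hP i : gq (h i) = sg (gp i) by apply/eqP/(xchooseP (ex_h i)).
have gpxS i : gp i \in x |: S by rewrite -gpS imset_f ?inE.
have hI : injective h.
  move=> i j /(congr1 gq); rewrite !hP /sg; case: eqP => [Ei|ni]; case: eqP => [Ej|nj].
  - by move=> _; apply: gpI; rewrite Ei Ej.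
  - by move=> Ey; have := gpxS j; rewrite -Ey !inE (negPf yS) orbF => /eqP Eyx; rewrite Eyx xC in yC.
  - by move=> Ey; have := gpxS i; rewrite Ey !inE (negPf yS) orbF => /eqP Eyx; rewrite Eyx xC in yC.
  exact: gpI.
have gpP i : gp i \in P i by have /setIP[] : gp i \in P i :&: (x |: S) by rewrite gpE inE.
have gqQ i : gq i \in Q i by have /setIP[] : gq i \in Q i :&: (y |: S) by rewrite gqE inE.
(* The halves can meet only in [S], where each has just its own end. *)
have PQ i j : i != j -> [disjoint P i & Q (h j)].
  move=> nij; apply/pred0P=> z /=; apply/negP=> /andP[zP zQ].
  have zS : z \in S by have := PinCS i z zP; rewrite inE (negPf (QinC _ _ zQ)).
  have : z \in P i :&: (x |: S) by rewrite !inE zP zS orbT.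
  have : z \in Q (h j) :&: (y |: S) by rewrite !inE zQ zS orbT.
  rewrite gqE gpE hP => /set1P Ez /set1P Ez'.
  move: Ez; rewrite /sg; case: eqP => [_ Ezy|_ Ez]; first by rewrite -Ezy zS in yS.
  by case/eqP: nij; apply: gpI; rewrite -Ez -Ez'.
exists (fun i => P i :|: Q (h i)); split=> [i|i|i|i j nij].
- apply: rel_connectedU => //.
  + by apply: rel_connected_sub (P1 i) => u v _ _; apply: sub1.
  + by apply: rel_connected_sub (Q1 (h i)) => u v _ _; apply: sub2.
  exists (gp i), (gq (h i)); split; [exact: gpP|exact: gqQ|].
  by rewrite hP /sg; case: (eqVneq (gp i) x) => [->|_]; rewrite ?exy ?orbT ?eqxx.
- by apply: contraNneq (P2 i) => E; rewrite -subset0 -E setSI // subsetUl.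
- by apply: contraNneq (Q3 (h i)) => E; rewrite -subset0 -E setSI // subsetUr.
apply/pred0P=> z /=; rewrite !inE; apply/negP=> /andP[/orP[zi|zi] /orP[zj|zj]].
- by rewrite (disjointFr (P4 _ _ nij) zi) in zj.
- by rewrite (disjointFr (PQ _ _ nij) zi) in zj.
- by rewrite eq_sym in nij; rewrite (disjointFr (PQ _ _ nij) zj) in zi.
by rewrite (disjointFr (Q4 _ _ _) zi) // in zj; rewrite inj_eq.
Qed.

(** * Density-critical sets and minors *)

(** As [arcs] counts edges twice, this is Mader's condition e(W) > D (|W| - b); the bound |W| >= D
    excludes the small sets for which the right side is negative. *)
Definition surplus (G : sgraph) (D b : nat) (W : {set G}) : bool :=
  (D <= #|W|) && (2 * D * #|W| < arcs W + 2 * D * b).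

(** Deleting a vertex of degree at most [D] keeps the edge inequality, so by minimality it can only
    break |W| >= D. Then |W| = D, and D (D - 1) arcs are too few because 2b <= D. *)
Lemma surplus_minimal_degree (G : sgraph) (D b : nat) (W : {set G}) :
  2 * b <= D -> surplus D b W ->
  (forall W' : {set G}, W' \proper W -> ~~ surplus D b W') ->
  forall x, x \in W -> D < #|nbhd W x|.
Proof.
move=> bD /andP[DW crit] minW x xW.
have := minW (W :\ x) (properD1 xW); rewrite /surplus negb_and -ltnNge -leqNgt.
have := arcs_setD1 xW; have := cardsD1 x W; rewrite xW add1n => EW Earcs.
case/orP => H; last by nia.
have {H} EWD : #|W| = D by lia.
have := arcs_leq W; rewrite EWD => aW; move: crit; rewrite EWD; nia.
Qed.

(** If [U] separated [W], both sides, each taken with [U :&: W], would be proper subsets with at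
    least [D] vertices by the degree bound. In the sum of their failed inequalities the vertices of
    [U :&: W] are counted twice, which costs at most 2Db, while the slack 2Db occurs twice; so [W]
    would have no surplus. *)
Lemma surplus_minimal_connected (G : sgraph) (D b : nat) (W : {set G}) :
  2 * b <= D -> surplus D b W ->
  (forall W' : {set G}, W' \proper W -> ~~ surplus D b W') ->
  forall U : {set G}, #|U :&: W| <= b -> connected_in (W :\: U).
Proof.
move=> bD crit minW U Ub.
have deg := surplus_minimal_degree bD crit minW.
have cW : 0 < #|W| by have := arcs_leq W; move: crit; rewrite /surplus; nia.
have DW : D < #|W|.
  have /card_gt0P[x xW] := cW; apply: leq_trans (deg x xW) _.
  by apply: subset_leq_card; apply/subsetP=> y; rewrite inE => /andP[].
apply: cut_rel_connected; first exact: adj_sym.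
  have := cardsID U W; rewrite setIC -card_gt0; lia.
move=> C CWU C0 CnWU.
have [/existsP[x /existsP[y /and4P[]]]|] := boolP [exists x, exists y,
   [&& x \in C, y \in W :\: U, y \notin C & adj x y]]; first by exists x, y.
move=> /existsPn noxy.
have cross x y : x \in C -> y \in W :\: U -> y \notin C -> adj x y = false.
  move=> xC yWU yC; apply: contraNF (noxy x) => xy.
  by apply/existsP; exists y; rewrite xC yWU yC.
have CW : C \subset W by apply: subset_trans CWU (subsetDl _ _).
pose A := C :|: (U :&: W); pose B := W :\: C.
have AW : A \subset W by rewrite subUset CW subsetIr.
have BW : B \subset W by apply: subsetDl.
have /set0Pn[x0 x0C] := C0.
have /set0Pn[y0] : (W :\: U) :\: C != set0.
  by rewrite setD_eq0; apply: contra CnWU => WUC; rewrite eqEsubset CWU.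
rewrite 2!inE => /and3P[y0C y0U y0W].
have Asub x : x \in C -> nbhd W x \subset A.
  move=> xC; apply/subsetP=> y; rewrite !inE => /andP[yW xy]; rewrite yW andbT.
  case: (boolP (y \in C)) => //= yC; apply: contraLR xy => yU.
  by rewrite cross // inE yU yW.
have Bsub y : y \in B -> y \notin U -> nbhd W y \subset B.
  move=> yB yU; apply/subsetP=> x; rewrite !inE => /andP[xW xy]; rewrite xW andbT.
  move: yB; rewrite inE => /andP[yC yW]; apply: contraL xy => xC.
  by rewrite adj_sym cross // inE yU yW.
have x0W := subsetP CW _ x0C.
have DA : D <= #|A|.
  apply: leq_trans (subset_leq_card (Asub _ x0C)); apply: ltnW; exact: deg.
have DB : D <= #|B|.
  apply: leq_trans (subset_leq_card (Bsub y0 _ y0U)); last by rewrite inE y0C.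
  by apply: ltnW; apply: deg.
have pA : A \proper W.
  apply/properP; split=> //; exists y0 => //.
  by rewrite !inE (negPf y0C) (negPf y0U).
have pB : B \proper W.
  by apply/properP; split=> //; exists x0 => //; rewrite inE x0C.
have cAB : #|A| + #|B| = #|W| + #|U :&: W|.
  have CU : C :&: (U :&: W) = set0.
    apply/setP=> z; rewrite !inE; apply/negP=> /and3P[zC zU _].
    by have := subsetP CWU _ zC; rewrite inE zU.
  have := cardsID C W; rewrite (setIidPr CW) => EW.
  by rewrite cardsU CU cards0 subn0 -EW; apply: addnAC.
have arcsAB : arcs W <= arcs A + arcs B.
  rewrite {2 3}/arcs [X in X + _]big_mkcond [X in _ + X]big_mkcond -big_split /=.
  rewrite /arcs [leqLHS]big_mkcond; apply: leq_sum => x _.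
  case: (boolP (x \in W)) => // xW.
  have [xC|xC] := boolP (x \in C).
    have -> : x \in A by rewrite inE xC.
    by rewrite (leq_trans (subset_leq_card _) (leq_addr _ _)) //; apply/subsetP=> y yN;
       rewrite inE (subsetP (Asub x xC) _ yN); move: yN; rewrite inE => /andP[].
  have xB : x \in B by rewrite inE xC.
  rewrite xB; have [xU|xU] := boolP (x \in U); last first.
    rewrite (leq_trans (subset_leq_card _) (leq_addl _ _)) //; apply/subsetP=> y yN.
    by rewrite inE (subsetP (Bsub x xB xU) _ yN); move: yN; rewrite inE => /andP[].
  have -> : x \in A by rewrite !inE xU xW orbT.
  apply: leq_trans (leq_card_setU _ _); apply: subset_leq_card; apply/subsetP=> y.
  by rewrite !inE => /andP[-> ->]; case: (y \in C); rewrite ?orbT ?andbT.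
have := minW _ pA; have := minW _ pB; rewrite /surplus DA DB /= -!leqNgt.
have H : 2 * D * #|A| + 2 * D * #|B| <= 2 * D * #|W| + 2 * D * b.
  by rewrite -!mulnDr leq_mul2l cAB leq_add2l Ub orbT.
case/andP: crit => _; move: arcsAB H.
move: (arcs W) (arcs A) (arcs B) (2 * D * #|A|) (2 * D * #|B|) (2 * D * #|W|) (2 * D * b).
clear; lia.
Qed.

Lemma surplus_subset (G : sgraph) (D b : nat) (W0 : {set G}) :
  2 * b <= D -> surplus D b W0 ->
  exists W : {set G}, [/\ W \subset W0, surplus D b W,
    forall x, x \in W -> D < #|nbhd W x|
  & forall U : {set G}, #|U :&: W| <= b -> connected_in (W :\: U)].
Proof.
move=> bD crit; have [W /minsetP[crW minW] WW0] := minset_exists (P := surplus D b) crit.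
have minW' (W' : {set G}) : W' \proper W -> ~~ surplus D b W'.
  move=> pW; apply/negP=> cr; have := minW _ cr (proper_sub pW).
  by move: pW => /[swap] ->; rewrite properxx.
exists W; split=> //; first exact: (surplus_minimal_degree bD crW minW').
exact: (surplus_minimal_connected bD crW minW').
Qed.

(** * Contractions and critical minors *)

Definition contract_adj (G : sgraph) (x y : G) : rel {z : G | z \in [set~ y]} :=
  fun u v => (val u != val v) && [|| adj (val u) (val v),
     (val u == x) && adj y (val v) | (val v == x) && adj y (val u)].

Lemma contract_adj_sym (G : sgraph) (x y : G) : symmetric (@contract_adj G x y).
Proof.
move=> u v; rewrite /contract_adj eq_sym adj_sym; congr (_ && (_ || _)); exact: orbC.
Qed.

Lemma contract_adj_irr (G : sgraph) (x y : G) : irreflexive (@contract_adj G x y).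
Proof. by move=> u; rewrite /contract_adj eqxx. Qed.

Definition contract (G : sgraph) (x y : G) : sgraph :=
  SGraph (@contract_adj_sym G x y) (@contract_adj_irr G x y).

Lemma num_vertices_contract (G : sgraph) (x y : G) :
  num_vertices G = (num_vertices (contract x y)).+1.
Proof.
rewrite /num_vertices card_sig (_ : #|_| = #|G|.-1); last by rewrite -(cardsC1 y); apply: eq_card.
by rewrite prednK //; apply/card_gt0P; exists y.
Qed.

Lemma minor_contract (G : sgraph) (x y : G) : adj x y -> minor (contract x y) G.
Proof.
move=> xy.
have nxy : x != y by apply: contraTneq xy => ->; rewrite adj_irr.
pose mu (z : contract x y) := if val z == x then [set x; y] else [set val z].
have zmu (z : contract x y) : val z \in mu z.
  by rewrite /mu; case: eqP => [->|_]; rewrite !inE eqxx.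
have ymu (z : contract x y) : val z == x -> y \in mu z.
  by rewrite /mu => ->; rewrite !inE eqxx orbT.
exists mu; first split.
- move=> z; rewrite /mu; case: eqP => _; last exact: rel_connected1.
  apply: rel_connectedU; [exact: adj_sym|exact: rel_connected1|exact: rel_connected1|].
  by exists x, y; rewrite !inE !eqxx xy orbT.
- move=> u v /andP[_ /or3P[uv|/andP[ux yv]|/andP[vx yu]]].
  + by exists (val u), (val v).
  + by exists y, (val v); split=> //; apply: ymu.
  by exists (val u), y; split=> //; [exact: ymu|rewrite adj_sym].
move=> u v nuv; have nuv' : val u != val v by rewrite (inj_eq val_inj).
have := valP u; have := valP v; rewrite !inE => vy uy.
apply/pred0P=> z /=; rewrite /mu; apply/negP=> /andP[].
case: eqP => [ux|_]; case: eqP => [vx|_]; rewrite !inE.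
- by rewrite ux vx eqxx in nuv'.
- by case/orP=> /eqP-> /eqP Ev; [rewrite ux Ev eqxx in nuv'|rewrite -Ev eqxx in vy].
- by move=> /eqP-> /orP[] /eqP Eu; [rewrite vx Eu eqxx in nuv'|rewrite Eu eqxx in uy].
by move=> /eqP-> /eqP Euv; rewrite Euv eqxx in nuv'.
Qed.

(** Contraction loses the edge itself and one edge for every common neighbour of its ends, and each
    counts twice in [arcs]. *)
Lemma arcs_contract (G : sgraph) (x y : G) : adj x y ->
  arcs [set: G] <= arcs [set: contract x y] + 2 * #|nbhd (nbhd setT x) y|.+1.
Proof.
move=> xy; have nxy : x != y by apply: contraTneq xy => ->; rewrite adj_irr.
pose Nc z := [set w in [set~ y] | (z != w) && [|| adj z w, (z == x) && adj y w | (w == x) && adj y z]].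
have cNc (z : contract x y) : #|nbhd setT z| = #|Nc (val z)|.
  rewrite -(card_imset _ val_inj); apply: eq_card => w; apply/imsetP/idP.
    by case=> v; rewrite inE => /andP[_ zv] ->; rewrite inE (valP v).
  by rewrite inE => /andP[wy zw]; exists (Sub w wy : contract x y); rewrite ?inE.
have -> : arcs [set: contract x y] = \sum_(z in [set~ y]) #|Nc z|.
  rewrite /arcs (eq_bigr (fun z : contract x y => #|Nc (val z)|)); last by move=> z _; apply: cNc.
  rewrite (eq_bigl xpredT); last by move=> z; rewrite inE.
  rewrite [RHS](reindex_omap (val : contract x y -> G) insub) /=; last first.
    by move=> z zy; rewrite insubT.
  by apply: eq_bigl => z; rewrite (valP z) valK eqxx.
have xin : x \in [set~ y] by rewrite !inE.
have xin' : x \in [set: G] :\ y by rewrite !inE nxy.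
rewrite /arcs (big_setD1 y (in_setT y)) /= (big_setD1 x xin') /= (big_setD1 x xin) /=.
have -> : [set~ y] :\ x = [set: G] :\ y :\ x by apply/setP=> z; rewrite !inE andbT.
set S := [set: G] :\ y :\ x.
have Hx : #|nbhd setT y| + #|nbhd setT x| <= #|Nc x| + #|nbhd (nbhd setT x) y| + 2.
  rewrite -cardsUI addnC; set I := _ :&: _.
  have -> : #|I| = #|nbhd (nbhd setT x) y|.
    by apply: eq_card => z; rewrite !inE andbC.
  rewrite addnC addnAC leq_add2r.
  have : nbhd setT y :|: nbhd setT x \subset Nc x :|: [set x; y].
    apply/subsetP=> z; rewrite !inE eqxx /= (eq_sym x z); case: (z == y); rewrite ?orbT //=.
    by case: (z == x) => //=; case: (adj x z); case: (adj y z).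
  move/subset_leq_card/leq_trans; apply; apply: leq_trans (leq_card_setU _ _) _.
  by rewrite cards2 nxy.
(* A vertex that sees both [x] and [y] loses one neighbour; one that sees only [y] gets [x] in
   exchange. *)
have Hz z : z \in S -> #|nbhd setT z| <= #|Nc z| + (adj x z && adj y z).
  rewrite !inE => /and3P[nzx nzy _].
  have [yz|yz] := boolP (adj y z); last first.
    rewrite andbF addn0; apply: subset_leq_card; apply/subsetP=> w; rewrite !inE /= => zw.
    have -> : w != y by apply: contraNneq yz => <-; rewrite adj_sym.
    have -> : z != w by apply: contraTneq zw => ->; rewrite adj_irr.
    by rewrite zw.
  have [xz|xz] := boolP (adj x z).
    rewrite addn1; apply: (leq_trans (n := #|y |: Nc z|)); last by rewrite cardsU1; case: (y \notin _).
    apply: subset_leq_card; apply/subsetP=> w; rewrite !inE /= => zw; case: eqP => //= _.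
    have -> : z != w by apply: contraTneq zw => ->; rewrite adj_irr.
    by rewrite zw.
  have yN : y \in nbhd setT z by rewrite !inE adj_sym yz.
  have xn : x \notin nbhd setT z :\ y by rewrite !inE /= (adj_sym z) (negPf xz) andbF.
  rewrite /= addn0 (cardsD1 y) yN.
  have <- : #|x |: (nbhd setT z :\ y)| = true + #|nbhd setT z :\ y| by rewrite cardsU1 xn.
  apply: subset_leq_card; apply/subsetP=> w; rewrite !inE /=.
  case/orP=> [/eqP->|/andP[wy zw]]; first by rewrite nxy nzx eqxx yz !orbT.
  rewrite wy zw andbT; apply: contraTneq zw => ->; by rewrite adj_irr.
have Hs : \sum_(z in S) (adj x z && adj y z : nat) <= #|nbhd (nbhd setT x) y|.
  rewrite -sum1_card big_mkcond [leqRHS]big_mkcond /=; apply: leq_sum => z _.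
  by rewrite !inE /=; case: (adj x z); case: (adj y z); case: ifP.
have : \sum_(z in S) #|nbhd setT z| <= \sum_(z in S) (#|Nc z| + (adj x z && adj y z)) by apply: leq_sum.
rewrite big_split /=; move: Hx Hs.
move: (#|Nc x|) (#|nbhd setT x|) (#|nbhd setT y|) (#|nbhd (nbhd _ _) _|) (\sum_(z in S) _) (\sum_(z in S) _) (\sum_(z in S) _).
clear; lia.
Qed.

(** A minor with surplus and fewest vertices is taken. Deleting vertices must destroy the surplus,
    which gives degree and connectivity; so must contracting an edge, which puts every edge into at
    least D - 1 triangles. *)
Lemma critical_minor (G0 : sgraph) (D b : nat) :
  2 * b <= D -> 0 < b -> surplus D b [set: G0] ->
  exists G : sgraph, [/\ minor G G0, surplus D b [set: G],
    forall x : G, D < #|nbhd setT x|,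
    forall U : {set G}, #|U| <= b -> connected_in (~: U)
  & (forall x y : G, adj x y -> D <= #|nbhd (nbhd setT x) y|.+1)
    /\ arcs [set: G] <= 2 * D * num_vertices G].
Proof.
move=> bD b0.
have [n] := ubnP (num_vertices G0); elim: n G0 => // n IH G0 ltn crit.
have [[G1 [m1 c1 l1]]|nosmaller] := pselect (exists G1, [/\ minor G1 G0, surplus D b [set: G1]
   & num_vertices G1 < num_vertices G0]).
  have [|G [m2 H1 H2 H3 H4]] := IH G1 _ c1; first by apply: leq_trans l1 _.
  by exists G; split=> //; apply: minor_trans m2 m1.
have minW (W : {set G0}) : W \proper setT -> ~~ surplus D b W.
  move=> pW; apply/negP=> cr; case: nosmaller; exists (induced_graph W); split.
  - exact/minor_subgraph/induced_subgraph.
  - by rewrite /surplus arcs_induced cardsT -[#|_|]/(num_vertices _) num_vertices_induced.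
  by rewrite num_vertices_induced /num_vertices -cardsT; apply: proper_card.
have deg (x : G0) : D < #|nbhd setT x|.
  exact: (surplus_minimal_degree bD crit minW (in_setT x)).
have cv : #|[set: G0]| = num_vertices G0 by rewrite cardsT.
have Dv : D < num_vertices G0.
  have : 0 < #|[set: G0]| by have := arcs_leq [set: G0]; move: crit; rewrite /surplus; nia.
  case/card_gt0P=> x _; apply: leq_trans (deg x) _.
  by rewrite -cv; apply: subset_leq_card; apply: subsetT.
exists G0; split=> //.
- by exists (fun x => [set x]); [split; [move=> v; exact: rel_connected1|
    by move=> u v uv; exists u, v; rewrite !inE] | move=> u v uv; rewrite disjoints1 inE].
- move=> U Ub; rewrite -setTD; apply: (surplus_minimal_connected bD crit minW).
  by rewrite setIT.
split.
  move=> x y xy; rewrite leqNgt; apply/negP=> lt; case: nosmaller.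
  exists (contract x y); split; [exact: minor_contract| |by rewrite (num_vertices_contract x y)].
  have Ecv : #|[set: contract x y]| = (num_vertices G0).-1.
    by rewrite cardsT -/(num_vertices _) (num_vertices_contract x y).
  rewrite /surplus Ecv; have := arcs_contract xy; case/andP: crit => _; rewrite cv; move: lt Dv.
  move: (arcs _) (arcs _) (num_vertices G0) (#|nbhd (nbhd _ _) _|); clear.
  move=> a a' [|v] k kD Dv crit aa'; first by rewrite ltn0 in Dv.
  by apply/andP; split; [lia|nia].
(* The upper bound on [arcs] comes from averaging over all [x] the failure of the surplus after
   deleting [x]; b >= 1 absorbs the degree terms. *)
have drop (x : G0) : arcs [set: G0] + 2 * D * b <= 2 * D * (num_vertices G0).-1 + 2 * #|nbhd setT x|.
  have := minW ([set: G0] :\ x) (properD1 (in_setT x)); rewrite /surplus negb_and -ltnNge -leqNgt.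
  have := arcs_setD1 (in_setT x); have := cardsD1 x [set: G0]; rewrite inE cv add1n => Ev.
  rewrite Ev; move: Ev Dv => ->; move: (arcs _) (arcs _) #|_| #|_|; clear => a a' d m Dm Ea.
  by case/orP; lia.
have : \sum_(x : G0) (arcs [set: G0] + 2 * D * b) <=
       \sum_(x : G0) (2 * D * (num_vertices G0).-1 + 2 * #|nbhd setT x|).
  by apply: leq_sum => x _; apply: drop.
have E2 : \sum_(x : G0) 2 * #|nbhd setT x| = 2 * arcs [set: G0].
  by rewrite /arcs big_distrr; apply: eq_bigl => x; rewrite inE.
rewrite big_split [X in _ <= X]big_split /= !sum_nat_const E2 (_ : #|_| = num_vertices G0); last exact: eq_card.
move: (num_vertices G0) (arcs _) Dv; clear -b0 bD => v a Dv H.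
have Ev : v = v.-2.+2 by lia.
have : v.-2 * a <= v.-2 * (2 * D * v) by rewrite Ev in H *; nia.
by rewrite leq_pmul2l //; lia.
Qed.

(** * Many disjoint dense pieces, or a small dense subgraph *)

(** Thus [P] has O(D) vertices and at least D / (8g) edges per vertex, so its size is also at least
    a constant times [D]. *)
Definition dense_piece (G : sgraph) (D g : nat) (P : {set G}) : Prop :=
  #|P| <= 4 * D /\ D * D <= g * arcs P.

(** Pieces are added as long as some dense piece avoids the union [Y] of those already found; when
    this stops early, [Y] meets all dense pieces. *)
Lemma disjoint_pieces (G : sgraph) (D g L : nat) :
  (exists P : 'I_L -> {set G}, (forall i, dense_piece D g (P i)) /\
     forall i j, i != j -> [disjoint P i & P j]) \/
  (exists Y : {set G}, #|Y| <= 4 * D * L /\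
     forall P : {set G}, dense_piece D g P -> ~~ [disjoint P & Y]).
Proof.
elim: L => [|L [[P [dP disP]]|[Y [cY HY]]]].
- by left; exists (fun _ => set0); split; case.
- pose Y := \bigcup_i P i.
  have cY : #|Y| <= 4 * D * L.
    apply: leq_trans (_ : \sum_i #|P i| <= _).
      apply: (big_ind2 (fun (A : {set G}) n => #|A| <= n)); rewrite ?cards0 //.
      by move=> A n B m An Bm; apply: leq_trans (leq_card_setU _ _) (leq_add An Bm).
    rewrite mulnC -[X in X * _]card_ord -sum_nat_const; apply: leq_sum => i _.
    by case: (dP i).
  have [[Q [dQ QY]]|noQ] := pselect (exists Q, dense_piece D g Q /\ [disjoint Q & Y]).
    left; exists (fun i => if unlift ord_max i is Some j then P j else Q); split.
      by move=> i; case: unliftP.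
    have QP j : [disjoint Q & P j] by apply: disjointWr QY; apply: (bigcup_sup j).
    move=> i i'; case: unliftP => [j ->|->]; case: unliftP => [j' ->|->].
    + by rewrite (inj_eq lift_inj) => /disP.
    + by rewrite disjoint_sym QP.
    + by rewrite QP.
    by rewrite eqxx.
  right; exists Y; split; first by apply: leq_trans cY _; rewrite leq_mul2l leqnSn orbT.
  by move=> Q dQ; apply/negP=> QY; apply: noQ; exists Q.
right; exists Y; split=> //; apply: leq_trans cY _; by rewrite leq_mul2l leqnSn orbT.
Qed.

(** The neighbours of [x] outside [Y] do not form a dense piece, so they span few edges, yet each
    has at least D - 1 common neighbours with [x]. Hence either few neighbours of [x] are outside
    [Y], or most of these common neighbours are in [Y]. The constant r * r lets each alternative
    lose about D / r. *)
Lemma low_vertex_cover (G : sgraph) (D r : nat) (Y : {set G}) (x : G) :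
  0 < r -> r <= D -> D < #|nbhd setT x| -> #|nbhd setT x| <= 4 * D ->
  (forall y : G, adj x y -> D <= #|nbhd (nbhd setT x) y|.+1) ->
  (forall P : {set G}, dense_piece D (r * r) P -> ~~ [disjoint P & Y]) ->
  r * D <= r * #|nbhd Y x| + 2 * D.
Proof.
move=> r0 rD degx lowx tri noP.
pose M := nbhd setT x :\: Y.
have MN : M \subset nbhd setT x by apply: subsetDl.
have arcsM : r * r * arcs M < D * D.
  rewrite ltnNge; apply/negP=> aM; have /negP := noP M (conj (leq_trans (subset_leq_card MN) lowx) aM).
  by apply; apply/pred0P=> z /=; rewrite !inE; case: (z \in Y); rewrite ?andbF.
have cN : #|nbhd setT x| = #|nbhd Y x| + #|M|.
  rewrite -(cardsID Y); congr (_ + _); apply: eq_card => z; rewrite !inE /=; exact: andbC.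
have sumM : #|M| * D <= arcs M + #|M| * #|nbhd Y x|.+1.
  rewrite /arcs -!sum_nat_const -big_split /=; apply: leq_sum => y yM.
  have xy : adj x y by move: (subsetP MN _ yM); rewrite !inE.
  apply: leq_trans (tri y xy) _; rewrite addnS ltnS.
  apply: leq_trans (leq_card_setU _ _); apply: subset_leq_card.
  apply/subsetP=> z; rewrite !inE /= => /andP[-> ->].
  by case: (z \in Y).
move: #|M| #|nbhd Y x| (arcs M) arcsM cN sumM => m t a arcsM cN sumM.
have [|lt] := leqP (r * m) D; first by nia.
have [|ltt] := leqP D t.+1; first by nia.
have [k Ek] : exists k, D = t.+1 + k by exists (D - t.+1); lia.
have mk : m * k <= a by rewrite Ek in sumM; nia.
have : r * k <= D.
  rewrite leqNgt; apply/negP=> Dk.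
  have : D * D < (r * m) * (r * k) by apply: ltn_mul.
  nia.
nia.
Qed.

(** Vertices of low degree outside [Y] have nearly [D] neighbours in [Y]. Adding to [Y] a set of
    them [r] times as large as the bound on |Y| makes the average degree nearly 2D. If there are too
    few of them, [G] itself has O(D) vertices, because by the edge bound at most half of its
    vertices have high degree. *)
Lemma dense_dichotomy (G : sgraph) (D b r L : nat) :
  2 < r -> r <= D -> r * b <= D -> 0 < L -> surplus D b [set: G] ->
  (forall x : G, D < #|nbhd setT x|) ->
  (forall x y : G, adj x y -> D <= #|nbhd (nbhd setT x) y|.+1) ->
  arcs [set: G] <= 2 * D * num_vertices G ->
  (exists P : 'I_L -> {set G}, (forall i, dense_piece D (r * r) (P i)) /\
     forall i j, i != j -> [disjoint P i & P j]) \/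
  (exists W : {set G}, [/\ 0 < #|W|, #|W| <= 8 * L * r.+1 * D
     & 2 * r * D * #|W| <= r * arcs W + 6 * D * #|W|]).
Proof.
move=> r2 rD rb L0 /andP[DV crit] deg tri eub.
have [|[Y [cY noP]]] := disjoint_pieces G D (r * r) L; [by left|right].
pose Hi := [set x : G | 4 * D < #|nbhd setT x|].
pose Lw := ~: (Hi :|: Y).
have cV : #|[set: G]| = num_vertices G by rewrite cardsT.
have cHi : 2 * #|Hi| <= num_vertices G.
  have : #|Hi| * (4 * D) <= arcs [set: G].
    rewrite -sum_nat_const /arcs [leqRHS](big_setID Hi) /= setTI.
    apply: leq_trans (leq_addr _ _); apply: leq_sum => x; rewrite inE; exact: ltnW.
  have : 0 < D by lia.
  nia.
have cLw : num_vertices G <= #|Hi| + #|Y| + #|Lw|.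
  rewrite -[num_vertices G](cardsC (Hi :|: Y)) leq_add2r.
  exact: leq_card_setU.
have LwY x : x \in Lw -> r * D <= r * #|nbhd Y x| + 2 * D.
  rewrite !inE negb_or -leqNgt => /andP[low _].
  by apply: low_vertex_cover noP => //; [lia|exact: tri].
have D0 : 0 < D by lia.
have [mLw|Lwm] := leqP (4 * D * L * r) #|Lw|; last first.
  exists setT; move: crit DV; rewrite cV; move: cHi cLw cY Lwm.
  move: #|Hi| #|Y| #|Lw| (num_vertices G) (arcs _) => hi y lw v a; move: D0 rb L0 r2; clear.
  move=> D0 rb L0 r2 cHi cLw cY Lwm crit DV; split; first by lia.
    have : v <= 2 * (4 * D * L + 4 * D * L * r) by lia.
    by move/leq_trans; apply; rewrite mulnS; nia.
  have : r * (2 * D * v) <= r * (a + 2 * D * b) by rewrite leq_mul2l (ltnW crit) orbT.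
  have : r * (2 * D * b) <= 2 * D * v by rewrite mulnCA leq_mul2l (leq_trans rb DV) orbT.
  rewrite mulnDr; have -> : 2 * r * D * v = r * (2 * D * v) by lia.
  lia.
have [W0 W0L cW0] : exists2 W0 : {set G}, W0 \subset Lw & #|W0| = 4 * D * L * r.
  pose s := take (4 * D * L * r) (enum Lw).
  exists [set x in s].
    by apply/subsetP=> x; rewrite inE => /mem_take; rewrite mem_enum.
  rewrite cardsE (card_uniqP _) ?size_takel -?cardE //.
  by apply: take_uniq; apply: enum_uniq.
have W0Y : [disjoint W0 & Y].
  apply/pred0P=> z /=; apply/negP=> /andP[/(subsetP W0L)]; rewrite !inE negb_or => /andP[_ /negPf->].
  by [].
have cW : #|Y :|: W0| = #|Y| + #|W0| by rewrite cardsU setIC disjoint_setI0 // cards0 subn0.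
have W0pos : 0 < #|W0| by rewrite cW0 !muln_gt0 D0 L0 (leq_trans _ r2).
exists (Y :|: W0); rewrite cW; split; first by rewrite addn_gt0 W0pos orbT.
  rewrite cW0; apply: leq_trans (leq_add cY (leqnn _)) _; clear; nia.
have aW : 2 * \sum_(x in W0) #|nbhd Y x| <= arcs (Y :|: W0).
  rewrite mul2n -addnn {1}arcs_exchange /arcs [leqRHS](big_setID Y) /=.
  have -> : (Y :|: W0) :&: Y = Y by rewrite setUK.
  have -> : (Y :|: W0) :\: Y = W0 by rewrite setDUl setDv set0U; apply/setDidPl.
  by apply: leq_add; apply: leq_sum => x _; apply: subset_leq_card; apply: nbhdS;
     rewrite ?subsetUl ?subsetUr.
have sY : #|W0| * (r * D) <= r * \sum_(x in W0) #|nbhd Y x| + #|W0| * (2 * D).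
  rewrite big_distrr /= -!sum_nat_const -big_split /=; apply: leq_sum => x xW.
  by apply: LwY; apply: (subsetP W0L).
have cYW : r * #|Y| <= #|W0|.
  by rewrite cW0 mulnC leq_mul2r cY orbT.
move: (arcs _) (\sum_(x in W0) _) #|W0| #|Y| aW sY cYW; clear => a s w y aW sY cYW.
have H1 : 2 * (w * (r * D)) <= r * a + 2 * (w * (2 * D)).
  have : r * (2 * s) <= r * a by rewrite leq_mul2l aW orbT.
  lia.
have H2 : 2 * D * (r * y) <= 2 * D * w by rewrite leq_mul2l cYW orbT.
lia.
Qed.

(** * Splitting a graph into small overlapping pieces *)

Definition covering (H : sgraph) (J : finType) (V : J -> {set H}) : Prop :=
  (forall u : H, exists j, u \in V j) /\
  (forall u v : H, adj u v -> exists j, (u \in V j) && (v \in V j)).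

Definition clone_adj (H : sgraph) (J : finType) (V : J -> {set H}) (home : H -> J) :
    rel {p : H * J | p.1 \in V p.2} :=
  fun c d => ((val c).2 == (val d).2) && adj (val c).1 (val d).1 ||
    [&& (val c).1 == (val d).1, (val c).2 != (val d).2 &
        ((val c).2 == home (val c).1) || ((val d).2 == home (val d).1)].

Lemma clone_adj_sym (H : sgraph) (J : finType) (V : J -> {set H}) (home : H -> J) :
  symmetric (clone_adj (V := V) home).
Proof.
by move=> c d; rewrite /clone_adj adj_sym (eq_sym (val c).2) (eq_sym (val c).1) orbC
  (orbC ((val c).2 == _)) orbC.
Qed.

Lemma clone_adj_irr (H : sgraph) (J : finType) (V : J -> {set H}) (home : H -> J) :
  irreflexive (clone_adj (V := V) home).
Proof. by move=> c; rewrite /clone_adj adj_irr eqxx /= eqxx. Qed.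

(* One clone of [u] for every piece containing [u]; all clones of [u] are
   joined to the one in the piece [home u]. *)
Definition clones (H : sgraph) (J : finType) (V : J -> {set H}) (home : H -> J) : sgraph :=
  SGraph (clone_adj_sym (V := V) home) (@clone_adj_irr H J V home).

Lemma minor_clones (H : sgraph) (J : finType) (V : J -> {set H}) (home : H -> J) :
  covering V -> (forall u, u \in V (home u)) -> minor H (clones V home).
Proof.
move=> [_ covE] hV.
pose mu (u : H) := [set c : clones V home | (val c).1 == u].
have hm u : exists c : clones V home, val c = (u, home u).
  by exists (Sub (u, home u) (hV u)); rewrite SubK.
exists mu; first split.
- move=> u; have [c0 Ec0] := hm u.
  have c0u : c0 \in mu u by rewrite inE Ec0.
  apply: cut_rel_connected; [exact: adj_sym|by apply/set0Pn; exists c0|].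
  have star c : c \in mu u -> c != c0 -> adj c0 c.
    rewrite inE => /eqP cu nc; apply/orP; right; rewrite Ec0 /= cu eqxx /= eqxx andbT.
    apply: contraNneq nc => Ec; apply/eqP/val_inj; rewrite Ec0.
    by apply: injective_projections; [exact: cu|exact: esym Ec].
  move=> C Cmu /set0Pn[c cC] nC; have [c0C|c0C] := boolP (c0 \in C).
    have /set0Pn[d] : mu u :\: C != set0.
      by rewrite setD_eq0; apply: contra nC => mC; rewrite eqEsubset Cmu.
    rewrite inE => /andP[dC dmu]; exists c0, d; split=> //; apply: star => //.
    by apply: contraNneq dC => ->.
  exists c, c0; split=> //; rewrite adj_sym; apply: star; first exact: (subsetP Cmu).
  by apply: contraNneq c0C => <-.
- move=> u v uv; have [j /andP[uj vj]] := covE u v uv.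
  exists (Sub (u, j) uj : clones V home), (Sub (v, j) vj : clones V home).
  split; rewrite ?inE ?SubK //=; apply/orP; left; by rewrite !SubK /= eqxx.
move=> u v nuv; apply/pred0P=> c /=; rewrite !inE; apply/negP=> /andP[/eqP-> /eqP E].
by rewrite E eqxx in nuv.
Qed.

Lemma sum_clones (H : sgraph) (J : finType) (V : J -> {set H}) (home : H -> J) (A : pred J)
    (F : H -> J -> nat) :
  \sum_(c : clones V home | A (val c).2) F (val c).1 (val c).2 =
  \sum_(j | A j) \sum_(u in V j) F u j.
Proof.
rewrite (eq_bigr (fun j => \sum_(u | u \in V j) F u j)) //.
rewrite (exchange_big_dep xpredT) //= pair_big_dep /=.
rewrite [RHS](reindex_omap (val : clones V home -> H * J) insub) /=; last first.
  by move=> p /andP[_ pV]; rewrite insubT.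
by apply: eq_bigl => c; rewrite (valP c) valK eqxx !andbT.
Qed.

Lemma card_clones (H : sgraph) (J : finType) (V : J -> {set H}) (home : H -> J) (A : pred J) :
  #|[set c : clones V home | A (val c).2]| = \sum_(j | A j) #|V j|.
Proof.
rewrite -sum1_card (eq_bigl (fun c : clones V home => A (val c).2)); last by move=> c; rewrite inE.
rewrite (sum_clones V home A (fun _ _ => 1)).
by apply: eq_bigr => j _; rewrite sum1_card.
Qed.

Definition away (H : sgraph) (J : finType) (V : J -> {set H}) (home : H -> J) :
    {set clones V home} :=
  [set c | (val c).2 != home (val c).1].

(** Each clone away from home asks for one connection, so the number of connections is the overlap
    of the pieces, which the covering keeps small. *)
Lemma card_away (H : sgraph) (J : finType) (V : J -> {set H}) (home : H -> J) :
  (forall u, u \in V (home u)) ->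
  #|away V home| + #|H| = \sum_j #|V j|.
Proof.
move=> hV; have := card_clones V home xpredT; rewrite -(cardsID (away V home)) => <-.
congr (_ + _); first by apply: eq_card => c; rewrite !inE.
pose f (u : H) : clones V home := Sub (u, home u) (hV u).
have finj : injective f by move=> u v /(congr1 (fun c => (val c).1)); rewrite !SubK.
rewrite -(card_imset _ finj); apply: eq_card => c; rewrite !inE andbT negbK.
apply/imsetP/eqP => [[u _ ->]|Ec]; first by rewrite SubK.
by exists (val c).1 => //; apply: val_inj; rewrite SubK -Ec -surjective_pairing.
Qed.

(** * Elementary choices *)

Lemma choose_injective (T I : finType) (X : finType) (key : T -> I) (P : I -> {set X}) :
  (forall i j, i != j -> [disjoint P i & P j]) ->
  (forall i, #|[set t | key t == i]| <= #|P i|) ->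
  exists2 p : T -> X, injective p & forall t, p t \in P (key t).
Proof.
move=> disP cap.
pose A i := enum [set t | key t == i].
have tA t : t \in A (key t) by rewrite mem_enum inE.
have idx t : index t (A (key t)) < size (enum (P (key t))).
  by apply: leq_trans (_ : _ < size (A (key t))) _; rewrite ?index_mem // -!cardE.
have x0 (t : T) : X.
  by have := idx t; case: (enum (P (key t))) => [|x _ _]; [rewrite ltn0|exact: x].
pose p t := nth (x0 t) (enum (P (key t))) (index t (A (key t))).
have pP t : p t \in P (key t) by rewrite -mem_enum mem_nth.
exists p => // t t' Ep.
have [Ek|nk] := eqVneq (key t) (key t'); last first.
  by have := disjointFr (disP _ _ nk) (pP t); rewrite Ep pP.
move: Ep; rewrite /p (set_nth_default (x0 t') (x0 t) (idx t)) Ek => /eqP.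
rewrite nth_uniq ?enum_uniq // -?Ek ?idx // ?Ek ?idx // => /eqP Ei.
by have := tA t; rewrite Ek => tA'; rewrite -(nth_index t tA') Ei nth_index.
Qed.

(** Each item goes to the lightest group, whose load is at most the average, so a group exceeds the
    average by at most one item. *)
Lemma balanced_groups (J : finType) (w : J -> nat) (k L : nat) :
  (forall j, w j <= k) ->
  exists grp : J -> 'I_L.+1, forall i,
    L.+1 * \sum_(j | grp j == i) w j <= \sum_j w j + L.+1 * k.
Proof.
move=> wk; suff [grp H] : exists grp : J -> 'I_L.+1, forall i,
    L.+1 * \sum_(j <- index_enum J | grp j == i) w j <= \sum_(j <- index_enum J) w j + L.+1 * k.
  by exists grp.
elim: (index_enum J) (index_enum_uniq J) => [_|j s IH /= /andP[js us]].
  by exists (fun _ => ord0) => i; rewrite !big_nil muln0.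
have [grp Hg] := IH us.
pose ld i := \sum_(j <- s | grp j == i) w j.
have tot : \sum_i ld i = \sum_(j <- s) w j.
  by rewrite (exchange_big_dep xpredT) //=; apply: eq_bigr => j' _;
     rewrite (big_pred1 (grp j')) // => i; rewrite eq_sym.
case: (arg_minnP ld (isT : xpredT ord0)) => i0 _ mini.
have i0le : L.+1 * ld i0 <= \sum_(j <- s) w j.
  by rewrite -tot -[X in X * _](card_ord L.+1) -sum_nat_const; apply: leq_sum => i _; apply: mini.
exists (fun j' => if j' == j then i0 else grp j') => i; rewrite !big_cons eqxx.
have -> : \sum_(j0 <- s | (if j0 == j then i0 else grp j0) == i) w j0 = ld i.
  rewrite /ld big_seq_cond [RHS]big_seq_cond; apply: eq_bigl => j'.
  by case: (boolP (j' \in s)) => //= j's; case: (eqVneq j' j) => // Ej; rewrite -Ej j's in js.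
have := Hg i; rewrite -/(ld i); have := wk j.
case: eqP => [<-|_]; move: i0le; move: (ld _) (\sum_(j <- s) w j) (w j); clear; nia.
Qed.

(** * Embedding into linked dense pieces *)

(** A dense piece has surplus for [d] and d/2, with [d] of order D / g. In a minimal subset with
    this surplus, degree d/2 and connectivity survive the loss of d/2 vertices. Then [short_link]
    gives length 3 * 4D / (d/2), and D <= 16 g d with d <= 3 (d/2) turns this into 576 g. *)
Lemma robust_piece (G : sgraph) (D g d : nat) (P : {set G}) :
  0 < g -> 1 < d -> 8 * g * d <= D -> D <= 16 * g * d -> dense_piece D g P ->
  exists W : {set G}, [/\ W \subset P, d < #|W|
    & forall (U : {set G}) a b, #|U :&: W| <= d./2 -> a \in W -> b \in W -> a != b ->
       exists I : {set G}, [/\ I \subset W, [disjoint I & U], #|I| <= 576 * g & links I a b]].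
Proof.
move=> g0 d1 dD Dd [cP aP].
have d2 : 0 < d./2 by rewrite half_gt0.
have dd : 2 * d./2 <= d by rewrite -[leqRHS]odd_double_half mul2n leq_addl.
have crit : surplus d d./2 P.
  have aP' := arcs_leq P; apply/andP; split.
    have : (8 * g * d) * (8 * g * d) <= g * (#|P| * #|P|).
      apply: leq_trans (leq_mul dD dD) _; apply: leq_trans aP _; rewrite leq_mul2l.
      by apply/orP; right; apply: leq_trans aP' _; rewrite leq_mul2l leq_pred orbT.
    move: #|P| g0; clear => p g0 H; rewrite leqNgt; apply/negP=> pd.
    have : p * p < d * d by apply: ltn_mul.
    nia.
  have H : 2 * d * #|P| <= arcs P.
    have H1 : D * (8 * g * d) <= g * arcs P by apply: leq_trans aP; rewrite leq_mul2l dD orbT.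
    have H2 : 2 * d * #|P| <= 8 * d * D by move: cP; move: #|P|; clear; nia.
    apply: leq_trans H2 _; rewrite -(leq_pmul2l g0); apply: leq_trans H1; clear; nia.
  apply: leq_ltn_trans H _; rewrite -{1}[arcs P]addn0 ltn_add2l !muln_gt0 d2 /=; lia.
have [W [WP /andP[dW _] deg con]] := surplus_subset dd crit.
have dW' : d < #|W|.
  have /card_gt0P[x xW] : 0 < #|W| by lia.
  apply: leq_trans (deg x xW) _; apply: subset_leq_card.
  by apply/subsetP=> y; rewrite inE => /andP[].
exists W; split=> // U a b UW aW bW nab.
(* The ends of a link may be occupied themselves, so they are put back before the link is sought. *)
pose U' := U :\: [set a; b].
have U'W : #|U' :&: W| <= d./2.
  by apply: leq_trans UW; apply: subset_leq_card; apply: setSI; apply: subsetDl.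
have aWU : a \in W :\: U' by rewrite !inE eqxx aW.
have bWU : b \in W :\: U' by rewrite !inE eqxx bW orbT.
have mindeg x : x \in W :\: U' -> d./2 <= #|nbhd (W :\: U') x|.
  rewrite inE => /andP[_ xW]; have degx := deg x xW.
  have : nbhd W x \subset nbhd (W :\: U') x :|: (U' :&: W).
    by apply/subsetP=> y; rewrite !inE; case: (y \in W); case: (adj x y); case: (_ && (y \in U)).
  move/subset_leq_card/leq_trans/(_ (leq_card_setU _ _)) => H.
  by move: degx H U'W dd; move: #|nbhd W x| #|_ :&: W| #|nbhd _ x|; clear; lia.
have [I [IW aI bI cI lk]] := short_link (con _ U'W) aWU bWU nab mindeg.
exists I; split=> //.
- by apply: subset_trans IW (subsetDl _ _).
- apply/pred0P=> z /=; apply/negP=> /andP[zI zU]; have := subsetP IW z zI.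
  rewrite !inE zU andbT negbK => /andP[/orP[] /eqP Ez _]; first by rewrite -Ez zI in aI.
  by rewrite -Ez zI in bI.
have cW : #|W :\: U'| <= 4 * D.
  apply: leq_trans cP; apply: subset_leq_card; apply: subset_trans WP; exact: subsetDl.
have d3 : d <= 3 * d./2.
  by have := odd_double_half d; move: d2; rewrite -mul2n; move: (d./2) (odd d) => e []; clear; lia.
rewrite -(leq_pmul2r d2); apply: leq_trans cI _.
move: cW Dd d3; move: #|_| (d./2) ; clear => w e cW Dd d3.
have : g * d <= g * (3 * e) by rewrite leq_mul2l d3 orbT.
lia.
Qed.

(** The average group costs at most c1 tot / (2048 g c1) <= d / 16, since tot <= 8D <= 128 g d; the
    one item of imbalance adds d / 8. *)
Lemma group_load_bound (g c1 d D tot n k : nat) :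
  D <= 16 * g * d -> tot <= 8 * D -> c1 * k <= d %/ 8 ->
  (2048 * g * c1).+1 * n <= tot + (2048 * g * c1).+1 * k -> c1 * n <= d %/ 4.
Proof.
rewrite !leq_divRL // (mulnC _ 4) (mulnC _ 8) => Dd tD kd Hn.
rewrite -(leq_pmul2l (ltn0Sn (2048 * g * c1))).
have H1 : 4 * c1 * ((2048 * g * c1).+1 * n) <= 4 * c1 * (tot + (2048 * g * c1).+1 * k).
  by rewrite leq_mul2l Hn orbT.
have H2 : 4 * c1 * tot <= 4 * c1 * (8 * (16 * g * d)).
  by rewrite leq_mul2l (leq_trans tD) ?orbT // leq_mul2l Dd orbT.
have H3 : (2048 * g * c1).+1 * (8 * (c1 * k)) <= (2048 * g * c1).+1 * d.
  by rewrite leq_mul2l kd orbT.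
move: H1 H2 H3; move EM: (2048 * g * c1).+1 => M.
have E1 : 4 * (4 * c1 * (8 * (16 * g * d))) + d = M * d by rewrite -EM; lia.
rewrite !mulnDr; have -> : 4 * c1 * (M * n) = M * (4 * (c1 * n)) by lia.
have -> : 4 * c1 * (M * k) = M * (4 * (c1 * k)) by lia.
have E2 : M * (8 * (c1 * k)) = 2 * (M * (4 * (c1 * k))) by lia.
by move: E1 E2; clear; lia.
Qed.

(** The dense piece of index 0 is kept as a hub. A clone away from home gets two terminals, one in
    its own dense piece and one in that of its home clone; Menger's paths lead all terminals to the
    hub, where the two ends for one clone are joined. A clone costs c1 = 1 + 2 C0 l vertices on
    average, itself and a link per arc. The [x] overlaps cost at most two vertices per piece for
    each of 2x paths and 2x + x + 2x further links, whence 4 + 5l. *)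
Theorem linked_pieces_minor (G H : sgraph) (J : finType) (V : J -> {set H})
    (D b g d C0 k x : nat) :
  let l := 576 * g in
  let c1 := 1 + 2 * C0 * l in
  let L := 2048 * g * c1 in
  0 < g -> 1 < d -> 8 * g * d <= D -> D <= 16 * g * d ->
  2 * x <= b -> (4 + 5 * l) * x <= d %/ 8 -> c1 * k <= d %/ 8 ->
  (forall U : {set G}, #|U| <= b -> connected_in (~: U)) ->
  (exists P : 'I_L.+2 -> {set G}, (forall i, dense_piece D g (P i)) /\
     forall i j, i != j -> [disjoint P i & P j]) ->
  covering V -> (forall j, #|V j| <= k) -> (forall j, arcs (V j) <= 2 * C0 * #|V j|) ->
  \sum_j #|V j| <= 8 * D -> \sum_j #|V j| <= #|H| + x ->
  minor H G.
Proof.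
move=> l c1 L g0 d1 dD Dd xb xd kd conG [P0 [dP0 disP0]] covV Vk VC0 Vtot Vx.
have ex_home u : exists j, u \in V j by case: covV => /(_ u).
pose home u := xchoose (ex_home u).
have hV u : u \in V (home u) by apply: xchooseP (ex_home u).
apply: minor_trans (minor_clones covV hV) _.
set K := clones V home.
have [W HW] : exists W : 'I_L.+2 -> {set G}, forall i, [/\ W i \subset P0 i, d < #|W i|
    & forall (U : {set G}) a b, #|U :&: W i| <= d./2 -> a \in W i -> b \in W i -> a != b ->
       exists I : {set G}, [/\ I \subset W i, [disjoint I & U], #|I| <= l & links I a b]].
  have H1 i := robust_piece g0 d1 dD Dd (dP0 i).
  by exists (fun i => projT1 (cid (H1 i))) => i; case: (cid (H1 i)).
have disW i j : i != j -> [disjoint W i & W j].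
  move=> nij; have [Wi _ _] := HW i; have [Wj _ _] := HW j.
  by apply: disjointWl Wi _; apply: disjointWr Wj _; apply: disP0.
pose X : finType := {c : K | c \in away V home}.
have cX : #|X| <= x.
  by rewrite card_sig; have := card_away hV; rewrite -/K => E; move: Vx; rewrite -E addnC leq_add2l;
     apply: leq_trans; apply: eq_leq; apply: eq_card.
have [grp0 Hgrp0] := balanced_groups L Vk.
pose grp (c : K) : 'I_L.+2 := lift ord0 (grp0 (val c).2).
have cgrp i : #|[set c : K | grp c == lift ord0 i]| = \sum_(j | grp0 j == i) #|V j|.
  rewrite -(card_clones V home); apply: eq_card => c; rewrite !inE.
  by rewrite (inj_eq lift_inj).
have grp_small i : c1 * #|[set c : K | grp c == i]| <= d %/ 4.
  case: (unliftP ord0 i) => [i' ->|->]; last first.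
    have -> : [set c : K | grp c == ord0] = set0.
      by apply/setP=> c; rewrite !inE /grp eq_sym (negPf (neq_lift _ _)).
    by rewrite cards0 muln0.
  by rewrite cgrp; apply: group_load_bound Dd Vtot kd (Hgrp0 i').
have home_clone (c : K) : exists h : K, val h = ((val c).1, home (val c).1).
  by exists (Sub (_, _) (hV (val c).1) : K); rewrite SubK.
pose hm c := projT1 (cid (home_clone c)).
have hmE c : val (hm c) = ((val c).1, home (val c).1) by rewrite /hm; case: cid.
(* [(y, true)] is the terminal of the clone [y] itself, [(y, false)] that of its home clone. *)
pose owner (p : X * bool) : K := if p.2 then val p.1 else hm (val p.1).
have l0 : 0 < l by rewrite /l; lia.
have x_d : 4 * x + 5 * l * x <= d %/ 8 by rewrite -mulnDl.
have cXb : #|{: X * bool}| <= 2 * x by rewrite card_prod card_bool mulnC leq_mul2l cX.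
have Wd i : d < #|W i| by case: (HW i).
have [bt bt_inj btW] : exists2 bt : X * bool -> G, injective bt & forall p, bt p \in W (grp (owner p)).
  apply: choose_injective => // i; apply: leq_trans (max_card _) _.
  by apply: leq_trans cXb _; have := Wd i; move: x_d; clear; lia.
(* All pieces become cliques. A shortest path then has at most two vertices in a piece, and its jump
   between them is later realised by a link inside the piece. *)
pose ga : rel G := fun u v => adj u v || (u != v) && [exists i, (u \in W i) && (v \in W i)].
have ga_sym : symmetric ga.
  move=> u v; rewrite /ga adj_sym eq_sym; congr (_ || (_ && _)).
  by apply: eq_existsb => i; rewrite andbC.
have ga_irr : irreflexive ga by move=> u; rewrite /ga adj_irr eqxx.
pose Ga := SGraph ga_sym ga_irr.
pose k2 := #|{: X * bool}|.
pose B := [set bt p | p in [set: X * bool]].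
have cB : #|B| = k2 by rewrite card_imset // cardsT.
have [Q0 [Q0c Q0A Q0B Q0d]] : exists P : 'I_k2 -> {set G},
    [/\ forall i, rel_connected ga (P i), forall i, P i :&: W ord0 != set0,
        forall i, P i :&: B != set0 & forall i j, i != j -> [disjoint P i & P j]].
  (* A set of fewer than k2 <= 2x <= b vertices neither disconnects [G] nor contains the hub or all
     terminals. *)
  apply: menger => // S [C [AC CS CB clo]]; rewrite leqNgt; apply/negP=> Sk.
  have Sb : #|S| <= b by apply: leq_trans (ltnW Sk) _; apply: leq_trans cXb _.
  have [a aW aS] : exists2 a, a \in W ord0 & a \notin S.
    apply/subsetPn; apply: contraTN (Wd ord0) => /subset_leq_card WS; rewrite -leqNgt.
    apply: leq_trans WS _; apply: leq_trans (ltnW Sk) _; apply: leq_trans cXb _.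
    by move: x_d; clear; lia.
  have [z zB zS] : exists2 z, z \in B & z \notin S.
    by apply/subsetPn; apply: contraTN Sk => /subset_leq_card; rewrite cB -leqNgt.
  have [|||u [v [uC vS vC uv]]] := rel_connected_cut (C := C) (conG S Sb).
  - by rewrite -disjoints_subset.
  - by apply/set0Pn; exists a; apply: (subsetP AC); rewrite inE aS.
  - apply/eqP=> EC; have : z \in C by rewrite EC inE.
    by move=> zC; rewrite (disjointFr CB zC) in zB.
  have := clo u v uC; rewrite /ga uv => /(_ isT); rewrite inE (negPf vC) /=.
  by move: vS; rewrite inE => /negPf->.
have clq i : {in W i &, forall u v : Ga, u != v -> adj u v}.
  move=> u v uW vW nuv; rewrite /= /ga nuv; apply/orP; right; apply/existsP.
  by exists i; rewrite uW vW.
have [Q1 HQ1] : exists Q : 'I_k2 -> {set G}, forall i, [/\ Q i \subset Q0 i, rel_connected ga (Q i),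
     Q i :&: W ord0 != set0, Q i :&: B != set0 & forall j, #|Q i :&: W j| <= 2].
  have H1 i : exists Q : {set G}, [/\ Q \subset Q0 i, rel_connected ga Q,
     Q :&: W ord0 != set0, Q :&: B != set0 & forall j, #|Q :&: W j| <= 2].
    have [Q QQ [? ? ? ?]] := thin_connector (G := Ga) clq (Q0c i) (Q0A i) (Q0B i).
    by exists Q.
  by exists (fun i => projT1 (cid (H1 i))) => i; case: (cid (H1 i)).
have Q1d i j : i != j -> [disjoint Q1 i & Q1 j].
  move=> nij; have [Qi _ _ _ _] := HQ1 i; have [Qj _ _ _ _] := HQ1 j.
  by apply: disjointWl Qi _; apply: disjointWr Qj _; apply: Q0d.
have Q1B i : Q1 i :&: B != set0 by case: (HQ1 i).
have [gq [gqE gqI gqS]] := disjoint_transversal cB Q1d Q1B.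
have ex_i p : exists i, gq i == bt p.
  have : bt p \in B by apply: imset_f.
  by rewrite -gqS => /imsetP[i _ ->]; exists i.
pose Q p := Q1 (xchoose (ex_i p)).
have btQ p : bt p \in Q p.
  have /setIP[] : gq (xchoose (ex_i p)) \in Q1 (xchoose (ex_i p)) :&: B by rewrite gqE inE.
  by rewrite (eqP (xchooseP (ex_i p))).
have Qd p q : p != q -> [disjoint Q p & Q q].
  move=> npq; apply: Q1d; apply: contraNneq npq => E; apply/eqP/bt_inj.
  by rewrite -(eqP (xchooseP (ex_i p))) -(eqP (xchooseP (ex_i q))) E.
have Qc p : rel_connected ga (Q p) by case: (HQ1 (xchoose (ex_i p))).
have Q2 p i : #|Q p :&: W i| <= 2 by case: (HQ1 (xchoose (ex_i p))).
have exa p : exists a, a \in Q p :&: W ord0.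
  by apply/set0Pn; case: (HQ1 (xchoose (ex_i p))).
pose at0 p := xchoose (exa p).
have atQ p : at0 p \in Q p by have := xchooseP (exa p); rewrite inE => /andP[].
have atW p : at0 p \in W ord0 by have := xchooseP (exa p); rewrite inE => /andP[].
pose UQ := \bigcup_p Q p.
have cUQ i : #|UQ :&: W i| <= 4 * x.
  rewrite /UQ big_distrl /=; apply: leq_trans (_ : \sum_(p : X * bool) 2 <= _).
    apply: (big_rec2 (fun (A : {set G}) n => #|A| <= n)); rewrite ?cards0 // => p n A _ An.
    by apply: leq_trans (leq_card_setU _ _) _; apply: leq_add.
  by rewrite sum_nat_const; move: cXb; rewrite (_ : #|_| = #|{: X * bool}|) //; clear; lia.
have [pt pt_inj ptW] : exists2 pt : K -> G, injective pt & forall c, pt c \in W (grp c) :\: UQ.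
  apply: (choose_injective (P := fun i => W i :\: UQ)).
    move=> i j nij; apply: disjointWl (subsetDl _ _) _; apply: disjointWr (subsetDl _ _) _; exact: disW.
  move=> i; have := cardsID UQ (W i); rewrite setIC => E.
  have := Wd i; rewrite -E; have := cUQ i; have := grp_small i; move: x_d.
  rewrite /c1 mulnDl mul1n; move: #|_| #|_| #|_|; clear; move=> n u w; lia.
(* Four kinds of links: edges of [H] inside a group, a clone to its terminals, the two path ends in
   the hub, and the jump of a path inside a piece. *)
pose Rb : finType := (((K * K) + (X * bool)) + (X + (X * bool) * 'I_L.+2))%type.
(* The default [bt p] is reached only when the path has fewer than two vertices in [W i]; the
   request then fails [valid]. *)
pose el2 p i n := nth (bt p) (enum (Q p :&: W i)) n.
pose src (r : Rb) := match r with
  | inl (inl cd) => pt cd.1 | inl (inr p) => pt (owner p)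
  | inr (inl y) => at0 (y, true) | inr (inr pi) => el2 pi.1 pi.2 0 end.
pose tgt (r : Rb) := match r with
  | inl (inl cd) => pt cd.2 | inl (inr p) => bt p
  | inr (inl y) => at0 (y, false) | inr (inr pi) => el2 pi.1 pi.2 1 end.
pose pc (r : Rb) : 'I_L.+2 := match r with
  | inl (inl cd) => grp cd.1 | inl (inr p) => grp (owner p)
  | inr (inl y) => ord0 | inr (inr pi) => pi.2 end.
pose same (c d : K) := ((val c).2 == (val d).2) && adj (val c).1 (val d).1.
pose valid (r : Rb) := [&& src r != tgt r, src r \in W (pc r), tgt r \in W (pc r)
  & if r is inl (inl cd) then same cd.1 cd.2 else true].
pose Rq : finType := {r : Rb | valid r}.
pose e : rel G := fun u v => adj u v || [exists r : Rq,
  (src (val r) == u) && (tgt (val r) == v) || (src (val r) == v) && (tgt (val r) == u)].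
have e_sym : symmetric e.
  by move=> u v; rewrite /e adj_sym; congr (_ || _); apply: eq_existsb => r; rewrite orbC.
have reqE r : valid r -> e (src r) (tgt r).
  by move=> vr; rewrite /e; apply/orP; right; apply/existsP; exists (Sub r vr : Rq); rewrite SubK !eqxx.
pose mu (c : K) := pt c |: \bigcup_(p | owner p == c) Q p.
have ptW' c : pt c \in W (grp c) by have := ptW c; rewrite inE => /andP[].
have ptUQ c p : pt c \notin Q p.
  have := ptW c; rewrite inE => /andP[+ _]; apply: contra => ptQ; apply/bigcupP; by exists p.
have Qsub p : Q p \subset mu (owner p).
  by apply/subsetP=> z zQ; rewrite inE; apply/orP; right; apply/bigcupP; exists p.
have Qe p : rel_connected e (Q p).
  apply: rel_connected_sub (Qc p) => u v uQ vQ; rewrite /ga => /orP[uv|/andP[nuv /existsP[i /andP[ui vi]]]].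
    by rewrite /e uv.
  have uE : u \in enum (Q p :&: W i) by rewrite mem_enum inE uQ.
  have vE : v \in enum (Q p :&: W i) by rewrite mem_enum inE vQ.
  have Esz : size (enum (Q p :&: W i)) <= 2 by rewrite -cardE.
  have [E|E] : enum (Q p :&: W i) = [:: u; v] \/ enum (Q p :&: W i) = [:: v; u].
    move: uE vE Esz (enum_uniq (Q p :&: W i)).
    case: (enum _) => [|a [|a' [|]]] //=; rewrite !inE.
      by move=> /eqP Eu /eqP Ev; rewrite Eu Ev eqxx in nuv.
    move=> /orP[] /eqP Eu /orP[] /eqP Ev _ _; subst; rewrite ?eqxx // in nuv *; by [left|right].
  - have := @reqE (inr (inr (p, i))); rewrite /src /tgt /el2 /= E /=; apply.
    by rewrite /valid /= /el2 E /= nuv ui vi.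
  have := @reqE (inr (inr (p, i))); rewrite e_sym /src /tgt /el2 /= E /=; apply.
  by rewrite /valid /= /el2 E /= eq_sym nuv ui vi.
have mucon c : rel_connected e (mu c).
  pose JJ := [set o : option (X * bool) | if o is Some p then owner p == c else true].
  pose F o := pt c |: (if o is Some p then Q p else set0).
  have -> : mu c = \bigcup_(o in JJ) F o.
    apply/setP=> z; rewrite !inE; apply/orP/bigcupP.
      case=> [zc|/bigcupP[p pc' zQ]]; first by exists None; rewrite ?inE ?zc.
      by exists (Some p); rewrite ?inE ?zQ ?orbT.
    case=> -[p|]; rewrite !inE => pc' /orP[zc|zQ]; try by left.
    by right; apply/bigcupP; exists p.
  apply: (rel_connected_bigcup (f := fun _ _ => true)) => //.
  - split; first by apply/set0Pn; exists None; rewrite inE.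
    by move=> o o' oJ o'J; apply: connect1; rewrite /= oJ o'J.
  - case=> [p|] oJ; rewrite /F; last by rewrite setU0; apply: rel_connected1.
    apply: rel_connectedU => //; first exact: rel_connected1.
    move: oJ; rewrite inE => /eqP oc; exists (pt c), (bt p); split; rewrite ?inE ?eqxx //.
    apply/orP; right; have := @reqE (inl (inr p)); rewrite /src /tgt /= oc; apply.
    rewrite /valid /= oc ptW' andbT /= -{2}oc btW andbT.
    by apply: contraNneq (ptUQ c p) => ->; apply: btQ.
  by move=> o o' _ _ _; exists (pt c), (pt c); rewrite /F !inE !eqxx.
have ptmu c : pt c \in mu c by rewrite !inE eqxx.
have muadj c c' : adj c c' -> exists u v, [/\ u \in mu c, v \in mu c' & e u v].
  have star (y : K) (z : K) : (val y).1 = (val z).1 -> (val y).2 != (val z).2 ->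
      (val z).2 = home (val z).1 -> exists u v, [/\ u \in mu y, v \in mu z & e u v].
    move=> E1 n2 Ez; have yX : y \in away V home by rewrite inE E1 -Ez.
    pose y' : X := Sub y yX.
    have o1 : owner (y', true) = y by [].
    have o2 : owner (y', false) = z.
      by apply: val_inj; rewrite /owner /= hmE /= E1 -Ez -surjective_pairing.
    exists (at0 (y', true)), (at0 (y', false)); split.
    - by apply: (subsetP (Qsub (y', true))).
    - by rewrite -o2; apply: (subsetP (Qsub _)).
    apply: (@reqE (inr (inl y'))); rewrite /valid /= !atW !andbT.
    apply/eqP => Ea; have nn : (y', true) != (y', false) by rewrite xpair_eqE andbF.
    by have := disjointFr (Qd _ _ nn) (atQ _); rewrite Ea atQ.
  case/orP => [/andP[/eqP E2 uv]|/and3P[/eqP E1 n2 /orP[/eqP Eh|/eqP Eh]]].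
  - exists (pt c), (pt c'); split=> //; apply: (@reqE (inl (inl (c, c')))).
    rewrite /valid /= /same E2 eqxx uv ptW' (_ : grp c = grp c') ?ptW' ?andbT /=; last by rewrite /grp E2.
    by rewrite (inj_eq pt_inj); apply: contraTneq uv => ->; rewrite adj_irr.
  - have n2' : (val c').2 != (val c).2 by rewrite eq_sym.
    have [u [v [uc' vc uv]]] := star c' c (esym E1) n2' Eh.
    by exists v, u; split=> //; rewrite e_sym.
  exact: star.
have mudis c c' : c != c' -> [disjoint mu c & mu c'].
  move=> ncd; apply/pred0P=> z /=; rewrite !inE; apply/negP=> /andP[].
  case/orP => [/eqP->|/bigcupP[p /eqP pc' zp]] /orP[/eqP Ez|/bigcupP[q /eqP qd zq]].
  - by rewrite (pt_inj _ _ Ez) eqxx in ncd.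
  - by rewrite (negPf (ptUQ c q)) in zq.
  - by rewrite Ez (negPf (ptUQ c' p)) in zp.
  have npq : p != q by apply: contraNneq ncd => E; rewrite -pc' -qd E.
  by rewrite (disjointFr (Qd _ _ npq) zp) in zq.
pose U0 := \bigcup_c mu c.
have capU i : #|U0 :&: W i| <= #|[set c : K | grp c == i]| + 4 * x.
  apply: leq_trans (leq_add (leqnn _) (cUQ i)).
  rewrite -(card_imset _ pt_inj); apply: leq_trans (leq_card_setU _ _).
  apply: subset_leq_card; apply/subsetP=> z; rewrite !inE => /andP[/bigcupP[c _]].
  rewrite !inE => /orP[/eqP->|/bigcupP[p _ zQ]] zW; apply/orP.
    left; apply: imset_f; rewrite inE; apply: contraLR zW => ngi.
    by rewrite (disjointFr (disW _ _ ngi) (ptW' c)).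
  by right; rewrite zW andbT; apply/bigcupP; exists p.
(* Requests of the first kind are injected into the arcs of the pieces of [H] in this group, few by
   [VC0]; the other kinds number at most 2x, x and 2x. *)
have capR i : #|[set r : Rq | pc (val r) == i]| <= 2 * C0 * #|[set c : K | grp c == i]| + 5 * x.
  rewrite -(card_imset _ val_inj).
  pose S1 := [set cd : K * K | (grp cd.1 == i) && same cd.1 cd.2].
  pose f1 (cd : K * K) : Rb := inl (inl cd).
  pose f2 (p : X * bool) : Rb := inl (inr p).
  pose f3 (y : X) : Rb := inr (inl y).
  pose f4 (p : X * bool) : Rb := inr (inr (p, i)).
  have sub : val @: [set r : Rq | pc (val r) == i] \subset
      (f1 @: S1 :|: f2 @: setT) :|: (f3 @: setT :|: f4 @: setT).
    apply/subsetP=> _ /imsetP[r + ->]; have := valP r; rewrite inE /valid => /and4P[_ _ _].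
    case: (val r) => [[cd|p]|[y|[p i']]] /= same_r /eqP Ei; rewrite !inE.
    - by rewrite imset_f // inE Ei eqxx.
    - by rewrite (imset_f f2) ?inE ?orbT.
    - by rewrite (imset_f f3) ?inE ?orbT.
    by rewrite Ei (imset_f f4) ?inE ?orbT.
  apply: leq_trans (subset_leq_card sub) _.
  apply: leq_trans (leq_card_setU _ _) _.
  apply: leq_trans (leq_add (leq_card_setU _ _) (leq_card_setU _ _)) _.
  have c2 : #|f2 @: setT| <= 2 * x by apply: leq_trans (leq_imset_card _ _) _; rewrite cardsT.
  have c3 : #|f3 @: setT| <= x by apply: leq_trans (leq_imset_card _ _) _; rewrite cardsT.
  have c4 : #|f4 @: setT| <= 2 * x by apply: leq_trans (leq_imset_card _ _) _; rewrite cardsT.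
  have cS1 : #|f1 @: S1| <= 2 * C0 * #|[set c : K | grp c == i]|.
    apply: leq_trans (leq_imset_card _ _) _.
    apply: leq_trans (_ : \sum_(c : K | grp c == i) #|nbhd (V (val c).2) (val c).1| <= _).
      rewrite -sum1_card (eq_bigl (fun cd : K * K => (grp cd.1 == i) && same cd.1 cd.2)); last first.
        by move=> cd; rewrite inE.
      rewrite -(pair_big_dep (fun c => grp c == i) same (fun _ _ => 1)) /=.
      apply: leq_sum => c _; rewrite sum1_card.
      have fi : {in [pred dd | same c dd] &, injective (fun dd : K => (val dd).1)}.
        move=> a a'; rewrite !inE /same => /andP[/eqP Ea _] /andP[/eqP Ea' _] E.
        by apply: val_inj; apply: injective_projections; [exact: E|rewrite -Ea].
      rewrite -(card_in_imset fi); apply: subset_leq_card; apply/subsetP=> u.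
      case/imsetP=> dd; rewrite !inE /same => /andP[/eqP E2 uv] ->; rewrite uv andbT E2.
      exact: (valP dd).
    case: (unliftP ord0 i) => [i' ->|->]; last first.
      by rewrite big_pred0 // => c; rewrite /grp eq_sym (negPf (neq_lift _ _)).
    rewrite (eq_bigl (fun c : K => grp0 (val c).2 == i')); last by move=> c; rewrite (inj_eq lift_inj).
    rewrite (sum_clones V home (fun j => grp0 j == i') (fun u j => #|nbhd (V j) u|)) cgrp big_distrr /=.
    by apply: leq_sum => j _; apply: VC0.
  by move: c2 c3 c4 cS1; move: #|_ @: _| #|_ @: _| #|_ @: _| #|_ @: _|; clear; lia.
have [|r U Ur|i|I [IW IU _ Ilk Idis]] := @greedy_links G Rq _ (fun r => pc (val r)) W
   (fun r => src (val r)) (fun r => tgt (val r)) U0 d./2 l.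
- exact: disW.
- have := valP r; rewrite /valid => /and4P[nst sW tW _].
  by have [_ _ av] := HW (pc (val r)); apply: av.
- apply: leq_trans (leq_add (capU i) (leq_mul (leqnn l) (capR i))) _.
  have := grp_small i; move: x_d; rewrite /c1; move: #|_| => n.
  have := odd_double_half d; rewrite -mul2n; move: (d./2) (odd d) (l) => dh [] l'; clear; nia.
apply: (@patch_minor G K e mu Rq (fun r => src (val r)) (fun r => tgt (val r)) I) => //.
- move=> u v /orP[uv|/existsP[r /orP[]/andP[/eqP sr /eqP tr]]]; [by left| |].
    by right; exists r; left.
  by right; exists r; right.
- by move=> r c; apply: disjointWr (IU r); apply: (bigcup_sup c).
Qed.

(** * A one-sided regularity lemma *)

Definition cell (G : sgraph) (B : {set G}) (T : finType) (f : G -> T) (x : T) : {set G} :=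
  [set v in B | f v == x].

Definition cross (G : sgraph) (A A' : {set G}) : nat := \sum_(u in A) #|nbhd A' u|.

(* [A, A'] certifies that the pair of cells [x, x'] is not dense at scale [1/w]. *)
Definition sparse_witness (G : sgraph) (B : {set G}) (T : finType) (f : G -> T) (p w : nat)
    (x x' : T) (A A' : {set G}) : bool :=
  [&& A \subset cell B f x, A' \subset cell B f x', #|cell B f x| <= w * #|A|,
      #|cell B f x'| <= w * #|A'| & p * cross A A' < #|A| * #|A'|].

(** A lower bound 1/p on the density between any two subsets that fill a share 1/w of related cells:
    it lets a typical choice keep a share 1/p of each later candidate set. *)
Definition lower_regular (G : sgraph) (B : {set G}) (T : finType) (f : G -> T) (p w : nat)
    (R : rel T) : Prop :=
  forall x x', R x x' -> forall A A', ~~ sparse_witness B f p w x x' A A'.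

Definition area (G : sgraph) (B : {set G}) (S : rel G) : nat :=
  #|[set uv : G * G | [&& uv.1 \in B, uv.2 \in B & S uv.1 uv.2]]|.

Lemma areaE (G : sgraph) (B : {set G}) (S : rel G) :
  area B S = \sum_(u in B) \sum_(v in B) (S u v : nat).
Proof.
rewrite pair_big /= /area -sum1_card big_mkcond [RHS]big_mkcond; apply: eq_bigr => uv _.
by rewrite inE; case: (uv.1 \in B); case: (uv.2 \in B); case: (S _ _).
Qed.

Lemma area_leq (G : sgraph) (B : {set G}) (S S' : rel G) :
  subrel S S' -> area B S <= area B S'.
Proof.
move=> sub; apply: subset_leq_card; apply/subsetP=> uv; rewrite !inE.
by case/and3P=> -> -> /sub ->.
Qed.

Lemma area_total (G : sgraph) (B : {set G}) (S : rel G) : area B S <= #|B| * #|B|.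
Proof.
rewrite areaE -sum_nat_const; apply: leq_sum => u _.
by rewrite -sum1_card; apply: leq_sum => v _; case: (S u v).
Qed.

Lemma areaU (G : sgraph) (B : {set G}) (S S1 S2 : rel G) :
  (forall u v, S u v = S1 u v || S2 u v) -> (forall u v, S1 u v -> S2 u v = false) ->
  area B S = area B S1 + area B S2.
Proof.
move=> ES dis; rewrite !areaE -big_split /=; apply: eq_bigr => u _.
rewrite -big_split /=; apply: eq_bigr => v _; rewrite ES.
by case E: (S1 u v) => //=; rewrite dis.
Qed.

Lemma area_cells (G : sgraph) (B : {set G}) (T : finType) (f : G -> T) (Q : rel T) (S : rel G) :
  area B (fun u v => Q (f u) (f v) && S u v) =
  \sum_(x : T) \sum_(x' : T | Q x x') \sum_(u in cell B f x) \sum_(v in cell B f x') (S u v : nat).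
Proof.
rewrite areaE (partition_big f xpredT) //=; apply: eq_bigr => x _.
rewrite [LHS](eq_bigl (fun u => u \in cell B f x)); last by move=> u; rewrite inE.
rewrite [RHS]exchange_big /=; apply: eq_bigr => u; rewrite inE => /andP[uB /eqP fu].
rewrite (partition_big f xpredT) //= [RHS]big_mkcond; apply: eq_bigr => x' _.
rewrite (eq_bigl (fun v => v \in cell B f x')); last by move=> v; rewrite inE.
case: ifP => Qx.
  by apply: eq_bigr => v; rewrite inE => /andP[_ /eqP fv]; rewrite fu fv Qx.
by rewrite big1 // => v; rewrite inE => /andP[_ /eqP fv]; rewrite fu fv Qx.
Qed.

Lemma sum_rect (G : sgraph) (X X' A A' : {set G}) (S : rel G) :
  A \subset X -> A' \subset X' ->
  \sum_(u in X) \sum_(v in X') ([&& u \in A, v \in A' & S u v] : nat) =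
  \sum_(u in A) \sum_(v in A') (S u v : nat).
Proof.
move=> AX AX'; rewrite [LHS](big_setID A) /= (setIidPr AX) [X in _ + X]big1 ?addn0; last first.
  by move=> u; rewrite inE => /andP[/negPf-> _]; rewrite big1.
apply: eq_bigr => u uA; rewrite [LHS](big_setID A') /= (setIidPr AX') [X in _ + X]big1 ?addn0; last first.
  by move=> v; rewrite inE => /andP[/negPf-> _]; rewrite andbF.
by apply: eq_bigr => v vA; rewrite uA vA.
Qed.

Lemma crossE (G : sgraph) (A A' : {set G}) :
  cross A A' = \sum_(u in A) \sum_(v in A') (adj u v : nat).
Proof.
apply: eq_bigr => u _; rewrite -sum1_card big_mkcond [RHS]big_mkcond /=.
by apply: eq_bigr => v _; rewrite !inE; case: (v \in A'); case: (adj u v).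
Qed.

(** A refined label also records, for every old label, membership in the chosen witness on either
    side, so [t] labels become t 2^t 2^t. *)
Definition label_bound (r : nat) : nat := iter r (fun t => t * 2 ^ t * 2 ^ t) 1.

(* Each round deletes the sparse rectangles of all bad pairs; the deleted area
   only grows, and the deleted rectangles contain few edges. *)
Lemma regularity_rounds (G : sgraph) (B : {set G}) (p w r : nat) :
  (exists (T : finType) (f : G -> T) (R : rel T),
    [/\ #|T| <= label_bound (p * w * w).+1, lower_regular B f p w R
      & p * area B (fun u v => ~~ R (f u) (f v) && adj u v) <= 2 * (#|B| * #|B|)]) \/
  (r <= (p * w * w).+1 ->
   exists (T : finType) (f : G -> T) (R : rel T),
    [/\ #|T| <= label_bound r,
        p * area B (fun u v => ~~ R (f u) (f v) && adj u v) <= area B (fun u v => ~~ R (f u) (f v))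
      & r * (#|B| * #|B|) <= p * w * w * area B (fun u v => ~~ R (f u) (f v))]).
Proof.
elim: r => [|r IH].
  right=> _; exists unit, (fun=> tt), (fun _ _ => true); split=> //.
    by rewrite card_unit.
  by rewrite /area (_ : [set uv | _] = set0) ?cards0 ?muln0 //; apply/setP=> uv; rewrite !inE !andbF.
case: IH => [|IH]; first by left.
have [ltr|ler] := ltnP r (p * w * w).+1; last by right=> ?; lia.
have [T [f [R [cT ed ar]]]] := IH (ltnW ltr).
pose bad x x' := [exists AA : {set G} * {set G}, sparse_witness B f p w x x' AA.1 AA.2].
(* When the bad pairs of cells cover little area they are declared unrelated, and the procedure
   stops. *)
have [good|badbig] := leqP (p * area B (fun u v => R (f u) (f v) && bad (f u) (f v))) (#|B| * #|B|).
  left; exists T, f, (fun x x' => R x x' && ~~ bad x x'); split.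
  - apply: leq_trans cT _; rewrite /label_bound; have : r <= (p * w * w).+1 by apply: ltnW.
    move: (p * w * w).+1 => m; elim: m => [|m IHm]; first by rewrite leqn0 => /eqP->.
    rewrite leq_eqVlt => /orP[/eqP->//|]; rewrite ltnS => /IHm/leq_trans; apply.
    by rewrite /= -mulnA leq_pmulr // muln_gt0 !expn_gt0.
  - move=> x x' /andP[_ /existsPn H] A A'; exact: (H (A, A')).
  rewrite (@areaU G B _ (fun u v => ~~ R (f u) (f v) && adj u v)
                 (fun u v => [&& R (f u) (f v), bad (f u) (f v) & adj u v])).
  - rewrite mulnDr mul2n -addnn; apply: leq_add.
      by apply: leq_trans ed (area_total _ _).
    apply: leq_trans good; rewrite leq_mul2l; apply/orP; right; apply: area_leq => u v.
    by case/and3P=> -> ->.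
  - by move=> u v; case: (R _ _); case: (bad _ _); case: (adj _ _).
  by move=> u v /andP[/negPf->].
right=> _.
pose AA x x' := odflt (set0, set0) [pick AA : {set G} * {set G} | sparse_witness B f p w x x' AA.1 AA.2].
have AAP x x' : bad x x' -> sparse_witness B f p w x x' (AA x x').1 (AA x x').2.
  move=> bx; rewrite /AA; case: pickP => //= no; case/existsP: bx => P; by rewrite no.
pose T' : finType := (T * {set T} * {set T})%type.
pose f' (u : G) : T' := (f u, [set x' | u \in (AA (f u) x').1], [set x | u \in (AA x (f u)).2]).
(* After refining, only the witness rectangle of a bad pair becomes unrelated; its density is below
   1/p, so deleted edges stay below 1/p of the deleted area. *)
pose R' (y y' : T') := R y.1.1 y'.1.1 &&
  ~~ [&& bad y.1.1 y'.1.1, y'.1.1 \in y.1.2 & y.1.1 \in y'.2].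
pose Q x x' := R x x' && bad x x'.
pose K (u v : G) := (u \in (AA (f u) (f v)).1) && (v \in (AA (f u) (f v)).2).
have ER' u v : ~~ R' (f' u) (f' v) = ~~ R (f u) (f v) || Q (f u) (f v) && K u v.
  by rewrite /R' /Q /K /f' /= !inE; case: (R _ _); case: (bad _ _); rewrite //= negbK.
have disRQ u v : ~~ R (f u) (f v) -> Q (f u) (f v) && K u v = false by rewrite /Q => /negPf->.
have aD : area B (fun u v => ~~ R' (f' u) (f' v)) =
    area B (fun u v => ~~ R (f u) (f v)) + area B (fun u v => Q (f u) (f v) && K u v).
  by apply: areaU.
have aE : area B (fun u v => ~~ R' (f' u) (f' v) && adj u v) =
    area B (fun u v => ~~ R (f u) (f v) && adj u v) +
    area B (fun u v => Q (f u) (f v) && (K u v && adj u v)).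
  apply: areaU => u v; first by rewrite ER' andb_orl -andbA.
  by case/andP=> /disRQ; case: (Q _ _) => //= ->.
have rect (S : rel G) x x' : Q x x' ->
    \sum_(u in cell B f x) \sum_(v in cell B f x') (K u v && S u v : nat) =
    \sum_(u in (AA x x').1) \sum_(v in (AA x x').2) (S u v : nat).
  case/andP=> _ /AAP/and5P[A1 A2 _ _ _]; rewrite -(sum_rect _ A1 A2).
  apply: eq_bigr => u; rewrite inE => /andP[_ /eqP fu].
  by apply: eq_bigr => v; rewrite inE => /andP[_ /eqP fv]; rewrite /K fu fv andbA.
have aK : area B (fun u v => Q (f u) (f v) && K u v) =
    \sum_(x : T) \sum_(x' : T | Q x x') #|(AA x x').1| * #|(AA x x').2|.
  rewrite area_cells; apply: eq_bigr => x _; apply: eq_bigr => x' Qx.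
  have := rect (fun _ _ => true) x x' Qx; under eq_bigr do under eq_bigr do rewrite andbT.
  by move=> ->; under eq_bigr do rewrite sum1_card; rewrite sum_nat_const.
have aKE : area B (fun u v => Q (f u) (f v) && (K u v && adj u v)) =
    \sum_(x : T) \sum_(x' : T | Q x x') cross (AA x x').1 (AA x x').2.
  rewrite area_cells; apply: eq_bigr => x _; apply: eq_bigr => x' Qx.
  by rewrite rect // crossE.
have aQ : area B (fun u v => R (f u) (f v) && bad (f u) (f v)) =
    \sum_(x : T) \sum_(x' : T | Q x x') #|cell B f x| * #|cell B f x'|.
  transitivity (area B (fun u v => Q (f u) (f v) && true)).
    by apply: eq_card => uv; rewrite !inE andbT.
  rewrite area_cells; apply: eq_bigr => x _; apply: eq_bigr => x' Qx.
  by under eq_bigr do rewrite sum1_card; rewrite sum_nat_const.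
exists T', f', R'; split.
- have cS : #|{: {set T}}| = 2 ^ #|T| 
    by have := card_powerset [set: T]; rewrite powersetT !cardsT.
  by rewrite /T' !card_prod !cS /=; apply: leq_mul; [apply: leq_mul|]; rewrite ?leq_pexp2l.
- rewrite aE aD mulnDr; apply: leq_add => //; rewrite aKE aK big_distrr /=.
  apply: leq_sum => x _; rewrite big_distrr /=; apply: leq_sum => x' /andP[_ /AAP/and5P[_ _ _ _]].
  exact: ltnW.
rewrite aD mulSn mulnDr addnC; apply: leq_add => //.
(* Witnesses fill a share 1/w of the cell in both coordinates, so a round deletes at least |B|^2 /
   (p w^2) of new area. *)
apply: leq_trans (ltnW badbig) _; rewrite aQ aK -!mulnA leq_mul2l; apply/orP; right.
rewrite !big_distrr /=; apply: leq_sum => x _; rewrite !big_distrr /=.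
apply: leq_sum => x' /andP[_ /AAP/and5P[_ _ c1 c2 _]].
by rewrite mulnA mulnACA leq_mul.
Qed.

(** The deleted area never exceeds |B|^2, so after p w^2 + 1 rounds a further failure is impossible.
    For empty [B] this count is void, and everything is declared unrelated. *)
Lemma regularity (G : sgraph) (B : {set G}) (p w : nat) :
  exists (T : finType) (f : G -> T) (R : rel T),
    [/\ #|T| <= label_bound (p * w * w).+1, lower_regular B f p w R
      & p * area B (fun u v => ~~ R (f u) (f v) && adj u v) <= 2 * (#|B| * #|B|)].
Proof.
have [//|H] := regularity_rounds B p w (p * w * w).+1.
have [T [f [R [cT ed ar]]]] := H (leqnn _).
have [B0|Bpos] := posnP #|B|.
  exists T, f, (fun _ _ => false); split=> //.
  have := area_total B (fun u v => ~~ false && adj u v); rewrite B0 leqn0 => /eqP->.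
  by rewrite muln0.
have := area_total B (fun u v => ~~ R (f u) (f v)).
move: ar; rewrite mulSn => ar ale.
have : p * w * w * area B (fun u v => ~~ R (f u) (f v)) <= p * w * w * (#|B| * #|B|).
  by rewrite leq_mul2l ale orbT.
have : 0 < #|B| * #|B| by rewrite muln_gt0 Bpos.
by move: ar; move: (p * w * w * (#|B| * #|B|)) (p * w * w * area _ _) (#|B| * #|B|); clear; lia.
Qed.

(* The edges promised by [lower_regular] let one embed a sequence of vertices
   with prescribed candidate sets one vertex at a time, each choice shrinking the
   remaining candidate sets by a factor at most [p]. *)
Lemma regular_embedding (G : sgraph) (B : {set G}) (T : finType) (f : G -> T) (p w m : nat)
    (R : rel T) (x0 : G) (t0 : T) (items : seq (T * {set G})) :
  1 < p -> 0 < w -> lower_regular B f p w R -> size items <= m ->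
  (forall it, it \in items -> [/\ it.2 \subset cell B f it.1, 2 * w <= #|cell B f it.1|
     & #|cell B f it.1| * (m * p ^ size items) <= w * #|it.2|]) ->
  exists ys : seq G, [/\ size ys = size items, uniq ys,
    forall i, i < size items -> nth x0 ys i \in (nth (t0, set0) items i).2
  & forall i j, i < j -> j < size items ->
      R (nth (t0, set0) items i).1 (nth (t0, set0) items j).1 ->
      adj (nth x0 ys i) (nth x0 ys j)].
Proof.
move=> p1 w0 reg; have [n] := ubnP (size items); elim: n items => // n IH [|[x C] rest] /= lt szm Hit.
  by exists [::].
have [/= Cx bigx szC] := Hit (x, C) (mem_head _ _).
have p0 : 0 < p by apply: ltnW.
have pk k : 0 < p ^ k by rewrite expn_gt0 p0.
have m0 : 0 < m by apply: leq_trans szm.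
have cx0 : 0 < #|cell B f x| by apply: leq_trans bigx; rewrite muln_gt0.
have Hrest it : it \in rest -> [/\ it.2 \subset cell B f it.1, 2 * w <= #|cell B f it.1|
     & #|cell B f it.1| * (m * p ^ (size rest).+1) <= w * #|it.2|].
  by move=> itr; apply: Hit; rewrite inE itr orbT.
have cell_le it : it \in rest -> #|cell B f it.1| <= w * #|it.2|.
  by case/Hrest=> _ _; apply: leq_trans; rewrite leq_pmulr // muln_gt0 m0 pk.
(* Choices that would shrink a later candidate set by more than a factor [p]. Were they more than a
   share 1/w of the cell, they would form a sparse witness. *)
pose bad (it : T * {set G}) := if R x it.1 then [set y in C | p * #|nbhd it.2 y| < #|it.2|] else set0.
have badle it : it \in rest -> w * #|bad it| <= #|cell B f x|.
  move=> itr; rewrite /bad; case: ifP => [Rx|_]; last by rewrite cards0 muln0.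
  rewrite leqNgt; apply/negP => lA; set A := [set y in C | _] in lA.
  have /negP := reg x it.1 Rx A it.2; apply.
  have [itx _ _] := Hrest it itr.
  apply/and5P; split; [|exact: itx|exact: ltnW|exact: cell_le|].
    by apply: subset_trans Cx; apply/subsetP=> y; rewrite inE => /andP[].
  have /card_gt0P[a aA] : 0 < #|A|.
    by rewrite lt0n; apply/eqP => A0; rewrite A0 muln0 ltn0 in lA.
  rewrite /cross big_distrr /= -sum_nat_const (big_setD1 a aA) [ltnRHS](big_setD1 a aA) /=.
  rewrite -addSn; apply: leq_add; first by move: aA; rewrite inE => /andP[].
  by apply: leq_sum => y; rewrite !inE => /andP[_ /andP[_ /ltnW]].
have [y yC ybad] : exists2 y, y \in C & forall it, it \in rest -> y \notin bad it.
  have : ~~ (C \subset \bigcup_(it <- rest) bad it).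
    apply/negP=> /subset_leq_card; apply/negP; rewrite -ltnNge.
    have H1 : w * #|\bigcup_(it <- rest) bad it| <= size rest * #|cell B f x|.
      elim: rest badle {IH lt szm Hit szC Hrest cell_le} => [|it rest IHr] badle.
        by rewrite big_nil cards0 muln0.
      rewrite big_cons /= mulSn; apply: leq_trans (_ : w * (#|bad it| + #|\bigcup_(it <- rest) bad it|) <= _).
        by rewrite leq_mul2l leq_card_setU orbT.
      rewrite mulnDr; apply: leq_add; first by apply: badle; rewrite mem_head.
      by apply: IHr => it' it'r; apply: badle; rewrite inE it'r orbT.
    rewrite -(ltn_pmul2l w0); apply: leq_ltn_trans H1 _; apply: leq_trans szC.
    rewrite mulnC ltn_pmul2l //; apply: leq_trans szm _.
    by apply: leq_pmulr; rewrite expn_gt0 p0.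
  case/subsetPn=> y yC yn; exists y => // it itr; apply: contra yn => yb.
  by rewrite bigcup_seq; apply/bigcupP; exists it.
(* For an unrelated item only [y] is removed, for injectivity. Candidate sets have at least two
   elements thanks to the bound 2w, so this costs a factor 2 <= p. *)
pose upd (it : T * {set G}) := (it.1, if R x it.1 then nbhd it.2 y else it.2 :\ y).
have updS it : (upd it).2 \subset it.2.
  rewrite /upd /=; case: ifP => _; last exact: subsetDl.
  by apply/subsetP=> z; rewrite inE => /andP[].
have updy it : y \notin (upd it).2.
  by rewrite /upd /=; case: ifP => _; rewrite !inE ?adj_irr ?andbF ?eqxx.
have updc it : it \in rest -> #|it.2| <= p * #|(upd it).2|.
  move=> itr; have := ybad it itr; rewrite /upd /bad /=; case: ifP => _.
    by rewrite inE yC /= -leqNgt.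
  move=> _; have c2 : 2 <= #|it.2|.
    have [_ c2 _] := Hrest it itr; rewrite -(leq_pmul2l w0) mulnC; apply: leq_trans c2 _.
    exact: cell_le.
  have := cardsD1 y it.2; move: c2; move: #|it.2| #|_ :\ _| (y \in _) => a b e c2 E.
  apply: leq_trans (_ : 2 * b <= _); last by rewrite leq_mul2r p1 orbT.
  by rewrite E in c2 *; case: e c2 {E} => /=; clear; lia.
have [||it|ys [ys1 ys2 ys3 ys4]] := IH [seq upd it | it <- rest].
- by rewrite size_map.
- by rewrite size_map; apply: ltnW.
- case/mapP=> it' it'r ->; have [H1 H2 H3] := Hrest it' it'r; split=> //.
    by apply: subset_trans (updS _) H1.
  rewrite size_map -(leq_pmul2l p0); apply: leq_trans (_ : w * #|it'.2| <= _).
    by apply: leq_trans H3; rewrite expnS /=; apply: eq_leq; ring.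
  by rewrite mulnCA leq_mul2l updc ?orbT.
rewrite size_map in ys1 ys3 ys4.
have nthu i : i < size rest -> nth (t0, set0) [seq upd it | it <- rest] i = upd (nth (t0, set0) rest i).
  by move=> ir; rewrite (nth_map (t0, set0)).
exists (y :: ys); split=> /=.
- by rewrite ys1.
- rewrite ys2 andbT; apply/negP=> /(nthP x0)[i]; rewrite ys1 => ir Ei.
  by have := ys3 i ir; rewrite nthu // Ei; apply/negP; apply: updy.
- case=> [|i] //= ir; have := ys3 i ir; rewrite nthu //.
  exact: (subsetP (updS _)).
case=> [|i] [|j] //= ij jr; last first.
  have ij' : i < j := ij; have ir : i < size rest := ltn_trans ij' jr.
  by have := ys4 i j ij' jr; rewrite !nthu.
by move=> Rx; have := ys3 j jr; rewrite nthu // /upd /= Rx inE => /andP[].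
Qed.

Import Order.TTheory GRing.Theory Num.Theory.

(** * A random reserve of vertices *)

(** Under a uniform [w] each vertex is in this set independently with probability 1 / (q + 1), so
    probabilities become counts of functions. *)
Definition zeros (V : finType) q (w : {ffun V -> 'I_q.+1}) : {set V} := [set x | w x == ord0].

Lemma card_zeros (V : finType) q (B : {set V}) :
  #|[set w : {ffun V -> 'I_q.+1} | B \subset zeros w]| * q.+1 ^ #|B| = q.+1 ^ #|V|.
Proof.
pose F x : pred 'I_q.+1 := if x \in B then pred1 ord0 else predT.
have -> : #|[set w : {ffun V -> 'I_q.+1} | B \subset zeros w]| = #|family F|.
  apply: eq_card => w; rewrite inE; apply/subsetP/familyP => H x.
    by rewrite /F; case: ifP => // /H; rewrite inE.
  by move=> xB; have := H x; rewrite /F xB !inE.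
rewrite card_family foldrE big_map big_enum /=.
have E x : #|F x| * (if x \in B then q.+1 else 1) = q.+1.
  by rewrite /F; case: ifP => _; rewrite ?card1 ?mul1n // muln1 cardT /= size_enum_ord.
have -> : q.+1 ^ #|B| = \prod_x (if x \in B then q.+1 else 1).
  by rewrite -big_mkcond /= prod_nat_const.
by rewrite -big_split /= (eq_bigr _ (fun x _ => E x)) prod_nat_const; congr (_ ^ _); apply: eq_card.
Qed.

Lemma card_bigcup_disjoint (V I : finType) (A : I -> {set V}) (J : {set I}) :
  (forall i j, i != j -> [disjoint A i & A j]) ->
  #|\bigcup_(i in J) A i| = \sum_(i in J) #|A i|.
Proof.
move=> disA; under [RHS]eq_bigr do rewrite -sum1_card big_mkcond /=.
rewrite exchange_big /= -sum1_card big_mkcond /=; apply: eq_bigr => x _.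
case: (boolP (x \in _)) => [/bigcupP[i iJ xA]|xn].
  rewrite (bigD1 i) //= xA big1 // => j /andP[_ ji].
  by rewrite (disjointFr (disA _ _ _) xA) // eq_sym.
rewrite big1 // => i iJ; case: ifP => // xA; case/negP: xn; apply/bigcupP; by exists i.
Qed.

Local Open Scope ring_scope.

(** With N the number of blocks inside the random set, 2^-N is the product over [i] of 1 - 1/2
    [A i inside]. Expanding over sets of blocks, each expectation factors because the blocks are
    disjoint, and the sum folds back into a product. *)
Lemma sum_half_pow_blocks (V : finType) q M (A : 'I_M -> {set V}) l :
  (forall i, #|A i| <= l)%N -> (forall i j, i != j -> [disjoint A i & A j]) ->
  \sum_(w : {ffun V -> 'I_q.+1}) (2%:R : rat) ^- #|[set i | A i \subset zeros w]| <=
  q.+1%:R ^+ #|V| * (1 - (2 * q.+1 ^ l)%N%:R^-1) ^+ M.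
Proof.
move=> Al disA; pose c : rat := - 2%:R^-1; pose Q : rat := q.+1%:R.
have Q0 : Q != 0 by rewrite pnatr_eq0.
have E1 (w : {ffun V -> 'I_q.+1}) : (2%:R : rat) ^- #|[set i | A i \subset zeros w]| =
    \prod_i (c * (A i \subset zeros w)%:R + 1).
  rewrite -exprVn -prodr_const big_mkcond /=; apply: eq_bigr => i _.
  by rewrite inE; case: (_ \subset _); rewrite /c /=; field.
have E2 (J : {set 'I_M}) : \sum_(w : {ffun V -> 'I_q.+1}) \prod_i
      (if i \in J then c * (A i \subset zeros w)%:R else 1) =
    Q ^+ #|V| * \prod_i (if i \in J then c * Q ^- #|A i| else 1).
  rewrite -[X in _ = _ * X]big_mkcond big_split /= prodr_const.
  under eq_bigr => w _ do rewrite -big_mkcond big_split /= prodr_const.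
  rewrite -big_distrr /= mulrCA; congr (_ * _).
  pose B := \bigcup_(i in J) A i.
  have EB (w : {ffun V -> 'I_q.+1}) : \prod_(i in J) (A i \subset zeros w)%:R = (B \subset zeros w)%:R :> rat.
    have [/bigcupsP BZ|/subsetPn[x /bigcupP[i iJ xA] xZ]] := boolP (B \subset zeros w).
      by rewrite big1 // => i /BZ ->.
    rewrite (bigD1 i) //= (_ : _ \subset _ = false) ?mul0r //.
    by apply/negbTE/subsetPn; exists x.
  rewrite (eq_bigr _ (fun w _ => EB w)).
  have -> : \sum_(w : {ffun V -> 'I_q.+1}) (B \subset zeros w)%:R =
      #|[set w : {ffun V -> 'I_q.+1} | B \subset zeros w]|%:R :> rat.
    rewrite -sum1_card natr_sum big_mkcond [RHS]big_mkcond /=.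
    by apply: eq_bigr => w _; rewrite inE; case: (_ \subset _).
  have cB : #|B| = (\sum_(i in J) #|A i|)%N.
    exact: card_bigcup_disjoint.
  rewrite prodfV prodrXr -cB; have /(congr1 (fun k => k%:R : rat)) := card_zeros q B.
  by rewrite natrM !natrX => <-; rewrite mulfK // expf_neq0.
under eq_bigr => w _ do rewrite E1 bigA_distr.
rewrite exchange_big /= (eq_bigr _ (fun J _ => E2 J)) -big_distrr /= -bigA_distr.
rewrite ler_pM2l ?exprn_gt0 ?ltr0n //.
rewrite -[X in _ <= _ ^+ X](card_ord M) -prodr_const.
apply: ler_prod => i _.
have Ql : Q ^- l <= Q ^- #|A i|.
  by rewrite lef_pV2 ?posrE ?exprn_gt0 ?ltr0n // ler_weXn2l ?Al // ler1n.
have Q1 : Q ^- #|A i| <= 1 by rewrite invf_le1 ?exprn_gt0 ?ltr0n // exprn_ege1 // ler1n.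
have -> : ((2 * q.+1 ^ l)%N%:R)^-1 = 2%:R^-1 * Q ^- l :> rat by rewrite natrM invfM natrX.
rewrite /c; move: (Q ^- l) (Q ^- #|A i|) Ql Q1; clear=> a b ab b1.
by suff : 0 <= - 2%:R^-1 * b + 1 <= 1 - 2%:R^-1 * a by []; apply/andP; split; lra.
Qed.

(** Bernoulli's inequality for the inverse: (1 + 1/x)^(x+1) >= 1 + (x+1)/x >= 2. *)
Lemma half_pow (x : nat) : (0 < x)%N -> (1 - (x.+1%:R : rat)^-1) ^+ x.+1 <= 2%:R^-1.
Proof.
move=> x0; have X0 : (x%:R : rat) > 0 by rewrite ltr0n.
have -> : 1 - (x.+1%:R : rat)^-1 = (1 + x%:R^-1)^-1.
  by rewrite -natr1; field; rewrite -?natr1; lra.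
rewrite exprVn lef_pV2 ?posrE ?exprn_gt0 //; last by rewrite addr_gt0 ?invr_gt0.
have B n : 1 + n%:R * (x%:R : rat)^-1 <= (1 + x%:R^-1) ^+ n.
  elim: n => [|n IH]; first by rewrite mul0r addr0 expr0.
  have iX : 0 < (x%:R : rat)^-1 by rewrite invr_gt0.
  rewrite exprS -natr1; move: (n%:R : rat) (ler0n rat n) IH => m m0 IH; nra.
apply: le_trans (B x.+1); rewrite -(natr1 x) mulrDl divff ?gt_eqF // mul1r.
have : 0 < (x%:R : rat)^-1 by rewrite invr_gt0.
lra.
Qed.

(** Markov for 2^-N: N < t has probability at most 2^t 4^-t = 2^-t, so the union over [Ix] has
    probability below 1/2. Markov for |Z| gives at most 1/2 for |Z| > 2 |V| / (q + 1), and both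
    events can be avoided together. *)
Lemma reserve_set (V Ix : finType) q l t M (A : Ix -> 'I_M -> {set V}) :
  (forall s i, #|A s i| <= l)%N -> (forall s i j, i != j -> [disjoint A s i & A s j]) ->
  (4 * q.+1 ^ l * t <= M)%N -> (2 * #|Ix| < 2 ^ t)%N -> (0 < #|V|)%N ->
  exists Z : {set V}, (q.+1 * #|Z| <= 2 * #|V|)%N /\
    forall s, (t <= #|[set i | A s i \subset Z]|)%N.
Proof.
move=> Al disA tM It V0.
pose Om := {ffun V -> 'I_q.+1}; pose N s (w : Om) := #|[set i | A s i \subset zeros w]|.
have cOm : (#|{: Om}|%:R : rat) = q.+1%:R ^+ #|V| by rewrite card_ffun card_ord natrX.
have few s : #|[set w : Om | N s w < t]%N|%:R * 2%:R ^+ t <= (q.+1%:R : rat) ^+ #|V|.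
  have H1 : #|[set w : Om | N s w < t]%N|%:R * (2%:R : rat) ^- t <=
      q.+1%:R ^+ #|V| * (4%:R : rat) ^- t.
    apply: (le_trans (y := \sum_(w : Om) (2%:R : rat) ^- N s w)).
      rewrite mulr_natl -sumr_const big_mkcond /=; apply: ler_sum => w _; rewrite inE.
      case: ifP => [lt|_]; last by rewrite invr_ge0 exprn_ge0.
      by rewrite lef_pV2 ?posrE ?exprn_gt0 // ler_weXn2l // ltnW.
    apply: le_trans (sum_half_pow_blocks q (Al s) (disA s)) _.
    rewrite ler_pM2l ?exprn_gt0 ?ltr0n //.
    pose y := (2 * q.+1 ^ l)%N; have y1 : (1 < y)%N by rewrite /y; have := expn_gt0 q.+1 l; lia.
    have y0 : 0 <= 1 - (y%:R : rat)^-1.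
      by rewrite subr_ge0 invf_le1 ?ltr0n ?ler1n //; apply: ltnW.
    have y2 : 1 - (y%:R : rat)^-1 <= 1 by rewrite gerBl invr_ge0.
    apply: (le_trans (y := (1 - (y%:R : rat)^-1) ^+ (y * (2 * t)))).
      apply: ler_wiXn2l => //; rewrite /y; move: tM; lia.
    have : (1 - (y%:R : rat)^-1) ^+ y <= 2%:R^-1.
      by have := @half_pow y.-1; rewrite prednK; [apply; lia|lia].
    rewrite exprM => hy; apply: (le_trans (y := (2%:R : rat)^-1 ^+ (2 * t))).
      by apply: lerXn2r; rewrite ?nnegrE ?exprn_ge0 ?invr_ge0.
    by rewrite exprM exprVn -[4%:R](natrM rat 2 2) expr2 -natrM exprVn.
  have E4 : (4%:R : rat) ^+ t = 2%:R ^+ t * 2%:R ^+ t by rewrite -exprMn -natrM.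
  have := H1; rewrite E4 invfM mulrA ler_pM2r ?invr_gt0 ?exprn_gt0 //.
  by rewrite -ler_pdivlMr ?exprn_gt0.
have big : #|[set w : Om | 2 * #|V| < q.+1 * #|zeros w|]%N|%:R * 2%:R <= (q.+1%:R : rat) ^+ #|V|.
  have sumz : \sum_(w : Om) (q.+1 * #|zeros w|)%N%:R = #|V|%:R * (q.+1%:R : rat) ^+ #|V|.
    have E x : (\sum_(w : Om) (w x == ord0 : nat) * q.+1)%N = (q.+1 ^ #|V|)%N.
      have := card_zeros q [set x]; rewrite cards1 expn1 => <-.
      rewrite -big_distrl /=; congr (_ * _)%N; rewrite -sum1_card big_mkcond [RHS]big_mkcond /=.
      by apply: eq_bigr => w _; rewrite inE sub1set inE; case: eqP.
    rewrite -natr_sum -natrX -natrM; congr (_%:R).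
    transitivity (\sum_(w : Om) \sum_(x : V) (w x == ord0 : nat) * q.+1)%N.
      apply: eq_bigr => w _; rewrite -big_distrl /= mulnC; congr (_ * _)%N.
      by rewrite -sum1_card big_mkcond /=; apply: eq_bigr => x _; rewrite inE; case: eqP.
    rewrite exchange_big /= (eq_bigr _ (fun x _ => E x)) sum_nat_const; congr (_ * _)%N; exact: eq_card.
  have V0' : (0 : rat) < #|V|%:R by rewrite ltr0n.
  rewrite -(ler_pM2l V0') -sumz mulrCA -natrM mulr_natl -sumr_const big_mkcond /=.
  apply: ler_sum => w _; rewrite inE; case: ifP => // lt; rewrite ler_nat; move: lt; rewrite mulnC; exact: ltnW.
have [w Hw] : exists w : Om, ~~ (2 * #|V| < q.+1 * #|zeros w|)%N && [forall s, ~~ (N s w < t)%N].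
  apply/existsP; rewrite -[X in is_true X]negbK negb_exists; apply/negP=> /forallP allbad.
  have cover : [set: Om] \subset [set w : Om | 2 * #|V| < q.+1 * #|zeros w|]%N
       :|: \bigcup_s [set w : Om | N s w < t]%N.
    apply/subsetP=> w _; have := allbad w; rewrite negb_and negbK !inE => /orP[->//|].
    rewrite negb_forall => /existsP[s]; rewrite negbK => lt.
    by apply/orP; right; apply/bigcupP; exists s; rewrite ?inE.
  have cards : (#|{: Om}| <= #|[set w : Om | 2 * #|V| < q.+1 * #|zeros w|]| +
       \sum_s #|[set w : Om | N s w < t]|)%N.
    have -> : #|{: Om}| = #|[set: Om]| by rewrite cardsT.
    apply: leq_trans (subset_leq_card cover) _.
    apply: leq_trans (leq_card_setU _ _) _; rewrite leq_add2l.
    apply: (big_ind2 (fun (X : {set Om}) n => #|X| <= n)%N); rewrite ?cards0 //.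
    by move=> X n Y m Xn Ym; apply: leq_trans (leq_card_setU _ _) (leq_add Xn Ym).
  have sums : (\sum_s #|[set w : Om | N s w < t]%N|)%N%:R * (2%:R : rat) ^+ t <=
      #|Ix|%:R * q.+1%:R ^+ #|V|.
    rewrite natr_sum big_distrl /= mulr_natl -sumr_const.
    by apply: ler_sum => s _; apply: few.
  have OmP : (0 : rat) < q.+1%:R ^+ #|V| by rewrite exprn_gt0 ?ltr0n.
  have It' : 2%:R * (#|Ix|%:R : rat) < 2%:R ^+ t by rewrite -natrM -natrX ltr_nat.
  have cards' : (q.+1%:R : rat) ^+ #|V| <= #|[set w : Om | 2 * #|V| < q.+1 * #|zeros w|]%N|%:R +
      (\sum_s #|[set w : Om | N s w < t]%N|)%N%:R by rewrite -cOm -natrD ler_nat.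
  move: (ler0n rat #|Ix|) OmP It' big sums cards'.
  move: (q.+1%:R ^+ _ : rat) (2%:R ^+ t : rat) (#|Ix|%:R : rat) => O T I.
  move: (#|[set w : Om | (2 * #|V| < q.+1 * #|zeros w|)%N]|%:R : rat) => b.
  move: ((\sum_s #|[set w : Om | (N s w < t)%N]|)%N%:R : rat) => s.
  clear=> I0 O0 It big sums cards.
  have sO : O <= 2%:R * s by lra.
  have T0 : 0 < T by lra.
  have P1 : 0 <= (2%:R * s - O) * T by rewrite mulr_ge0 ?subr_ge0 // ltW.
  have P2 : 0 < O * (T - 2%:R * I) by rewrite mulr_gt0 ?subr_gt0.
  lra.
case/andP: Hw; rewrite -leqNgt => Z2 /forallP HN.
by exists (zeros w); split=> // s; have := HN s; rewrite -leqNgt.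
Qed.

From mathcomp Require Import all_classical all_reals all_analysis.
From mathcomp Require Import fintype finset bigop.
From mathcomp Require Import zify ring lra.
Import Order.TTheory GRing.Theory Num.Theory.

Local Open Scope ring_scope.

(** * Averaging over finite samples *)

Lemma exists_le_average (R : realFieldType) (I : finType) (f : I -> R) (c : R) :
  (0 < #|I|)%N -> \sum_i f i <= #|I|%:R * c -> exists i, f i <= c.
Proof.
move=> I0 H; have [/existsP[i fi]|/existsPn no] := boolP [exists i, f i <= c]; first by exists i.
have /card_gt0P[i0 _] := I0; suff : #|I|%:R * c < \sum_i f i by rewrite ltNge H.
rewrite mulr_natl -sumr_const (bigD1 i0) //= [ltRHS](bigD1 i0) //=.
apply: ltr_leD; first by rewrite ltNge no.
by apply: ler_sum => i _; rewrite ltW // ltNge no.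
Qed.

Definition upd (T : finType) s (w : {ffun 'I_s -> T}) (i : 'I_s) (a : T) : {ffun 'I_s -> T} :=
  [ffun j => if j == i then a else w j].

(** Exchanging [a] with the i-th coordinate of [w] is an involution. This identity carries all uses
    of independence of the sampled vertices. *)
Lemma sum_resample (R : realFieldType) (T : finType) s (i : 'I_s) (F : {ffun 'I_s -> T} -> R) :
  \sum_w \sum_a F (upd w i a) = #|T|%:R * \sum_w F w.
Proof.
pose h (p : {ffun 'I_s -> T} * T) := (upd p.1 i p.2, p.1 i).
have hK : involutive h.
  case=> w a; rewrite /h /= ffunE eqxx; congr (_, _); apply/ffunP=> j.
  by rewrite !ffunE; case: eqP => [->|].
rewrite pair_big /= (reindex_inj (inv_inj hK)) /= -(pair_big xpredT xpredT (fun w a => F (upd (upd w i a) i (w i)))) /=.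
rewrite mulr_sumr; apply: eq_bigr => w _.
rewrite (eq_bigr (fun _ => F w)) ?sumr_const ?mulr_natl // => a _; congr F.
by apply/ffunP=> j; rewrite !ffunE; case: eqP => [->|].
Qed.

Lemma sum_sample_pair (R : realFieldType) (T : finType) s (i j : 'I_s) (g : T -> T -> R)
    (h : {ffun 'I_s -> T} -> R) :
  i != j -> (forall w a b, h (upd (upd w i a) j b) = h w) ->
  #|T|%:R ^+ 2 * (\sum_(w : {ffun 'I_s -> T}) g (w i) (w j) * h w) =
  (\sum_a \sum_b g a b) * \sum_w h w.
Proof.
move=> nij hE; rewrite expr2 -mulrA -(sum_resample j) mulr_sumr.
under eq_bigr => w _.
  rewrite (eq_bigr (fun b => g (w i) b * h (upd w j b))); last first.
    by move=> b _; rewrite !ffunE eqxx (negPf nij).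
  over.
rewrite -mulr_sumr -(sum_resample i) /=.
rewrite mulrC mulr_suml; apply: eq_bigr => w _; rewrite mulrC mulr_suml.
apply: eq_bigr => a _; rewrite ffunE eqxx mulr_suml; apply: eq_bigr => b _.
by rewrite hE.
Qed.

Lemma sum_sample_pair1 (R : realFieldType) (T : finType) s (i j : 'I_s) (g : T -> T -> R) :
  i != j ->
  #|T|%:R ^+ 2 * \sum_(w : {ffun 'I_s -> T}) g (w i) (w j) =
  (\sum_a \sum_b g a b) * #|{ffun 'I_s -> T}|%:R.
Proof.
move=> nij; have := @sum_sample_pair R T s i j g (fun=> 1) nij (fun _ _ _ => erefl).
rewrite sumr_const -mulr_natr mul1r => <-; congr (_ * _); by apply: eq_bigr => w _; rewrite mulr1.
Qed.

Lemma sum_sample_one (R : realFieldType) (T : finType) s (i : 'I_s) (g : T -> R) :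
  #|T|%:R * \sum_(w : {ffun 'I_s -> T}) g (w i) = (\sum_a g a) * #|{ffun 'I_s -> T}|%:R.
Proof.
rewrite -(sum_resample i) mulrC mulr_natl -sumr_const; apply: eq_bigr => w _.
by apply: eq_bigr => a _; rewrite ffunE eqxx.
Qed.

(** Both orientations are required because the relation between cells delivered by regularity need
    not be symmetric. *)
Definition pull_adj (T : finType) (S : rel T) s (w : {ffun 'I_s -> T}) : rel 'I_s :=
  fun i j => (i != j) && (S (w i) (w j) && S (w j) (w i)).

Lemma pull_adj_sym (T : finType) (S : rel T) s (w : {ffun 'I_s -> T}) : symmetric (pull_adj S w).
Proof. by move=> i j; rewrite /pull_adj eq_sym andbC [X in X && _]andbC andbC. Qed.

Lemma pull_adj_irr (T : finType) (S : rel T) s (w : {ffun 'I_s -> T}) : irreflexive (pull_adj S w).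
Proof. by move=> i; rewrite /pull_adj eqxx. Qed.

(* A vertex sampled several times gives several vertices. *)
Definition pull_graph (T : finType) (S : rel T) s (w : {ffun 'I_s -> T}) : sgraph :=
  SGraph (pull_adj_sym S w) (pull_adj_irr S w).

Lemma arcs_pull (R : realFieldType) (T : finType) (S : rel T) s (w : {ffun 'I_s -> T}) :
  (arcs [set: pull_graph S w])%:R =
  \sum_i \sum_(j | i != j) (S (w i) (w j) && S (w j) (w i))%:R :> R.
Proof.
rewrite /arcs natr_sum; apply: eq_big => [i|i _]; first by rewrite inE.
rewrite -sum1_card natr_sum big_mkcond [RHS]big_mkcond /=; apply: eq_bigr => j _.
by rewrite !inE /= /pull_adj; case: eqP => //= _; case: (_ && _).
Qed.

(** * Two potential arguments *)

(** Blackwell's argument. The potential is the sum of the squared positive parts of the accumulated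
    excesses. Answering the weights given by these positive parts makes the cross term nonpositive,
    so the potential grows by at most |X| C^2 per round and each excess is of order the square root
    of the number of rounds. *)
Lemma approachability (R : realType) (X : finType) (M : Type) (load : M -> X -> R) (b : X -> R) (C : R) :
  (forall m x, `|load m x - b x| <= C) ->
  (forall y : X -> R, (forall x, 0 <= y x) -> exists m, \sum_x y x * (load m x - b x) <= 0) ->
  forall xi : R, 0 < xi ->
  exists ms : seq M, (0 < size ms)%N /\
    forall x, \sum_(m <- ms) load m x <= (size ms)%:R * (b x + xi).
Proof.
move=> bd play xi xi0.
pose E (ms : seq M) x := \sum_(m <- ms) (load m x - b x).
have C2 m x : (load m x - b x) ^+ 2 <= C ^+ 2.
  rewrite -[leLHS]real_normK ?num_real //; apply: lerXn2r; rewrite ?nnegrE //.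
  exact: le_trans (bd m x).
have pot r : exists ms : seq M, size ms = r /\
    \sum_x Num.max 0 (E ms x) ^+ 2 <= r%:R * (#|X|%:R * C ^+ 2).
  elim: r => [|r [ms [sz IH]]].
    exists [::]; split=> //; rewrite mul0r big1 // => x _.
    by rewrite /E big_nil maxxx expr0n.
  have [m Hm] := play (fun x => Num.max 0 (E ms x)) (fun x => ltac:(by rewrite le_max lexx)).
  exists (m :: ms); split; first by rewrite /= sz.
  rewrite -natr1 mulrDl mul1r.
  apply: (le_trans (y := \sum_x (Num.max 0 (E ms x) ^+ 2 +
      2%:R * (Num.max 0 (E ms x) * (load m x - b x)) + C ^+ 2))).
    apply: ler_sum => x _; rewrite /E big_cons -/(E ms x); have := C2 m x.
    move: (load m x - b x) (E ms x) => d e dC.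
    have P : Num.max 0 (d + e) ^+ 2 <= (Num.max 0 e + d) ^+ 2.
      case: (leP 0 (d + e)) => h; last by rewrite expr0n sqr_ge0.
      by case: (leP 0 e) => h'; [rewrite addrC|apply: lerXn2r; rewrite ?nnegrE; lra].
    apply: le_trans P _; move: (Num.max 0 e) => f; rewrite sqrrD; lra.
  have EK : \sum_(x : X) C ^+ 2 = #|X|%:R * C ^+ 2 by rewrite sumr_const mulr_natl.
  rewrite !big_split /= -mulr_sumr EK.
  move: IH Hm; set a := \sum_x Num.max 0 (E ms x) ^+ 2.
  set s := \sum_x Num.max 0 (E ms x) * _ => IH Hm.
  by move: a s (#|X|%:R * C ^+ 2) IH Hm => a s u; move: (r%:R * u) => v; lra.
(* Enough rounds for r |X| C^2 <= (r xi)^2. *)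
pose r := (Num.trunc (#|X|%:R * C ^+ 2 / xi ^+ 2)).+1.
have [ms [sz H]] := pot r; exists ms; rewrite sz; split=> // x.
have r_big : #|X|%:R * C ^+ 2 <= r%:R * xi ^+ 2.
  rewrite -ler_pdivrMr ?exprn_gt0 //; apply: ltW.
  have q0 : 0 <= #|X|%:R * C ^+ 2 / xi ^+ 2 by apply: divr_ge0; [apply: mulr_ge0; [exact: ler0n|exact: sqr_ge0]|exact: sqr_ge0].
  by have /andP[] := truncn_itv q0.
have Ex : E ms x <= r%:R * xi.
  rewrite leNgt; apply/negP=> lt.
  have r0 : (0 : R) < r%:R * xi by rewrite mulr_gt0.
  have : (r%:R * xi) ^+ 2 < \sum_x Num.max 0 (E ms x) ^+ 2.
    apply: (lt_le_trans (y := Num.max 0 (E ms x) ^+ 2)).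
      by apply: ltrXn2r; rewrite ?nnegrE // ?lt_max ?lt ?orbT // ?ltW // le_max lexx.
    by rewrite (bigD1 x) //= lerDl; apply: sumr_ge0 => ? _; apply: sqr_ge0.
  apply/negP; rewrite -leNgt; apply: le_trans H _.
  apply: le_trans (ler_wpM2l (ler0n _ r) r_big) _.
  by rewrite exprMn [X in _ <= X * _]expr2 mulrA.
move: Ex; rewrite /E big_split /= sumrN big_const_seq count_predT iter_addr addr0 sz -mulr_natl.
lra.
Qed.

(** Derandomised choice of a uniform index for each [j]: deviations from the average have mean zero,
    so each step can be made with the total squared deviation growing by at most |X| A^2, and at the
    end it is at most z^2. *)
Lemma round_choices (R : realType) (J X : finType) T (a : J -> 'I_T.+1 -> X -> R) (A z : R) :
  (forall j i x, 0 <= a j i x <= A) -> 0 <= z -> #|J|%:R * (#|X|%:R * A ^+ 2) <= z ^+ 2 ->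
  exists c : J -> 'I_T.+1, forall x,
    \sum_j a j (c j) x <= (\sum_j \sum_i a j i x) / T.+1%:R + z.
Proof.
move=> aA z0 zz.
pose av j x := (\sum_i a j i x) / T.+1%:R.
have T0 : (0 : R) < T.+1%:R by rewrite ltr0n.
have avA j x : 0 <= av j x <= A.
  rewrite /av; apply/andP; split.
    by rewrite divr_ge0 ?ler0n // sumr_ge0 // => i _; case/andP: (aA j i x).
  rewrite ler_pdivrMr // mulrC mulr_natl -[X in _ *+ X]card_ord -sumr_const.
  by apply: ler_sum => i _; case/andP: (aA j i x).
have dA j i x : (a j i x - av j x) ^+ 2 <= A ^+ 2.
  have /andP[? ?] := aA j i x; have /andP[? ?] := avA j x.
  by rewrite -[leLHS]real_normK ?num_real //; apply: lerXn2r; rewrite ?nnegrE // ?ler_norml; lra.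
have [c H] : exists c : J -> 'I_T.+1, \sum_x (\sum_(j <- index_enum J) (a j (c j) x - av j x)) ^+ 2 <=
    (size (index_enum J))%:R * (#|X|%:R * A ^+ 2).
  elim: (index_enum J) (index_enum_uniq J) => [_|j l IH /= /andP[jl ul]].
    exists (fun=> ord0); rewrite mul0r big1 // => x _; by rewrite big_nil expr0n.
  have [c Hc] := IH ul; pose D x := \sum_(j <- l) (a j (c j) x - av j x).
  have [||i Hi] := @exists_le_average R 'I_T.+1
      (fun i => \sum_x (D x + (a j i x - av j x)) ^+ 2) ((size l).+1%:R * (#|X|%:R * A ^+ 2)).
  - by rewrite card_ord.
  - rewrite card_ord exchange_big /=.
    have step x : \sum_i (D x + (a j i x - av j x)) ^+ 2 <= T.+1%:R * (D x ^+ 2 + A ^+ 2).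
      have zero : \sum_(i < T.+1) (a j i x - av j x) = 0.
        by rewrite big_split /= sumrN sumr_const card_ord -mulr_natl /av mulrC divfK ?subrr ?gt_eqF.
      apply: (le_trans (y := \sum_(i < T.+1) ((D x ^+ 2 + A ^+ 2) + 2%:R * D x * (a j i x - av j x)))).
        by apply: ler_sum => i _; have := dA j i x; rewrite sqrrD; lra.
      by rewrite big_split /= -mulr_sumr zero mulr0 addr0 sumr_const card_ord mulr_natl lexx.
    apply: le_trans (ler_sum _ (fun x _ => step x)) _.
    have EK : \sum_(x : X) A ^+ 2 = #|X|%:R * A ^+ 2 by rewrite sumr_const mulr_natl.
    rewrite -mulr_sumr ler_pM2l // big_split /= EK -natr1 mulrDl mul1r.
    by rewrite lerD2r.
  exists (fun j' => if j' == j then i else c j'); apply: le_trans Hi; apply: ler_sum => x _.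
  rewrite big_cons eqxx addrC (_ : \sum_(j0 <- l) _ = D x) //.
  apply: eq_big_seq => j' j'l; case: eqP => // Ej; by rewrite -Ej j'l in jl.
exists c => x.
have Dz : \sum_j (a j (c j) x - av j x) <= z.
  rewrite leNgt; apply/negP=> lt; have : z ^+ 2 < (\sum_j (a j (c j) x - av j x)) ^+ 2.
    by apply: ltrXn2r; rewrite ?nnegrE // ltW // (le_lt_trans z0).
  apply/negP; rewrite -leNgt; apply: le_trans zz; apply: (le_trans (y := (size (index_enum J))%:R * (#|X|%:R * A ^+ 2))).
    by apply: le_trans H; rewrite [leRHS](bigD1 x) //= lerDl; apply: sumr_ge0 => ? _; apply: sqr_ge0.
  by rewrite -(sum1_size (index_enum J)) sum1_card lexx.
move: Dz; rewrite big_split /= sumrN lerBlDl => Dz; apply: le_trans Dz _.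
by rewrite mulr_suml.
Qed.

(** * Cheap jumbled models *)

Lemma multiplicity_sum (R : realType) (H G : sgraph) (mu : H -> {set G}) (y : G -> R) :
  \sum_u \sum_(x in mu u) y x = \sum_x y x * (multiplicity mu x)%:R.
Proof.
under eq_bigr do rewrite big_mkcond /=; rewrite exchange_big /=; apply: eq_bigr => x _.
rewrite -big_mkcond sumr_const mulr_natr /multiplicity; congr (_ *+ _).
by apply: eq_card => u; rewrite inE.
Qed.

Lemma volume_ge0 (R : realType) (H G : sgraph) : (0 <= volume R H G)%E.
Proof.
apply: ereal_sup_ubound; exists 0%N, (fun=> 0), (fun=> fun=> set0); split=> //; try by case.
- by move=> x; rewrite big_ord0.
by rewrite big_ord0.
Qed.

(* Weak duality for the linear program defining the volume. *)
Lemma frac_cost (R : realType) (H G : sgraph) (c : R) :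
  (frac_extremal R H < c%:E)%E -> (0 < num_vertices G)%N -> (0 < num_edges G)%N ->
  forall y : G -> R, (forall x, 0 <= y x) ->
  exists2 mu : H -> {set G}, jumbled_model mu &
    density R G * (\sum_u \sum_(x in mu u) y x) <= c * \sum_x y x.
Proof.
move=> cfc G0 e0 y y0; set d := density R G.
have d0 : 0 < d by rewrite divr_gt0 ?ltr0n.
have ratio : (d%:E / volume R H G < c%:E)%E.
  by apply: le_lt_trans cfc; apply: ereal_sup_ubound; exists G.
have vol0 := volume_ge0 R H G.
have c0 : 0 < c.
  rewrite -lte_fin; apply: le_lt_trans ratio; apply: mule_ge0; first by rewrite lee_fin ltW.
  by rewrite inve_ge0.
(* A volume of at most d / c would make the ratio at least [c]; volume 0 makes it infinite, as d >
   0. *)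
have : ((d / c)%:E < volume R H G)%E.
  rewrite ltNge; apply/negP=> Vle; move: ratio.
  have Vfin : volume R H G \is a fin_num.
    by rewrite ge0_fin_numE // (le_lt_trans Vle) // ltry.
  move: vol0 Vle; rewrite -(fineK Vfin); move: (fine _) => v; rewrite !lee_fin => v0 vle.
  have [->|vn0] := eqVneq v 0; first by rewrite inve0 gt0_muley ?lte_fin.
  have vp : 0 < v by rewrite lt_neqAle eq_sym vn0.
  rewrite inver (negPf vn0) -EFinM lte_fin; apply/negP; rewrite -leNgt ler_pdivlMr //.
  by move: vle; rewrite ler_pdivlMr // mulrC.
case/ereal_sup_gt => _ [n [al [mu [al0 mumod load ->]]]]; rewrite lte_fin => dcs.
have [/existsP[i /asboolP Hi]|no] := boolP [exists i, `[< d * (\sum_u \sum_(x in mu i u) y x) <= c * \sum_x y x >]].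
  by exists (mu i).
exfalso; have big i : c * \sum_x y x < d * (\sum_u \sum_(x in mu i u) y x).
  rewrite ltNge; apply: contra no => Hi; apply/existsP; exists i; exact/asboolP.
(* The load constraints, weighted by [y]. If every model were too expensive, a packing of total more
   than d / c would violate this. *)
have tot : \sum_(i < n) al i * (\sum_u \sum_(x in mu i u) y x) <= \sum_x y x.
  under eq_bigr do rewrite multiplicity_sum mulr_sumr.
  rewrite exchange_big /=; apply: ler_sum => x _.
  under eq_bigr do rewrite mulrCA.
  by rewrite -mulr_sumr -[leRHS]mulr1 ler_wpM2l.
have s0 : 0 < \sum_(i < n) al i by apply: lt_trans dcs; rewrite divr_gt0.
have [i0 ai0] : exists i, 0 < al i.
  apply/existsP; rewrite -[X in is_true X]negbK negb_exists; apply/negP=> /forallP no0.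
  by move: s0; rewrite big1 ?ltxx // => i _; apply/eqP; rewrite eq_le al0 andbT leNgt no0.
have lt : (\sum_(i < n) al i) * (c * \sum_x y x) < d * \sum_x y x.
  apply: lt_le_trans (ler_wpM2l (ltW d0) tot).
  rewrite mulr_suml [X in _ < X]mulr_sumr (bigD1 i0) //= [ltRHS](bigD1 i0) //=; apply: ltr_leD.
    by rewrite [ltRHS]mulrCA ltr_pM2l.
  by apply: ler_sum => i _; rewrite [leRHS]mulrCA ler_wpM2l // ltW.
have Y0 : 0 <= \sum_x y x by apply: sumr_ge0.
move: lt; rewrite mulrA; apply/negP; rewrite -leNgt ler_wpM2r //.
by move: dcs; rewrite ltr_pdivrMr // => /ltW.
Qed.

(** A random sample of [s] vertices has mean weight s Y / n and mean number of arcs s (s - 1) E /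
    n^2. Some sample does at least as well as the ratio of the means, and [frac_cost] applies to the
    graph it spans. The sample size bounds the model independently of |V|, at the price of the
    factor s / (s - 1). *)
Lemma sampled_cost (R : realType) (H : sgraph) (V : finType) (S : rel V) (c : R) (s : nat) (y : V -> R) :
  (frac_extremal R H < c%:E)%E -> (1 < s)%N -> (0 < #|V|)%N -> (forall v, 0 <= y v) ->
  0 < \sum_a \sum_b (S a b && S b a)%:R :> R ->
  exists (w : {ffun 'I_s -> V}) (mu : H -> {set pull_graph S w}), jumbled_model mu /\
    s.-1%:R * (\sum_a \sum_b (S a b && S b a)%:R) * (\sum_u \sum_(i in mu u) y (w i)) <=
    2%:R * s%:R * c * #|V|%:R * \sum_v y v.
Proof.
move=> cfc s1 V0 y0 E0; set E := \sum_a _ in E0 *.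
pose T1 (w : {ffun 'I_s -> V}) := \sum_i y (w i).
pose T2 (w : {ffun 'I_s -> V}) : R := (arcs [set: pull_graph S w])%:R.
pose N : R := #|{ffun 'I_s -> V}|%:R; pose n : R := #|V|%:R; pose Y := \sum_v y v.
have n0 : 0 < n by rewrite ltr0n.
have N0 : 0 < N by rewrite ltr0n; apply/card_gt0P; have /card_gt0P[v _] := V0; exists [ffun=> v].
have A1 : n * \sum_w T1 w = s%:R * Y * N.
  rewrite exchange_big /= mulr_sumr (eq_bigr (fun=> Y * N)); last by move=> i _; apply: sum_sample_one.
  rewrite sumr_const card_ord -[in LHS]mulr_natr; ring.
have A2 : n ^+ 2 * \sum_w T2 w = s%:R * s.-1%:R * E * N.
  under eq_bigr do rewrite /T2 arcs_pull.
  rewrite exchange_big /= mulr_sumr (eq_bigr (fun=> s.-1%:R * (E * N))).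
    rewrite sumr_const card_ord -[in LHS]mulr_natr; ring.
  move=> i _; rewrite exchange_big /= mulr_sumr (eq_bigr (fun=> E * N)); last first.
    by move=> j nij; apply: (sum_sample_pair1 (fun a b => (S a b && S b a)%:R) nij).
  rewrite sumr_const -[LHS]mulr_natl; congr (_%:R * _).
  by have := cardC1 i; rewrite card_ord => <-; apply: eq_card => j; rewrite !inE eq_sym.
have Y0 : 0 <= Y by apply: sumr_ge0.
have s10 : (0 : R) < s.-1%:R by rewrite ltr0n; lia.
have s0 : (0 : R) < s%:R by rewrite ltr0n; lia.
have T2ge w : 0 <= T2 w by apply: ler0n.
have T1ge w : 0 <= T1 w by apply: sumr_ge0.
have S2 : 0 < \sum_w T2 w.
  by rewrite -(pmulr_rgt0 _ (exprn_gt0 2 n0)) A2 !mulr_gt0.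
(* a sample whose weight-to-edges ratio is at most average *)
have [w [w2 Hw]] : exists w, 0 < T2 w /\ T1 w * (\sum_w T2 w) <= T2 w * (\sum_w T1 w).
  pose g w := T2 w * (\sum_w T1 w) - T1 w * (\sum_w T2 w).
  have sg : \sum_w g w = 0 by rewrite big_split /= sumrN -!mulr_suml mulrC subrr.
  have [/existsP[w /andP[w2 gw]]|no] := boolP [exists w, (0 < T2 w) && (0 <= g w)].
    by exists w; rewrite -subr_ge0.
  exfalso; have gneg w : g w <= 0.
    have := T2ge w; rewrite le_eqVlt => /orP[/eqP w2|w2].
      by rewrite /g -w2 mul0r sub0r oppr_le0 mulr_ge0 // ltW.
    by rewrite leNgt; apply: contra no => gw; apply/existsP; exists w; rewrite w2 ltW.
  have [w w2] : exists w, 0 < T2 w.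
    apply/existsP; rewrite -[X in is_true X]negbK negb_exists; apply/negP=> /forallP no0.
    by move: S2; rewrite big1 ?ltxx // => w _; apply/eqP; rewrite eq_le T2ge andbT leNgt no0.
  have : g w < 0.
    by rewrite ltNge; apply: contra no => gw; apply/existsP; exists w; rewrite w2.
  move/eqP: sg; rewrite (bigD1 w) //= => /eqP sg gw.
  have : \sum_(i | i != w) g i <= 0 by apply: sumr_le0.
  lra.
have e2 : (2 * num_edges (pull_graph S w))%N%:R = T2 w by rewrite num_edges_arcs.
have e0 : (0 < num_edges (pull_graph S w))%N by move: w2; rewrite -e2 ltr0n muln_gt0.
have v0 : (0 < num_vertices (pull_graph S w))%N by rewrite /num_vertices card_ord; apply: ltn_trans s1.
have [mu jm Hmu] := frac_cost cfc v0 e0 (fun i => y0 (w i)).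
exists w, mu; split=> //.
set cost := \sum_u _ in Hmu *.
have s2 : 0 < 2%:R * s%:R :> R by rewrite mulr_gt0.
have ed : 2%:R * s%:R * density R (pull_graph S w) = T2 w.
  by rewrite /density /num_vertices card_ord -e2 natrM; field; rewrite gt_eqF.
have {}Hmu : T2 w * cost <= 2%:R * s%:R * c * T1 w.
  by have := ler_wpM2l (ltW s2) Hmu; rewrite mulrA ed -/(T1 w) mulrA.
have c0 : 0 < c.
  rewrite ltNge; apply/negP=> c_le; have cost0 : 0 <= cost by apply: sumr_ge0 => u _; apply: sumr_ge0.
  have : (0 <= frac_extremal R H)%E.
    apply: le_trans (_ : (density R (pull_graph S w))%:E / volume R H (pull_graph S w) <= _)%E; last first.
      by apply: ereal_sup_ubound; exists (pull_graph S w).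
    apply: mule_ge0; first by rewrite lee_fin divr_ge0.
    by rewrite inve_ge0; apply: volume_ge0.
  by move=> h; have := le_lt_trans h cfc; rewrite lte_fin ltNge c_le.
have K1 : T1 w * (s.-1%:R * E) <= T2 w * (n * Y).
  have sN : 0 < s%:R * N by rewrite mulr_gt0.
  rewrite -(ler_pM2l sN).
  have -> : s%:R * N * (T1 w * (s.-1%:R * E)) = n ^+ 2 * (T1 w * \sum_w T2 w).
    by transitivity (T1 w * (n ^+ 2 * \sum_w T2 w)); [rewrite A2; ring|ring].
  have -> : s%:R * N * (T2 w * (n * Y)) = n ^+ 2 * (T2 w * \sum_w T1 w).
    by transitivity (T2 w * n * (n * \sum_w T1 w)); [rewrite A1; ring|ring].
  by rewrite ler_pM2l ?exprn_gt0.
rewrite -(ler_pM2l w2).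
have sE0 : 0 <= s.-1%:R * E by rewrite mulr_ge0 // ltW.
have := ler_wpM2l sE0 Hmu.
have cs : 0 <= 2%:R * s%:R * c by rewrite !mulr_ge0 // ltW.
have := ler_wpM2l cs K1.
rewrite -/Y -/n; move: (2%:R * s%:R * c) (s.-1%:R * E) => q r h1 h2.
have -> : T2 w * (r * cost) = r * (T2 w * cost) by ring.
have -> : T2 w * (q * n * Y) = q * (T2 w * (n * Y)) by ring.
apply: le_trans h2 _; have -> : r * (q * T1 w) = q * (T1 w * r) by ring.
done.
Qed.

Local Open Scope nat_scope.

(** * Dense graphs contain every fixed minor *)

Definition complete_adj t : rel 'I_t := fun i j => i != j.

Lemma complete_adj_sym t : symmetric (@complete_adj t).
Proof. by move=> i j; rewrite /complete_adj eq_sym. Qed.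

Lemma complete_adj_irr t : irreflexive (@complete_adj t).
Proof. by move=> i; rewrite /complete_adj eqxx. Qed.

Definition complete t : sgraph := SGraph (@complete_adj_sym t) (@complete_adj_irr t).

Lemma complete_minor_cone t (G : sgraph) (x : G) :
  minor (complete t) (induced_graph (nbhd [set: G] x)) -> minor (complete t.+1) G.
Proof.
move=> [mu [mucon muadj] mudis].
pose nu (i : complete t.+1) : {set G} :=
  if unlift ord_max i is Some j then val @: mu j else [set x].
have xnu j : x \notin val @: mu j.
  apply/imsetP=> -[y _ Ey]; have := valP y; rewrite inE -Ey adj_irr andbF //.
have adjx j : exists2 y, y \in val @: mu j & adj x y.
  have [/set0Pn[y yj] _] := mucon j; exists (val y); first exact: imset_f.
  by have := valP y; rewrite inE => /andP[].
have cim j : connected_in (G := G) (val @: mu j).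
  have -> : val @: mu j = \bigcup_(y in mu j) [set val y].
    apply/setP=> z; apply/imsetP/bigcupP => -[y yj].
      by move=> ->; exists y => //; rewrite inE.
    by move/set1P->; exists y.
  apply: (rel_connected_bigcup (f := @adj (induced_graph (nbhd [set: G] x))) (@adj_sym G)) => //.
  - exact: mucon.
  - by move=> y _; apply: rel_connected1.
  move=> y y' _ _ yy; exists (val y), (val y'); rewrite !inE; split=> //.
  by apply/orP; right; exact: yy.
exists nu; first split.
- move=> i; rewrite /nu; case: unliftP => [j _|_]; [exact: cim|exact: rel_connected1].
- move=> i i'; rewrite /nu /= /complete_adj; case: unliftP => [j ->|->]; case: unliftP => [j' ->|->].
  + rewrite (inj_eq lift_inj) => njj; have [y [z [yj zj yz]]] := muadj j j' njj.
    by exists (val y), (val z); split=> //; apply: imset_f.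
  + by move=> _; have [y yj xy] := adjx j; exists y, x; rewrite inE adj_sym.
  + by move=> _; have [y yj xy] := adjx j'; exists x, y; rewrite inE.
  by rewrite eqxx.
move=> i i'; rewrite /nu; case: unliftP => [j ->|->]; case: unliftP => [j' ->|->].
- rewrite (inj_eq lift_inj) => njj; apply/pred0P=> z /=; apply/negP=> /andP[/imsetP[y yj ->] /imsetP[y' yj']].
  by move/val_inj=> Ey; have := disjointFr (mudis _ _ njj) yj; rewrite Ey yj'.
- by move=> _; rewrite disjoint_sym disjoints1 xnu.
- by move=> _; rewrite disjoints1 xnu.
by rewrite eqxx.
Qed.

(** In a critical minor every edge lies in many triangles, so the neighbourhood of a vertex has
    minimum degree at least 2D + 3 and satisfies the previous hypothesis; the vertex itself is the
    apex. This makes both extremal functions finite. *)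
Lemma complete_minor_dense t : exists D : nat, forall G : sgraph,
  surplus D 1 [set: G] -> minor (complete t) G.
Proof.
elim: t => [|t [D IH]].
  by exists 0%N => G _; exists (fun=> set0); [split|]; case.
exists (2 * D + 4)%N => G0 crit.
have [||G [mG crG deg _ [tri _]]] := critical_minor (b := 1) _ _ crit => //; first by lia.
apply: minor_trans mG.
have /card_gt0P[x _] : (0 < #|[set: G]|)%N.
  by have := arcs_leq [set: G]; move: crG; rewrite /surplus; nia.
apply: (complete_minor_cone (x := x)); apply: IH.
have aN : (#|nbhd setT x| * (2 * D + 3) <= arcs (nbhd setT x))%N.
  rewrite -sum_nat_const; apply: leq_sum => y; rewrite !inE /= => xy.
  by have := tri x y xy; rewrite addnS ltnS.
have dx := deg x; rewrite /surplus cardsT -/(num_vertices _) num_vertices_induced arcs_induced.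
by move: aN dx; move: #|_| (arcs _) => m a; clear; nia.
Qed.

Lemma minor_dense (H : sgraph) : exists D : nat, forall G : sgraph,
  (0 < num_vertices G)%N -> (2 * D * num_vertices G < arcs [set: G])%N -> minor H G.
Proof.
have [D HD] := complete_minor_dense #|H|; exists D => G v0 dense.
have HK : subgraph H (complete #|H|).
  exists (@enum_rank H); first exact: enum_rank_inj.
  by move=> x y xy; rewrite /= /complete_adj (inj_eq enum_rank_inj); apply: contraTneq xy => ->; rewrite adj_irr.
apply: minor_trans (minor_subgraph HK) (HD G _).
have := arcs_leq [set: G]; rewrite /surplus cardsT -/(num_vertices G).
by move: v0 dense; move: (num_vertices G) (arcs _) => v a; clear; nia.
Qed.

Local Open Scope ring_scope.

(** * Random samples contain minors *)

(** Disjoint branch sets in a sample with repetitions project to sets that overlap at [x] at most as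
    often as [x] was sampled. *)
Lemma pull_minor_model (H G : sgraph) s (w : {ffun 'I_s -> G}) :
  minor H (pull_graph (@adj G) w) ->
  exists2 mu : H -> {set G}, jumbled_model mu &
    forall x, (multiplicity mu x <= #|[set i | w i == x]|)%N.
Proof.
move=> [br [brcon bradj] brdis]; exists (fun u => w @: br u); first split.
- move=> u; have -> : w @: br u = \bigcup_(i in br u) [set w i].
    apply/setP=> z; apply/imsetP/bigcupP => -[i iu].
      by move=> ->; exists i => //; rewrite inE.
    by move/set1P->; exists i.
  apply: (rel_connected_bigcup (f := @adj (pull_graph (@adj G) w)) (@adj_sym G)) => //.
  + exact: brcon.
  + by move=> i _; apply: rel_connected1.
  by move=> i j _ _ /andP[_ /andP[ij _]]; exists (w i), (w j); rewrite !inE ij orbT.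
- move=> u v /bradj[i [j [iu jv /andP[_ /andP[ij _]]]]].
  by exists (w i), (w j); split=> //; apply: imset_f.
move=> x; rewrite /multiplicity.
pose g (u : H) := [pick i in br u | w i == x].
have gP u : x \in w @: br u -> exists2 i, g u = Some i & (i \in br u) && (w i == x).
  move=> /imsetP[i iu Ex]; rewrite /g; case: pickP => [j jP|no]; first by exists j.
  by have := no i; rewrite iu Ex eqxx.
have g_in : {in [set u | x \in w @: br u] &, injective g}.
  move=> u v; rewrite !inE => /gP[i gi /andP[iu _]] /gP[j gj /andP[jv _]]; rewrite gi gj => -[Eij].
  apply/eqP; apply/negPn/negP => nuv; have := disjointFr (brdis _ _ nuv) iu; by rewrite Eij jv.
rewrite -(card_in_imset g_in) -(card_imset [set i | w i == x] (@Some_inj _)); apply: subset_leq_card.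
apply/subsetP=> _ /imsetP[u + ->]; rewrite inE => /gP[i -> /andP[_ wi]].
by apply: imset_f; rewrite inE.
Qed.

(** All samples spanning an [H] minor get the same weight. A vertex is sampled m / n times on
    average, so the weight n / (m N) loads it by at most 1. *)
Lemma volume_sample (R : realType) (H G : sgraph) m :
  (0 < num_vertices G)%N -> (0 < m)%N ->
  (((num_vertices G)%:R / (m%:R * #|{ffun 'I_m -> G}|%:R) *
    #|[set w : {ffun 'I_m -> G} | `[< minor H (pull_graph (@adj G) w) >]]|%:R)%:E
   <= volume R H G)%E.
Proof.
move=> v0 m0; set good := [set w | _]; pose n : R := (num_vertices G)%:R.
pose N : R := #|{ffun 'I_m -> G}|%:R; set al := n / (m%:R * N).
have n0 : 0 < n by rewrite ltr0n.
have m0' : (0 : R) < m%:R by rewrite ltr0n.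
have N0 : 0 < N.
  by rewrite ltr0n; apply/card_gt0P; move: v0 => /card_gt0P[v _]; exists [ffun=> v].
have al0 : 0 < al by rewrite divr_gt0 // mulr_gt0.
have mod_ex (i : 'I_#|good|) : exists mu : H -> {set G}, jumbled_model mu /\
    forall x, (multiplicity mu x <= #|[set j | enum_val i j == x]|)%N.
  have := enum_valP i; rewrite inE => /asboolP /pull_minor_model[mu jm lm]; by exists mu.
pose mu i := projT1 (cid (mod_ex i)).
have muP i : jumbled_model (mu i) /\ forall x, (multiplicity (mu i) x <= #|[set j | enum_val i j == x]|)%N.
  by rewrite /mu; case: cid.
apply: ereal_sup_ubound; exists #|good|, (fun=> al), mu; split.
- by move=> i; apply: ltW.
- by move=> i; case: (muP i).
- move=> x; rewrite -mulr_sumr.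
  have tot : n * \sum_(w : {ffun 'I_m -> G}) (\sum_i (w i == x)%:R) = m%:R * N.
    rewrite exchange_big /= mulr_sumr (eq_bigr (fun=> N)); last first.
      move=> i _; rewrite [LHS](sum_sample_one i (fun y : G => (y == x)%:R : R)).
      by rewrite (bigD1 x) //= eqxx big1 ?addr0 ?mul1r // => y /negPf->.
    by rewrite sumr_const card_ord -[LHS]mulr_natl.
  have le : \sum_(i < #|good|) (multiplicity (mu i) x)%:R <= \sum_(w : {ffun 'I_m -> G}) (\sum_i (w i == x)%:R) :> R.
    have E (w : {ffun 'I_m -> G}) : \sum_i (w i == x)%:R = #|[set j | w j == x]|%:R :> R.
      rewrite -sum1_card natr_sum big_mkcond [RHS]big_mkcond /=.
      by apply: eq_bigr => j _; rewrite inE; case: eqP.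
    apply: (le_trans (y := \sum_(w in good) \sum_i (w i == x)%:R)).
      rewrite [leRHS]big_enum_val /=; apply: ler_sum => i _; rewrite E ler_nat.
      by case: (muP i).
    rewrite [leRHS](bigID (mem good)) /= lerDl; apply: sumr_ge0 => w _; apply: sumr_ge0 => i _; exact: ler0n.
  apply: le_trans (ler_wpM2l (ltW al0) le) _.
  rewrite /al mulrAC tot divff // gt_eqF // mulr_gt0 //.
by rewrite sumr_const card_ord -[in RHS]mulr_natr.
Qed.

Lemma arcs_sum (R : realType) (G : sgraph) :
  (arcs [set: G])%:R = \sum_(a : G) \sum_(b : G) (adj a b)%:R :> R.
Proof.
rewrite /arcs natr_sum; apply: eq_big => [a|a _]; first by rewrite inE.
rewrite -sum1_card natr_sum big_mkcond [RHS]big_mkcond /=.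
by apply: eq_bigr => b _; rewrite !inE; case: (adj a b).
Qed.

(* Chebyshev's inequality for the number of edges spanned by [m] independent
   vertices: two pairs of indices interact only when they share an index. *)
Lemma sample_edges_variance (R : realType) (G : sgraph) m (q mu : R) :
  (0 < num_vertices G)%N ->
  q = (arcs [set: G])%:R / (num_vertices G)%:R ^+ 2 ->
  mu = m%:R * m.-1%:R * q ->
  \sum_(w : {ffun 'I_m -> G}) ((arcs [set: pull_graph (@adj G) w])%:R - mu) ^+ 2 <=
  4%:R * m%:R * mu * #|{ffun 'I_m -> G}|%:R.
Proof.
move=> v0 Eq Emu; pose n : R := (num_vertices G)%:R; pose N : R := #|{ffun 'I_m -> G}|%:R.
have n0 : 0 < n by rewrite ltr0n.
have n2 : n ^+ 2 != 0 by rewrite expf_neq0 // gt_eqF.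
have q0 : 0 <= q by rewrite Eq divr_ge0 // exprn_ge0 // ltW.
have N0 : 0 <= N by apply: ler0n.
pose A (p : 'I_m * 'I_m) (w : {ffun 'I_m -> G}) : R := (adj (w p.1) (w p.2))%:R.
pose Dg : pred ('I_m * 'I_m) := fun p => p.1 != p.2.
have sumadj : \sum_(a : G) \sum_(b : G) (adj a b)%:R = q * n ^+ 2 :> R.
  by rewrite Eq -/n divfK // arcs_sum.
have T2E w : (arcs [set: pull_graph (@adj G) w])%:R = \sum_(p | Dg p) A p w.
  rewrite arcs_pull pair_big_dep /=; apply: eq_big => p //.
  by move=> _; rewrite /A (adj_sym (w p.2)) andbb.
have EA p : Dg p -> \sum_w A p w = q * N.
  move=> dp; apply: (mulfI n2); rewrite [LHS](sum_sample_pair1 (fun a b => (adj a b)%:R) dp) sumadj.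
  by rewrite -/N; ring.
have A01 p w : 0 <= A p w <= 1 by rewrite /A; case: (adj _ _); rewrite ?lexx ?ler01.
(* Bounds the indicator that two pairs of indices share an index. Sharing pairs contribute at most
   [q] each, the others exactly q^2, and a pair shares with at most 4m others. *)
pose meet (p p' : 'I_m * 'I_m) : R :=
  (p'.1 == p.1)%:R + (p'.1 == p.2)%:R + (p'.2 == p.1)%:R + (p'.2 == p.2)%:R.
have meet0 p p' : 0 <= meet p p' by rewrite /meet !addr_ge0.
have EAA p p' : Dg p -> Dg p' -> \sum_w A p w * A p' w <= (q * q + meet p p' * q) * N.
  move=> dp dp'; have [|nm] := boolP [|| p'.1 == p.1, p'.1 == p.2, p'.2 == p.1 | p'.2 == p.2].
    move=> m1; have mge : 1 <= meet p p'.
      rewrite /meet; move: m1; do 4 case: (_ == _) => //=; move=> _; lra.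
    apply: (le_trans (y := q * N)).
      rewrite -(EA p dp); apply: ler_sum => w _; have /andP[a0 _] := A01 p w; have /andP[_ b1] := A01 p' w.
      by rewrite -[leRHS]mulr1 ler_wpM2l.
    rewrite ler_wpM2r // -[leLHS]add0r lerD ?mulr_ge0 // -[leLHS]mul1r ler_wpM2r //.
  move: nm; rewrite !negb_or => /and4P[n1 n2' n3 n4].
  have -> : meet p p' = 0 by rewrite /meet (negPf n1) (negPf n2') (negPf n3) (negPf n4) !addr0.
  have hinv (w : {ffun 'I_m -> G}) a b : A p' (upd (upd w p.1 a) p.2 b) = A p' w.
    by rewrite /A !ffunE (negPf n1) (negPf n2') (negPf n3) (negPf n4).
  rewrite mul0r addr0 le_eqVlt; apply/orP; left; apply/eqP; apply: (mulfI n2).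
  rewrite [LHS](sum_sample_pair (fun a b => (adj a b)%:R) dp hinv) sumadj EA //; ring.
have cD : \sum_(p | Dg p) 1 = m%:R * m.-1%:R :> R.
  rewrite -(pair_big_dep xpredT (fun i j : 'I_m => i != j) (fun _ _ => 1 : R)) /=.
  rewrite (eq_bigr (fun=> m.-1%:R)); first by rewrite sumr_const card_ord -[LHS]mulr_natl.
  move=> i _; rewrite sumr_const; congr (_%:R); have := cardC1 i; rewrite card_ord => <-.
  by apply: eq_card => j; rewrite !inE eq_sym.
have Emeet p : \sum_(p' | Dg p') meet p p' <= 4%:R * m%:R.
  have E0 (a : 'I_m) : \sum_(i : 'I_m) \sum_(j : 'I_m) (i == a)%:R = m%:R :> R.
    rewrite (eq_bigr (fun i => (i == a)%:R * m%:R)); last first.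
      by move=> i _; rewrite sumr_const card_ord mulr_natr.
    by rewrite -mulr_suml (bigD1 a) //= eqxx big1 ?addr0 ?mul1r // => i /negPf->.
  have E1 (a : 'I_m) : \sum_(p' : 'I_m * 'I_m) (p'.1 == a)%:R = m%:R :> R.
    by rewrite -[RHS](E0 a) pair_big.
  have E2 (a : 'I_m) : \sum_(p' : 'I_m * 'I_m) (p'.2 == a)%:R = m%:R :> R.
    by rewrite -[RHS](E0 a) exchange_big /= pair_big.
  apply: (le_trans (y := \sum_(p' : 'I_m * 'I_m) meet p p')).
    by rewrite [leRHS](bigID Dg) /= lerDl sumr_ge0.
  rewrite /meet !big_split /= !E1 !E2; lra.
have S1 : \sum_(w : {ffun 'I_m -> G}) \sum_(p | Dg p) A p w = mu * N.
  rewrite exchange_big /= (eq_bigr (fun=> 1 * (q * N))); last by move=> p dp; rewrite mul1r EA.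
  by rewrite -mulr_suml cD Emu; ring.
have S2 : \sum_(w : {ffun 'I_m -> G}) (\sum_(p | Dg p) A p w) ^+ 2 <=
    (mu ^+ 2 + 4%:R * m%:R * mu) * N.
  have -> : \sum_(w : {ffun 'I_m -> G}) (\sum_(p | Dg p) A p w) ^+ 2 =
      \sum_(p | Dg p) \sum_(p' | Dg p') \sum_w A p w * A p' w.
    under eq_bigr => w _ do rewrite expr2 mulr_suml.
    rewrite exchange_big /=; apply: eq_bigr => p _; rewrite exchange_big /=.
    by apply: eq_bigr => w _; rewrite mulr_sumr.
  apply: (le_trans (y := \sum_(p | Dg p) 1 * ((m%:R * m.-1%:R * (q * q) + 4%:R * m%:R * q) * N))).
    apply: ler_sum => p dp; rewrite mul1r.
    apply: le_trans (ler_sum _ (fun p' dp' => EAA p p' dp dp')) _.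
    rewrite -mulr_suml ler_wpM2r // big_split /=; apply: lerD; last by rewrite -mulr_suml ler_wpM2r // Emeet.
    by rewrite -cD mulr_suml; under [leRHS]eq_bigr do rewrite mul1r.
  by rewrite -mulr_suml cD Emu le_eqVlt; apply/orP; left; apply/eqP; ring.
under eq_bigr => w _ do rewrite T2E sqrrB.
rewrite !big_split /= sumrN -/N.
have -> : \sum_(w : {ffun 'I_m -> G}) (\sum_(p | Dg p) A p w) * mu *+ 2 = 2%:R * mu * (mu * N).
  by rewrite -S1 mulr_sumr; apply: eq_bigr => w _; rewrite -mulr_natl; ring.
rewrite sumr_const -[X in _ + X]mulr_natl -/N; move: S2; move: (\sum_w _) => T; lra.
Qed.

(** A bad sample misses the mean [mu] by eps mu, since 2cm <= (1 - eps) mu. Chebyshev bounds the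
    share of bad samples by 4 / (eps^2 (m - 1) q) <= 2 / (eps^2 c) <= eps. The constant 7 absorbs (1
    + eps) / (1 - eps)^2 for eps <= 1/4. *)
Lemma frac_extremal_upper (R : realType) (H : sgraph) (c eps : R) :
  0 < eps -> eps <= 4%:R^-1 -> 2%:R <= eps ^+ 3 * c ->
  (forall G : sgraph, (0 < num_vertices G)%N ->
     2%:R * c * (num_vertices G)%:R < (arcs [set: G])%:R -> minor H G) ->
  (frac_extremal R H <= (c * (1 + 7%:R * eps))%:E)%E.
Proof.
move=> e0 e4 ec minorH.
have c0 : 0 < c by rewrite -(pmulr_rgt0 _ (exprn_gt0 3 e0)); apply: lt_le_trans ec.
have K0 : 0 <= c * (1 + 7%:R * eps) by rewrite mulr_ge0 ?ltW // addr_gt0 // mulr_gt0.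
apply: ge_ereal_sup => _ [G [v0 ->]]; set d := density R G.
pose n : R := (num_vertices G)%:R; have n0 : 0 < n by rewrite ltr0n.
have [e_0|e_pos] := posnP (num_edges G).
  by rewrite /d /density e_0 mul0r mul0e lee_fin.
have d0 : 0 < d by rewrite divr_gt0 ?ltr0n.
have Ed : (arcs [set: G])%:R = 2%:R * d * n :> R.
  by rewrite -num_edges_arcs natrM /d /density; field; rewrite gt_eqF.
have d_n : 2%:R * d <= n.
  rewrite -(ler_pM2r n0) -Ed -natrM ler_nat; apply: leq_trans (arcs_leq _) _.
  by rewrite cardsT -/(num_vertices G) leq_mul2l leq_pred orbT.
have e1 : 0 < 1 - eps by move: e4; lra.
pose y := c * n / ((1 - eps) * d).
have y0 : 0 <= y by rewrite divr_ge0 // mulr_ge0 // ltW.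
(* The 2 gives m - 1 >= y, the factor that occurs in the mean m (m - 1) q. *)
pose m := (Num.trunc y).+2.
have my : y <= m.-1%:R by apply: ltW; apply: truncnS_gt.
have ym : m%:R <= y + 2%:R.
  have /andP[ty _] := truncn_itv y0; rewrite /m -addn2 natrD; lra.
have m1 : (0 : R) < m.-1%:R by rewrite ltr0n.
have mp : (0 : R) < m%:R by rewrite ltr0n.
have cm : c * n <= (1 - eps) * (m.-1%:R * d).
  have dd : 0 < (1 - eps) * d by rewrite mulr_gt0.
  have := ler_wpM2r (ltW dd) my; rewrite {1}/y divfK ?gt_eqF //.
  by rewrite mulrCA.
pose q : R := 2%:R * d / n; pose mu := m%:R * m.-1%:R * q.
have Eq : q = (arcs [set: G])%:R / (num_vertices G)%:R ^+ 2.
  by rewrite Ed /q -/n; field; rewrite gt_eqF.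
have q0 : 0 < q by rewrite divr_gt0 // mulr_gt0.
have mu0 : 0 < mu := mulr_gt0 (mulr_gt0 mp m1) q0.
have var := sample_edges_variance v0 Eq (erefl mu).
pose N : R := #|{ffun 'I_m -> G}|%:R; rewrite -/N in var.
have N0 : 0 < N.
  by rewrite ltr0n; apply/card_gt0P; move: (v0) => /card_gt0P[v _]; exists [ffun=> v].
pose good := [set w : {ffun 'I_m -> G} | `[< minor H (pull_graph (@adj G) w) >]].
have cmu : 2%:R * c * m%:R <= (1 - eps) * mu.
  rewrite -(ler_pM2r n0).
  have -> : (1 - eps) * mu * n = 2%:R * m%:R * ((1 - eps) * (m.-1%:R * d)).
    by rewrite /mu /q; field; rewrite gt_eqF.
  have m2 : (0 : R) < 2%:R * m%:R by rewrite pmulr_rgt0 ?ltr0n.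
  have -> : 2%:R * c * m%:R * n = 2%:R * m%:R * (c * n) by ring.
  by rewrite ler_pM2l.
have bad_far (w : {ffun 'I_m -> G}) : w \notin good ->
    (eps * mu) ^+ 2 <= ((arcs [set: pull_graph (@adj G) w])%:R - mu) ^+ 2.
  rewrite inE => /asboolP nm; have T2 : (arcs [set: pull_graph (@adj G) w])%:R <= 2%:R * c * m%:R.
    rewrite leNgt; apply/negP=> lt; apply: nm; apply: minorH; first by rewrite /num_vertices card_ord.
    by rewrite /num_vertices card_ord.
  rewrite -[leRHS]sqrrN; apply: lerXn2r; rewrite ?nnegrE.
  - by rewrite mulr_ge0 // ltW.
  - by move: T2 cmu mu0 e0; move: ((arcs _)%:R : R) => T; nra.
  by move: T2 cmu; move: ((arcs _)%:R : R) => T; lra.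
have badle : #|~: good|%:R * (eps * mu) ^+ 2 <= 4%:R * m%:R * mu * N.
  apply: le_trans var; rewrite mulr_natl -sumr_const [leRHS](bigID (mem good)) /=.
  rewrite -[leLHS]add0r; apply: lerD; first by apply: sumr_ge0 => w _; apply: sqr_ge0.
  rewrite (eq_bigl (fun w => w \notin good)); last by move=> w; rewrite inE.
  by apply: ler_sum => w; apply: bad_far.
have bad_eps : #|~: good|%:R <= eps * N.
  have h1 : #|~: good|%:R * (eps ^+ 2 * (m.-1%:R * q)) <= 4%:R * N.
    have mm : 0 < m%:R * mu by rewrite mulr_gt0.
    rewrite -(ler_pM2r mm); apply: le_trans (_ : 4%:R * m%:R * mu * N <= _); last by rewrite le_eqVlt; apply/orP; left; apply/eqP; ring.
    by apply: le_trans badle; rewrite le_eqVlt; apply/orP; left; apply/eqP; rewrite /mu; ring.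
  have h2 : 2%:R * c <= m.-1%:R * q.
    rewrite -(ler_pM2r n0); have -> : m.-1%:R * q * n = 2%:R * (m.-1%:R * d) by rewrite /q; field; rewrite gt_eqF.
    have : (1 - eps) * (m.-1%:R * d) <= m.-1%:R * d.
      by rewrite -[leRHS]mul1r ler_wpM2r ?mulr_ge0 // ?ltW //; move: e0; lra.
    move: cm; lra.
  have h3 : #|~: good|%:R * (eps ^+ 2 * (2%:R * c)) <= 4%:R * N.
    by apply: le_trans h1; rewrite ler_wpM2l // ler_wpM2l // exprn_ge0 // ltW.
  have b0 : (0 : R) <= #|~: good|%:R by apply: ler0n.
  have h4 : #|~: good|%:R * 4%:R <= eps * (4%:R * N).
    apply: le_trans (ler_wpM2l (ltW e0) h3).
    have -> : eps * (#|~: good|%:R * (eps ^+ 2 * (2%:R * c))) = #|~: good|%:R * (2%:R * (eps ^+ 3 * c)) by ring.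
    by rewrite ler_wpM2l //; move: ec; lra.
  by move: h4; lra.
have good_big : (1 - eps) * N <= #|good|%:R.
  have := cardsC good; move/(congr1 (fun k => k%:R : R)); rewrite natrD -/N; move: bad_eps; lra.
pose r := (1 - eps) * n / m%:R.
have r0 : 0 < r by rewrite divr_gt0 // mulr_gt0.
have Vr : (r%:E <= volume R H G)%E.
  apply: le_trans (volume_sample R H v0 (ltn0Sn _ : 0 < m)%N); rewrite lee_fin -/n -/good.
  apply: (le_trans (y := n / (m%:R * N) * ((1 - eps) * N))); last by rewrite ler_wpM2l // divr_ge0 ?mulr_ge0 // ltW.
  by rewrite le_eqVlt; apply/orP; left; apply/eqP; rewrite /r; field; rewrite !gt_eqF.
have dr : d / r <= c * (1 + 7%:R * eps).
  rewrite ler_pdivrMr // /r mulrA ler_pdivlMr //.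
  have h1 : d * m%:R <= d * (y + 2%:R) by rewrite ler_pM2l.
  have h2 : (1 - eps) * (d * y) = c * n by rewrite /y; field; rewrite !gt_eqF.
  have h3 : eps * c >= 2%:R.
    apply: le_trans ec _; rewrite ler_pM2r // 2!exprS expr1 -[leRHS]mulr1 ler_pM2l //.
    by move: e0 e4; clear; nra.
  rewrite -(ler_pM2l e1); apply: le_trans (ler_wpM2l (ltW e1) h1) _.
  rewrite mulrDr (mulrDr (1 - eps)) h2.
  have h4 : (1 - eps) * (d * 2%:R) <= n.
    by apply: le_trans d_n; rewrite -[leRHS]mul1r (mulrC d) ler_wpM2r ?mulr_ge0 // ?ltW //; move: e0; lra.
  apply: (le_trans (y := c * n + eps * c * n)).
    rewrite lerD2l; apply: le_trans h4 _; rewrite -[leLHS]mul1r ler_wpM2r ?ltW //; move: h3; lra.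
  have cn0 : 0 < c * n by rewrite mulr_gt0.
  have -> : c * n + eps * c * n = c * n * (1 + eps) by ring.
  have -> : (1 - eps) * (c * (1 + 7%:R * eps) * ((1 - eps) * n)) = c * n * ((1 - eps) ^+ 2 * (1 + 7%:R * eps)) by ring.
  by rewrite ler_pM2l //; move: e0 e4; nra.
move: Vr; case: (volume R H G) => [v| |] //; last by rewrite invey mule0 lee_fin.
rewrite lee_fin => rv; have v_pos : 0 < v by apply: lt_le_trans rv.
rewrite inver gt_eqF // -EFinM lee_fin; apply: le_trans dr.
by rewrite ler_pM2l // lef_pV2.
Qed.

(** * Graphs with strongly sublinear separators *)

(** Write x^beta as x / x^(1 - beta). A part of size at most 3n/4 has a denominator smaller than
    that of [n] by the factor rho = (3/4)^(1 - beta). *)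
Lemma powR_gain (R : realType) (beta : R) : 0 <= beta -> beta < 1 ->
  exists2 rho : R, 0 < rho < 1 &
    forall n a1 a2 : R, 0 < n -> 0 < a1 -> 0 < a2 -> 4%:R * a1 <= 3%:R * n -> 4%:R * a2 <= 3%:R * n ->
      n <= a1 + a2 -> n `^ beta <= rho * (a1 `^ beta + a2 `^ beta).
Proof.
move=> b0 b1; pose dl : R := 1 - beta; have dl0 : 0 < dl by rewrite subr_gt0.
have q0 : (0 : R) < 3%:R / 4%:R by lra.
have q1 : (3%:R / 4%:R : R) < 1 by lra.
have hb (x : R) : 0 < x -> x `^ beta = x / x `^ dl.
  move=> x0; have -> : beta = 1 - dl by rewrite /dl; ring.
  rewrite powRB; last by apply/implyP=> _; rewrite gt_eqF.
  by rewrite powRr1 // ltW.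
exists ((3%:R / 4%:R) `^ dl).
  rewrite powR_gt0 //= -[X in _ < X](_ : 1 `^ dl = 1); last by rewrite powR1.
  by apply: gt0_ltr_powR; rewrite ?nnegrE // ltW.
move=> n a1 a2 n0 a10 a20 h1 h2 h12; set rho := (_ `^ dl).
have rho0 : 0 < rho by apply: powR_gt0.
have hn0 : 0 < n `^ dl by apply: powR_gt0.
have half (a : R) : 0 < a -> 4%:R * a <= 3%:R * n -> a / n `^ dl <= rho * a `^ beta.
  move=> a0 ha; rewrite hb //; have ha0 : 0 < a `^ dl by apply: powR_gt0.
  have le : a `^ dl <= rho * n `^ dl.
    rewrite -powRM ?(ltW q0) ?(ltW n0) //; apply: ge0_ler_powR; rewrite ?nnegrE ?(ltW dl0) ?(ltW a0) //.
      by rewrite mulr_ge0 // ltW.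
    lra.
  rewrite mulrCA ler_pM2l // ler_pdivlMr // mulrC ler_pdivrMr //.
rewrite (hb n n0) mulrDr; have := half a1 a10 h1; have := half a2 a20 h2.
have : n / n `^ dl <= (a1 + a2) / n `^ dl by rewrite ler_pM2r // invr_gt0.
rewrite mulrDl; move: (n / _) (a1 / _) (a2 / _) (rho * a1 `^ _) (rho * a2 `^ _) => v v1 v2 u1 u2; lra.
Qed.

Lemma powR_small (R : realType) (beta eps : R) : beta < 1 -> 0 < eps ->
  exists N : nat, forall n : nat, (N <= n)%N -> n%:R `^ beta <= eps * n%:R.
Proof.
move=> b1 e0; pose dl : R := 1 - beta; have dl0 : 0 < dl by rewrite subr_gt0.
pose t : R := eps^-1 `^ dl^-1.
have t0 : 0 < t by rewrite powR_gt0 // invr_gt0.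
exists (Num.trunc t).+1 => n Nn.
have tn : t <= n%:R.
  by apply: ltW; apply: lt_le_trans (_ : (Num.trunc t).+1%:R <= _); rewrite ?ler_nat // truncnS_gt.
have n0 : (0 : R) < n%:R by apply: lt_le_trans tn.
have -> : beta = 1 - dl by rewrite /dl; ring.
rewrite powRB; last by apply/implyP=> _; rewrite gt_eqF.
rewrite powRr1 ?(ltW n0) // mulrC ler_pM2r //.
rewrite -[leRHS]invrK lef_pV2 ?posrE ?invr_gt0 ?powR_gt0 //.
have -> : eps^-1 = t `^ dl.
  by rewrite /t -powRrM mulVf ?gt_eqF // powRr1 // invr_ge0 ltW.
by apply: ge0_ler_powR; rewrite ?nnegrE ?(ltW dl0) ?(ltW t0) ?(ltW n0).
Qed.

(** Isolates what the recursion uses of the power function. A negative exponent is replaced by 0,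
    and the threshold [n0.+1] makes the base at least 1, so that raising the exponent keeps the
    bound. *)
Lemma separator_function (R : realType) (F : sgraph -> Prop) :
  strongly_sublinear_separators R F ->
  exists (phi : nat -> R) (c rho : R) (n0 : nat),
    [/\ 0 < c /\ 0 < rho < 1, forall n, 0 <= phi n,
        forall eps, 0 < eps -> exists N : nat, forall n, (N <= n)%N -> phi n <= eps * n%:R,
        forall n a1 a2 : nat, (0 < n)%N -> (0 < a1)%N -> (0 < a2)%N -> (4 * a1 <= 3 * n)%N ->
          (4 * a2 <= 3 * n)%N -> (n <= a1 + a2)%N -> phi n <= rho * (phi a1 + phi a2)
      & forall G, F G -> (n0 <= num_vertices G)%N -> exists A1 A2 : {set G},
          [/\ separation A1 A2, (num_vertices G <= 3 * #|A1|)%N, (num_vertices G <= 3 * #|A2|)%N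
            & #|A1 :&: A2|%:R <= c * phi (num_vertices G)]].
Proof.
move=> [_ [beta [c [n0 [b1 c0 H]]]]].
pose bb := Num.max beta 0; have bb0 : 0 <= bb by rewrite le_max lexx orbT.
have bb1 : bb < 1 by rewrite gt_max b1 ltr01.
have [rho rho01 gain] := powR_gain bb0 bb1.
exists (fun n => n%:R `^ bb), c, rho, n0.+1; split=> //.
- by move=> eps e0; apply: powR_small.
- move=> n a1 a2 n_0 a10 a20 h1 h2 h12; apply: gain; rewrite ?ltr0n //.
  + by rewrite -!natrM ler_nat.
  + by rewrite -!natrM ler_nat.
  by rewrite -natrD ler_nat.
move=> G FG nG; have [A1 [A2 [sep [bal1 bal2] ord]]] := H G FG (ltnW nG).
have v1 : (1 : R) <= (num_vertices G)%:R by rewrite ler1n; apply: leq_ltn_trans nG.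
exists A1, A2; split=> //.
- by move: bal1; rewrite ler_pdivrMr // -natrM ler_nat mulnC.
- by move: bal2; rewrite ler_pdivrMr // -natrM ler_nat mulnC.
apply: le_trans ord _; rewrite ler_pM2l //; apply: ler_powR => //.
by rewrite le_max lexx.
Qed.

(* Splitting recursively along separators costs [1 + 2 eta - Cst phi n / n] per
   vertex; the concavity of [phi] pays for the duplicated separators. *)
Lemma sublinear_pieces (R : realType) (F : sgraph -> Prop) (eta : R) :
  strongly_sublinear_separators R F -> 0 < eta -> eta <= 1 ->
  exists k : nat, forall H, F H -> exists ss : seq {set H},
    [/\ forall B, B \in ss -> (0 < #|B| <= k)%N,
        forall u, has (fun B : {set H} => u \in B) ss,
        forall u v, adj u v -> has (fun B : {set H} => (u \in B) && (v \in B)) ss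
      & (\sum_(B <- ss) #|B|)%N%:R <= (1 + eta) * (num_vertices H)%:R].
Proof.
move=> hF e0 e1; have [clF _] := hF.
have [phi [c [rho [n0 [[c0 /andP[r0 r1]] phi0 small gain sepF]]]]] := separator_function hF.
(* Solves Cst (1 - rho) = 2 c rho: the growth of Cst phi under splitting then pays for 2 c phi,
   which is at least 1 + eta times the separator. *)
pose Cst : R := 2%:R * c * rho / (1 - rho).
have r1' : 0 < 1 - rho by rewrite subr_gt0.
have C0 : 0 < Cst by rewrite divr_gt0 // !mulr_gt0.
have [N1 HN1] := small (eta / Cst) (divr_gt0 e0 C0).
(* A separator of at most 1/12 of the vertices leaves each side at most 1 - 1/3 + 1/12 = 3/4 of
   them, as the gain requires. *)
have q12 : 0 < 12%:R^-1 / c by rewrite divr_gt0 // invr_gt0 ltr0n.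
have [N2 HN2] := small (12%:R^-1 / c) q12.
pose k0 := (N1 + N2 + n0 + 1)%N.
have [N1k N2k n0k k00] : [/\ N1 <= k0, N2 <= k0, n0 <= k0 & 0 < k0]%N by rewrite /k0; split; clear; lia.
exists (3 * k0)%N => H FH.
pose bnd (m : nat) : R := if (k0 <= m)%N then eta * m%:R - Cst * phi m else 0.
have bnd0 m : 0 <= bnd m <= eta * m%:R.
  rewrite /bnd; case: ifP => [km|_]; last by rewrite lexx mulr_ge0 // ltW.
  have : phi m <= eta / Cst * m%:R by apply: HN1; apply: leq_trans N1k km.
  rewrite mulrAC ler_pdivlMr // => h; have := phi0 m => p0.
  have P : 0 <= Cst * phi m by rewrite mulr_ge0 // ltW.
  by apply/andP; split; lra.
suff main (A : {set H}) : exists ss : seq {set H},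
    [/\ forall B, B \in ss -> (0 < #|B| <= 3 * k0)%N,
        forall u, u \in A -> has (fun B : {set H} => u \in B) ss,
        forall u v, u \in A -> v \in A -> adj u v -> has (fun B : {set H} => (u \in B) && (v \in B)) ss
      & (\sum_(B <- ss) #|B|)%N%:R <= #|A|%:R + bnd #|A|].
  have [ss [h1 h2 h3 h4]] := main setT; exists ss; split=> // [u|u v|].
  - by apply: h2; rewrite inE.
  - by apply: h3; rewrite inE.
  apply: le_trans h4 _; have /andP[_] := bnd0 #|[set: H]|.
  rewrite cardsT -/(num_vertices H); lra.
have [n] := ubnP #|A|; elim: n A => // n IH A lt.
have [A0|A0] := eqVneq A set0.
  exists [::]; split=> // [u|u v|]; rewrite ?A0 ?inE //.
  by rewrite big_nil cards0 add0r; case/andP: (bnd0 0%N).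
(* Stopping at 3 k0 keeps both sides of every split at least k0, where [bnd] contains its negative
   term. *)
have [small_A|big_A] := leqP #|A| (3 * k0).
  exists [:: A]; split=> [B|u uA|u v uA vA _|] /=.
  - by rewrite inE => /eqP->; rewrite card_gt0 A0.
  - by rewrite uA.
  - by rewrite uA vA.
  by rewrite big_seq1 lerDl; case/andP: (bnd0 #|A|).
have FA : F (induced_graph A) by apply: clF FH _; apply: induced_subgraph.
have vA := num_vertices_induced A.
have k0A : (k0 <= #|A|)%N by apply: ltnW; apply: leq_ltn_trans big_A; rewrite leq_pmull.
have nA : (n0 <= num_vertices (induced_graph A))%N by rewrite vA (leq_trans n0k k0A).
have [A1 [A2 [[cov sep _ _] b1 b2 ord]]] := sepF _ FA nA.
rewrite vA in b1 b2 ord.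
pose B1 : {set H} := val @: A1; pose B2 : {set H} := val @: A2.
have cB1 : #|B1| = #|A1| by apply: card_imset; apply: val_inj.
have cB2 : #|B2| = #|A2| by apply: card_imset; apply: val_inj.
have cs : (#|A1| + #|A2| = #|A| + #|A1 :&: A2|)%N.
  by rewrite -cardsUI cov cardsT -/(num_vertices _) vA addnC.
have s12 : (12 * #|A1 :&: A2| <= #|A|)%N.
  have ph : phi #|A| <= 12%:R^-1 / c * #|A|%:R by apply: HN2; apply: leq_trans N2k k0A.
  have := ler_wpM2l (ltW c0) ph; have -> : c * (12%:R^-1 / c * #|A|%:R) = 12%:R^-1 * #|A|%:R.
    by field; rewrite gt_eqF.
  move=> ph'; have := le_trans ord ph'; rewrite -(ler_nat R) natrM.
  by move: (#|_|%:R : R) (#|_|%:R : R); clear=> a' s'; lra.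
have a10 : (k0 <= #|A1|)%N by move: big_A b1; clear; lia.
have a20 : (k0 <= #|A2|)%N by move: big_A b2; clear; lia.
have q1 : (4 * #|A1| <= 3 * #|A|)%N by move: cs s12 b2 b1; clear; lia.
have q2 : (4 * #|A2| <= 3 * #|A|)%N by move: cs s12 b2 b1; clear; lia.
have l1 : (#|B1| < n)%N by rewrite cB1; move: q1 lt a10 k00; clear; lia.
have l2 : (#|B2| < n)%N by rewrite cB2; move: q2 lt a20 k00; clear; lia.
have [s1 [h11 h12 h13 h14]] := IH B1 l1.
have [s2 [h21 h22 h23 h24]] := IH B2 l2.
exists (s1 ++ s2); split.
- by move=> B; rewrite mem_cat => /orP[/h11|/h21].
- move=> u uA; rewrite has_cat; pose u' : induced_graph A := Sub u uA.
  have : u' \in A1 :|: A2 by rewrite cov inE.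
  rewrite inE => /orP[/(imset_f val) uB|/(imset_f val) uB]; apply/orP; [left; exact: h12 uB|right; exact: h22 uB].
- move=> u v uA vA' uv; rewrite has_cat; pose u' : induced_graph A := Sub u uA; pose v' : induced_graph A := Sub v vA'.
  have uv' : adj u' v' by [].
  have /orP[/andP[/(imset_f val) uB /(imset_f val) vB]|/andP[/(imset_f val) uB /(imset_f val) vB]] := sep u' v' uv'.
    by apply/orP; left; apply: h13 uB vB uv.
  by apply/orP; right; apply: h23 uB vB uv.
rewrite big_cat /= natrD; apply: le_trans (lerD h14 h24) _.
rewrite cB1 cB2 /bnd a10 a20 k0A.
have g : phi #|A| <= rho * (phi #|A1| + phi #|A2|).
  by apply: gain => //; move: cs a10 a20 k00 big_A; clear; lia.
have cs' : #|A1|%:R + #|A2|%:R = #|A|%:R + #|A1 :&: A2|%:R :> R by rewrite -!natrD cs.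
have CE : Cst * (1 - rho) = 2%:R * c * rho by rewrite /Cst divfK // gt_eqF.
have p0 := phi0 #|A|.
move: g cs' ord; move: (phi #|A|) (phi #|A1|) (phi #|A2|) p0 => p p1 p2 p0 g.
move: (#|A1|%:R : R) (#|A2|%:R : R) (#|A|%:R : R) (#|A1 :&: A2|%:R : R) => a1 a2 a s cs' ord.
have k1 : (1 + eta) * s <= 2%:R * (c * p).
  apply: (le_trans (y := (1 + eta) * (c * p))); first by rewrite ler_pM2l // addr_gt0.
  by rewrite ler_wpM2r ?mulr_ge0 ?(ltW c0) //; move: e1; clear; lra.
(* [Cst (p1 + p2) >= Cst p / rho >= Cst p + 2 c p] *)
have k2 : Cst * p + 2%:R * (c * p) <= Cst * (p1 + p2).
  rewrite -(ler_pM2l r0); have := ler_wpM2l (ltW C0) g.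
  have -> : rho * (Cst * p + 2%:R * (c * p)) = rho * Cst * p + (2%:R * c * rho) * p by ring.
  rewrite -CE => h; have -> : rho * Cst * p + Cst * (1 - rho) * p = Cst * p by ring.
  by have -> : rho * (Cst * (p1 + p2)) = Cst * (rho * (p1 + p2)) by ring.
have -> : a1 + (eta * a1 - Cst * p1) + (a2 + (eta * a2 - Cst * p2)) =
  (1 + eta) * (a1 + a2) - Cst * (p1 + p2) by ring.
rewrite cs'; have -> : (1 + eta) * (a + s) = (1 + eta) * a + (1 + eta) * s by ring.
lra.
Qed.

Lemma sublinear_covering (R : realType) (F : sgraph -> Prop) (eta : R) :
  strongly_sublinear_separators R F -> 0 < eta -> eta <= 1 ->
  exists k : nat, forall H, F H -> exists (J : finType) (V : J -> {set H}),
    [/\ covering V, forall j, (0 < #|V j| <= k)%N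
      & (\sum_j #|V j|)%N%:R <= (1 + eta) * (num_vertices H)%:R].
Proof.
move=> hF e0 e1; have [k Hk] := sublinear_pieces hF e0 e1.
exists k => H /Hk[ss [h1 h2 h3 h4]].
exists 'I_(size ss), (fun i : 'I_(size ss) => nth set0 ss i); split.
- split=> [u|u v uv].
    have /(has_nthP set0)[i ir ui] := h2 u; by exists (Ordinal ir).
  have /(has_nthP set0)[i ir ui] := h3 u v uv; by exists (Ordinal ir).
- by move=> i; apply: h1; apply: mem_nth.
by move: h4; rewrite (big_nth set0) big_mkord.
Qed.

(** * Sparsity of the family *)

Lemma arcs_covering (H : sgraph) (J : finType) (V : J -> {set H}) :
  covering V -> (arcs [set: H] <= \sum_j arcs (V j))%N.
Proof.
move=> [_ cov]; rewrite /arcs.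
under [leqRHS]eq_bigr do rewrite big_mkcond /=.
rewrite exchange_big /= [leqLHS]big_mkcond /=; apply: leq_sum => x _; rewrite inE.
rewrite -big_mkcond /=; apply: leq_trans (_ : #|\bigcup_(j | x \in V j) nbhd (V j) x| <= _)%N.
  apply: subset_leq_card; apply/subsetP=> y; rewrite !inE /= => xy.
  have [j /andP[xj yj]] := cov x y xy; apply/bigcupP; exists j => //; by rewrite inE yj.
apply: (big_ind2 (fun (A : {set H}) n => #|A| <= n)%N); rewrite ?cards0 //.
by move=> A n B m An Bm; apply: leq_trans (leq_card_setU _ _) (leq_add An Bm).
Qed.

(** With eta = 1 the graph is covered by pieces of at most [k] vertices and total size 2n, and a
    piece has fewer than [k] arcs per vertex. *)
Lemma sublinear_sparse (R : realType) (F : sgraph -> Prop) :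
  strongly_sublinear_separators R F ->
  exists C0 : nat, forall H, F H -> (arcs [set: H] <= 2 * C0 * num_vertices H)%N.
Proof.
move=> hF; have [k Hk] := sublinear_covering hF ltr01 (lexx 1).
exists k => H /Hk[J [V [cov Vk tot]]].
apply: leq_trans (arcs_covering cov) _; apply: leq_trans (_ : \sum_j k * #|V j| <= _)%N.
  apply: leq_sum => j _; apply: leq_trans (arcs_leq _) _; rewrite mulnC leq_mul2r.
  by apply/orP; right; apply: leq_trans (leq_pred _) _; case/andP: (Vk j).
rewrite -big_distrr /= mulnAC mulnC leq_mul2r; apply/orP; right.
by move: tot; rewrite -[1 + 1]/(2%:R) -natrM ler_nat.
Qed.

Local Open Scope nat_scope.

(** * A reserved set of vertices for short connections *)

Lemma robust_short_links (G : sgraph) (K D b : nat) :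
  (0 < b)%N -> (num_vertices G <= K * D)%N -> (D <= K * b)%N -> (2 * b <= D)%N ->
  (forall x : G, (D <= #|nbhd setT x|)%N) ->
  (forall U : {set G}, (#|U| <= b)%N -> connected_in (~: U)) ->
  forall (U : {set G}) x y, (#|U| <= b)%N -> x != y ->
    exists I : {set G}, [/\ [disjoint I & U], (#|I| <= 3 * K * K)%N & links I x y].
Proof.
move=> b0 nK DK bD deg con U x y Ub nxy.
pose U' := U :\: [set x; y].
have U'b : (#|U'| <= b)%N by apply: leq_trans Ub; apply: subset_leq_card; apply: subsetDl.
have xW : x \in ~: U' by rewrite !inE eqxx.
have yW : y \in ~: U' by rewrite !inE eqxx orbT.
have mindeg z : z \in ~: U' -> (b <= #|nbhd (~: U') z|)%N.
  move=> _; have : nbhd setT z \subset nbhd (~: U') z :|: U'.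
    by apply/subsetP=> t; rewrite !inE /= => ->; rewrite andbT; case: (_ && _).
  move/subset_leq_card/leq_trans/(_ (leq_card_setU _ _)); have := deg z.
  by move: #|nbhd setT z| #|nbhd _ z| #|U'| U'b bD; clear; lia.
have [I [IW xI yI cI lk]] := short_link (con _ U'b) xW yW nxy mindeg.
exists I; split=> //.
  apply/pred0P=> z /=; apply/negP=> /andP[zI zU]; have := subsetP IW z zI.
  rewrite !inE zU andbT negbK => /orP[] /eqP Ez; first by rewrite -Ez zI in xI.
  by rewrite -Ez zI in yI.
rewrite -(leq_pmul2r b0); apply: leq_trans cI _.
have cW : (#|~: U'| <= num_vertices G)%N by apply: max_card.
rewrite -!mulnA leq_mul2l /=; apply: leq_trans cW _; apply: leq_trans nK _.
by rewrite leq_mul2l DK orbT.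
Qed.

(** For each pair of vertices there are b / l disjoint short links, chosen greedily, and the random
    [Z] contains many of them. A set with fewer than n / tau vertices in [Z] cannot hit all of
    these. *)
Lemma reserve_links (G : sgraph) (K D b q : nat) :
  let l := (3 * K * K)%N in
  let tau := (8 * K * K * l * q.+1 ^ l)%N in
  (0 < K)%N -> (l <= b)%N -> (num_vertices G <= K * D)%N -> (D <= K * b)%N -> (2 * b <= D)%N ->
  (forall x : G, (D <= #|nbhd setT x|)%N) ->
  (forall U : {set G}, (#|U| <= b)%N -> connected_in (~: U)) ->
  (2 * (num_vertices G * num_vertices G) < 2 ^ (num_vertices G %/ tau))%N ->
  exists Z : {set G}, (q.+1 * #|Z| <= 2 * num_vertices G)%N /\
    forall (U : {set G}) x y, (#|U :&: Z| < num_vertices G %/ tau)%N -> x != y ->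
      exists I : {set G}, [/\ I \subset Z, [disjoint I & U], (#|I| <= l)%N & links I x y].
Proof.
move=> l tau K0 lb nK DK bD deg con big_n; set n := num_vertices G in nK big_n *.
have l0 : (0 < l)%N by rewrite /l !muln_gt0 K0.
have b0 : (0 < b)%N by apply: leq_trans lb.
have n0 : (0 < #|G|)%N.
  have [] := con set0; first by rewrite cards0.
  by move=> /set0Pn[x _] _; apply/card_gt0P; exists x.
have avail := robust_short_links b0 nK DK bD deg con.
pose M := (b %/ l)%N; pose t := (n %/ tau)%N.
pose Ix : finType := {p : G * G | p.1 != p.2}.
have fam (s : Ix) : exists A : 'I_M -> {set G}, [/\ forall i, (#|A i| <= l)%N,
    forall i, links (A i) (val s).1 (val s).2 & forall i j, i != j -> [disjoint A i & A j]].
  have [|i U Ub|j|A [_ _ h1 h2 h3]] := @greedy_links G 'I_M unit (fun=> tt) (fun=> setT)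
      (fun=> (val s).1) (fun=> (val s).2) set0 b l.
  - by case; case.
  - rewrite setIT in Ub; have [I [h1 h2 h3]] := avail U _ _ Ub (valP s).
    by exists I; rewrite subsetT.
  - rewrite set0I cards0 add0n; apply: leq_trans (_ : l * M <= _)%N.
      by rewrite leq_mul2l; apply/orP; right; apply: leq_trans (max_card _) _; rewrite card_ord.
    by rewrite /M mulnC leq_trunc_div.
  by exists A.
pose A s := projT1 (cid (fam s)).
have AP s : [/\ forall i, (#|A s i| <= l)%N,
    forall i, links (A s i) (val s).1 (val s).2 & forall i j, i != j -> [disjoint A s i & A s j]].
  by rewrite /A; case: cid.
(* [tau] is made for this: n <= K K b, so t = n / tau is at most b / (8 l (q+1)^l). *)
have tM : (4 * q.+1 ^ l * t <= M)%N.
  rewrite /M leq_divRL //.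
  have h : (t * tau <= K * (K * b))%N.
    apply: leq_trans (leq_trunc_div _ _) _; apply: leq_trans nK _; by rewrite leq_mul2l DK orbT.
  have KK : (0 < K * K)%N by rewrite muln_gt0 K0.
  rewrite -(leq_pmul2l KK); apply: leq_trans (_ : t * tau <= _)%N; last by rewrite -mulnA.
  have -> : (t * tau = 2 * (K * K * (4 * q.+1 ^ l * t * l)))%N.
    by rewrite /tau; move: (q.+1 ^ l)%N => X; ring.
  by rewrite leq_pmull.
have It : (2 * #|Ix| < 2 ^ t)%N.
  apply: leq_ltn_trans big_n; rewrite leq_mul2l /=.
  by apply: leq_trans (_ : #|{: G * G}| <= _)%N; [rewrite card_sig; apply: max_card|rewrite card_prod].
have h1 s i : (#|A s i| <= l)%N by case: (AP s).
have h3 s i j : i != j -> [disjoint A s i & A s j] by case: (AP s) => _ _; apply.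
have [Z [cZ HZ]] := reserve_set h1 h3 tM It n0.
exists Z; split=> // U x y Ut nxy.
pose s : Ix := Sub (x, y) (nxy : (x, y).1 != (x, y).2).
have [/existsP[i /andP[iZ iU]]|/existsPn no] := boolP [exists i, (A s i \subset Z) && [disjoint A s i & U]].
  by exists (A s i); split=> //; case: (AP s).
exfalso; move: Ut; apply/negP; rewrite -leqNgt; apply: leq_trans (HZ s) _.
have wit (i : 'I_M) : A s i \subset Z -> exists z, z \in A s i :&: (U :&: Z).
  move=> iZ; have := no i; rewrite iZ /= -setI_eq0 => /set0Pn[z]; rewrite inE => /andP[zA zU].
  by exists z; rewrite !inE zA zU (subsetP iZ).
pose g (i : 'I_M) := [pick z in A s i :&: (U :&: Z)].
have gP (i : 'I_M) : A s i \subset Z -> exists2 z, g i = Some z & z \in A s i :&: (U :&: Z).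
  move=> iZ; rewrite /g; case: pickP => [z zP|none]; first by exists z.
  by have [z zP] := wit i iZ; have := none z; rewrite zP.
have g_in : {in [set i | A s i \subset Z] &, injective g}.
  move=> i j; rewrite !inE => /gP[z gi]; rewrite inE => /andP[zi _] /gP[z' gj].
  rewrite inE => /andP[zj _]; rewrite gi gj => -[Ez]; apply/eqP; apply/negPn/negP => nij.
  by have := disjointFr (h3 s _ _ nij) zi; rewrite Ez zj.
rewrite -(card_in_imset g_in) -(card_imset (U :&: Z) (@Some_inj _)); apply: subset_leq_card.
apply/subsetP=> _ /imsetP[i + ->]; rewrite inE => /gP[z -> ]; rewrite inE => /andP[_ zUZ].
exact: imset_f.
Qed.

Local Open Scope ring_scope.

(** * Cheap models inside few light cells *)

Definition label_adj (G : sgraph) (T : finType) (f : G -> T) (R0 : rel T) s (lab : 'I_s -> G) : rel 'I_s :=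
  fun i j => (i != j) && (R0 (f (lab i)) (f (lab j)) && R0 (f (lab j)) (f (lab i))).

(** The model lives on [s] indices and sees the vertices [lab i] only through their cells, so it can
    later be re-embedded on other vertices of these cells. *)
Definition label_model (H G : sgraph) (T : finType) (f : G -> T) (R0 : rel T) s
    (lab : 'I_s -> G) (mu : H -> {set 'I_s}) : Prop :=
  (forall u, rel_connected (label_adj f R0 lab) (mu u)) /\
  (forall u v, adj u v -> exists i j, [/\ i \in mu u, j \in mu v & label_adj f R0 lab i j]).

(** By Markov at most n / C vertices carry weight above C Y / n; dropping them loses at most 2 n^2 /
    C pairs, and [sampled_cost] applies to the rest. Lightness gives a bound on the cost of each
    single branch set, used where pieces overlap. *)
Lemma light_model (R : realType) (H G : sgraph) (T : finType) (f : G -> T) (R0 : rel T)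
    (B : {set G}) (c eps : R) (s C : nat) (y : T -> R) :
  (frac_extremal R H < c%:E)%E -> 0 < c -> 0 < eps -> (1 < s)%N -> (0 < C)%N ->
  (0 < num_vertices G)%N -> (forall x, 0 <= y x) ->
  let n : R := (num_vertices G)%:R in
  let Y := \sum_(v in B) y (f v) in
  (1 + eps) * (2%:R * c * n) + 2%:R * n ^+ 2 / C%:R <=
    \sum_(u in B) \sum_(v in B) (R0 (f u) (f v) && R0 (f v) (f u))%:R ->
  exists (lab : 'I_s -> G) (mu : H -> {set 'I_s}),
    [/\ forall i, lab i \in B, label_model f R0 lab mu,
        forall i, y (f (lab i)) * n <= C%:R * Y
      & s.-1%:R * (1 + eps) * (\sum_u \sum_(i in mu u) y (f (lab i))) <= s%:R * Y].
Proof.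
move=> cfc c0 e0 s1 C0 v0 y0 n Y dense.
have n0 : 0 < n by rewrite ltr0n.
have C0' : (0 : R) < C%:R by rewrite ltr0n.
pose S (u v : G) := R0 (f u) (f v) && R0 (f v) (f u).
pose B' := [set v in B | y (f v) * n <= C%:R * Y].
have B'B : B' \subset B by apply/subsetP=> v; rewrite inE => /andP[].
have Y0 : 0 <= Y by apply: sumr_ge0.
have heavy : #|B :\: B'|%:R * C%:R <= n.
  have [Yz|Yn] := eqVneq Y 0.
    rewrite (_ : B :\: B' = set0) ?cards0 ?mul0r ?ltW //.
    apply/setP=> v; rewrite !inE; case: (boolP (v \in B)) => vB; rewrite ?andbF ?andbT //=.
    rewrite Yz mulr0; apply/negbTE; rewrite negbK.
    have yv : y (f v) <= 0 by rewrite -Yz /Y (bigD1 v) //= lerDl sumr_ge0.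
    by rewrite pmulr_lle0.
  have Yp : 0 < Y by rewrite lt_neqAle eq_sym Yn.
  rewrite -(ler_pM2r Yp) -mulrA mulr_natl -sumr_const.
  apply: (le_trans (y := \sum_(v in B :\: B') y (f v) * n)).
    apply: ler_sum => v; rewrite !inE => /andP[+ vB]; rewrite vB /= -ltNge; exact: ltW.
  rewrite -mulr_suml mulrC ler_pM2l // /Y [leRHS](big_setID B') /= (setIidPr B'B) lerDr.
  exact: sumr_ge0.
have Sle u : \sum_(v in B) (S u v)%:R <= n.
  apply: (le_trans (y := \sum_(v in B) 1)).
    by apply: ler_sum => v _; case: (S u v).
  by rewrite sumr_const ler_nat; apply: max_card.
have Ssym u v : S u v = S v u by rewrite /S andbC.
pose E' : R := \sum_(u in B') \sum_(v in B') (S u v)%:R.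
have removed : \sum_(u in B) \sum_(v in B) (S u v)%:R <= E' + 2%:R * (#|B :\: B'|%:R * n).
  have rem1 (A : {set G}) : A \subset B -> \sum_(u in A) \sum_(v in B :\: B') (S u v)%:R <= #|B :\: B'|%:R * n.
    move=> AB; rewrite exchange_big /= mulr_natl -sumr_const; apply: ler_sum => v _.
    apply: le_trans (Sle v); under eq_bigr do rewrite Ssym.
    by rewrite [leRHS](big_setID A) /= (setIidPr AB) lerDl sumr_ge0.
  rewrite (big_setID B') /= (setIidPr B'B).
  have -> : \sum_(u in B') \sum_(v in B) (S u v)%:R =
      E' + \sum_(u in B') \sum_(v in B :\: B') (S u v)%:R.
    rewrite -big_split /=; apply: eq_bigr => u _; by rewrite (big_setID B') /= (setIidPr B'B).
  have h1 := rem1 B' B'B.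
  have h2 : \sum_(u in B :\: B') \sum_(v in B) (S u v)%:R <= #|B :\: B'|%:R * n.
    by rewrite mulr_natl -sumr_const; apply: ler_sum => u _; apply: Sle.
  move: h1 h2; move: (\sum_(u in B') _) (\sum_(u in B :\: B') _) (_ * n) => p1 p2 p3; lra.
have E'big : (1 + eps) * (2%:R * c * n) <= E'.
  have h : 2%:R * (#|B :\: B'|%:R * n) <= 2%:R * n ^+ 2 / C%:R.
    rewrite -mulrA ler_pM2l // ler_pdivlMr // mulrAC expr2 ler_pM2r //.
  move: dense removed h; move: (\sum_(u in B) _) (_ / C%:R) (2%:R * (_ * n)) => p1 p2 p3; lra.
have E'0 : 0 < E' by apply: lt_le_trans E'big; rewrite !mulr_gt0 // addr_gt0.
pose V' : finType := {v : G | v \in B'}.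
have sumV (F : G -> R) : \sum_(v : V') F (val v) = \sum_(v in B') F v.
  rewrite [RHS](reindex_omap (val : V' -> G) insub) /=; last by move=> v vB; rewrite insubT.
  by apply: eq_bigl => v; rewrite (valP v) valK eqxx.
pose S' : rel V' := fun u v => R0 (f (val u)) (f (val v)).
have E'V : \sum_(a : V') \sum_(b : V') (S' a b && S' b a)%:R = E'.
  rewrite /E' -(sumV (fun u => \sum_(v in B') (S u v)%:R)); apply: eq_bigr => u _.
  by rewrite -(sumV (fun v => (S (val u) v)%:R)).
have V'0 : (0 < #|V'|)%N.
  rewrite lt0n; apply/eqP => V0; move: E'0; rewrite -E'V big1 ?ltxx // => v.
  by have := card0_eq V0 v; rewrite inE.
have [||w [mu [[mucon muadj] Hcost]]] := @sampled_cost R H V' S' c s (fun v => y (f (val v))) cfc s1 V'0.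
- by move=> v; apply: y0.
- by rewrite E'V.
exists (fun i => val (w i)), mu; split.
- by move=> i; apply: (subsetP B'B); apply: valP.
- split=> [u|u v uv]; first exact: (mucon u).
  by have [i [j [iu jv ij]]] := muadj u v uv; exists i, j.
- by move=> i; have := valP (w i); rewrite inE => /andP[].
set cost := \sum_(u : H) _ in Hcost *.
have cost0 : 0 <= cost by apply: sumr_ge0 => u _; apply: sumr_ge0.
have s10 : (0 : R) <= s.-1%:R by apply: ler0n.
have Y'Y : \sum_(v : V') y (f (val v)) <= Y.
  by rewrite (sumV (fun v => y (f v))) /Y [leRHS](big_setID B') /= (setIidPr B'B) lerDl sumr_ge0.
have V'n : (#|V'|%:R : R) <= n by rewrite ler_nat card_sig; apply: max_card.
have k0 : 0 < 2%:R * c * n by rewrite !mulr_gt0.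
rewrite -(ler_pM2l k0).
apply: (le_trans (y := s.-1%:R * E' * cost)).
  have -> : 2%:R * c * n * (s.-1%:R * (1 + eps) * cost) = s.-1%:R * ((1 + eps) * (2%:R * c * n)) * cost by ring.
  by rewrite ler_wpM2r // ler_wpM2l.
rewrite E'V in Hcost; apply: le_trans Hcost _.
have -> : 2%:R * c * n * (s%:R * Y) = 2%:R * s%:R * c * n * Y by ring.
have k1 : 0 <= 2%:R * s%:R * c by rewrite !mulr_ge0 // ltW.
apply: ler_pM => //; [by rewrite mulr_ge0|by apply: sumr_ge0|by rewrite ler_wpM2l].
Qed.

Local Open Scope nat_scope.

(** * Assembling the pieces in the dense case *)

Lemma exp_dominates_square tau n :
  (0 < tau)%N -> (24 * tau * tau <= n)%N -> (2 * (n * n) < 2 ^ (n %/ tau))%N.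
Proof.
move=> t0 nt; set t := (n %/ tau)%N; pose r := (t %/ 4)%N.
have tt : (24 * tau <= t)%N by rewrite /t leq_divRL.
have rt : (6 * tau <= r)%N by rewrite /r leq_divRL //; lia.
have n_lt : (n < tau * t.+1)%N by rewrite mulnC; apply: ltn_ceil.
have t_lt : (t.+1 <= 4 * r.+1)%N by rewrite /r; lia.
have e1 : ((r.+1 * r.+1) * (r.+1 * r.+1) <= 2 ^ t)%N.
  apply: leq_trans (_ : 2 ^ (r * 4) <= _)%N; last by rewrite leq_exp2l // /r leq_trunc_div.
  rewrite expnM [X in (_ <= X)%N]expnS (expnS _ 2) (expnS _ 1) expn1 !mulnA.
  by rewrite !leq_mul // ltn_expl.
apply: leq_trans e1.
have nn : (n * n < (4 * tau * r.+1) * (4 * tau * r.+1))%N.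
  have h : (n < 4 * tau * r.+1)%N.
    by apply: leq_trans n_lt _; rewrite (mulnC 4) -mulnA leq_mul2l t_lt orbT.
  by apply: ltn_mul.
apply: leq_trans (_ : 2 * ((4 * tau * r.+1) * (4 * tau * r.+1)) <= _)%N.
  by rewrite ltn_mul2l /=.
have -> : (2 * (4 * tau * r.+1 * (4 * tau * r.+1)) = (32 * (tau * tau)) * (r.+1 * r.+1))%N by ring.
rewrite leq_mul2r; apply/orP; right.
apply: leq_trans (_ : (6 * tau) * (6 * tau) <= _)%N; first by move: (tau * tau)%N (mulnACA 6 tau 6 tau) => x ->; lia.
by apply: leq_mul; apply: leqW.
Qed.

Lemma embed_group (G : sgraph) (B : {set G}) (T : finType) (f : G -> T) (p w m : nat)
    (R0 : rel T) (X : finType) (lb : X -> T) (C : X -> {set G}) :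
  (1 < p)%N -> (0 < w)%N -> lower_regular B f p w R0 -> (#|X| <= m)%N ->
  (forall x, [/\ C x \subset cell B f (lb x), 2 * w <= #|cell B f (lb x)|
     & #|cell B f (lb x)| * (m * p ^ m) <= w * #|C x|]%N) ->
  exists g : X -> G, [/\ injective g, forall x, g x \in C x
    & forall x x', x != x' -> R0 (lb x) (lb x') -> R0 (lb x') (lb x) -> adj (g x) (g x')].
Proof.
move=> p1 w0 reg cX HC.
have [X0|Xpos] := posnP #|X|.
  have no (x : X) : False by have := card0_eq X0 x; rewrite inE.
  by exists (fun x => False_rect _ (no x)); split=> x; case: (no x).
have /card_gt0P[a _] := Xpos.
have C0 : exists y, y \in cell B f (lb a).
  by have [_ h _] := HC a; apply/card_gt0P; apply: leq_trans h; rewrite muln_gt0.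
have [y0 _] := C0.
pose items := [seq (lb x, C x) | x <- enum X].
have sz : size items = #|X| by rewrite size_map -cardE.
have [||ys [sys uys memys adjys]] := regular_embedding (m := m) y0 (lb a) p1 w0 reg (items := items).
- by rewrite sz.
- move=> _ /mapP[x _ ->] /=; have [h1 h2 h3] := HC x; split=> //.
  apply: leq_trans h3; rewrite leq_mul2l; apply/orP; right; rewrite leq_mul2l; apply/orP; right.
  by rewrite leq_exp2l // sz.
have ixP (x : X) : (index x (enum X) < size items)%N.
  by rewrite /items size_map index_mem mem_enum.
have nthI x : nth (lb a, set0) items (index x (enum X)) = (lb x, C x).
  rewrite (nth_map x); last by rewrite index_mem mem_enum.
  by rewrite nth_index ?mem_enum.
have idx_inj x x' : index x (enum X) = index x' (enum X) -> x = x'.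
  by move=> Ei; rewrite -(nth_index x (mem_enum X x)) Ei nth_index // mem_enum.
exists (fun x => nth y0 ys (index x (enum X))); split.
- move=> x x' /eqP; rewrite nth_uniq ?sys // => /eqP; exact: idx_inj.
- by move=> x; have := memys _ (ixP x); rewrite nthI.
move=> x x' nx h1 h2; have : index x (enum X) != index x' (enum X).
  by apply: contra nx => /eqP/idx_inj->.
rewrite neq_ltn => /orP[] lt; last rewrite adj_sym.
  by apply: adjys; rewrite // !nthI.
by apply: adjys; rewrite // !nthI.
Qed.

(** Only adjacencies within one group matter, so the groups are embedded one after another into what
    remains of the cells. [room] counts the items of all groups in a cell, so enough remains at
    every stage. *)
Lemma embed_groups (G : sgraph) (B : {set G}) (T : finType) (f : G -> T) (p w m : nat)
    (R0 : rel T) (X J : finType) (pc : X -> J) (lb : X -> T) :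
  (1 < p)%N -> (0 < w)%N -> lower_regular B f p w R0 ->
  (forall j, #|[set x | pc x == j]| <= m)%N ->
  (forall x, [/\ 2 * w <= #|cell B f (lb x)|
     & #|cell B f (lb x)| * (m * p ^ m) <=
       w * (#|cell B f (lb x)| - #|[set x' | lb x' == lb x]|)]%N) ->
  exists g : X -> G, [/\ injective g, forall x, g x \in cell B f (lb x)
    & forall x x', pc x = pc x' -> x != x' -> R0 (lb x) (lb x') -> R0 (lb x') (lb x) ->
        adj (g x) (g x')].
Proof.
move=> p1 w0 reg cX room.
suff [g [g1 g2 g3]] : exists g : X -> G,
    [/\ {in [set x | pc x \in enum J] &, injective g},
        forall x, pc x \in enum J -> g x \in cell B f (lb x)
      & forall x x', pc x \in enum J -> pc x = pc x' -> x != x' -> R0 (lb x) (lb x') ->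
          R0 (lb x') (lb x) -> adj (g x) (g x')].
  have inE' x : pc x \in enum J by rewrite mem_enum.
  exists g; split=> [x x' Eg|x|x x'].
  - by apply: g1 Eg; rewrite inE.
  - exact: g2.
  - exact: g3.
have ex_vertex (x : X) : exists y, y \in cell B f (lb x).
  by have [h _] := room x; apply/card_gt0P; apply: leq_trans h; rewrite muln_gt0.
elim: (enum J) (enum_uniq J) => [_|j l IH /= /andP[jl ul]].
  exists (fun x => xchoose (ex_vertex x)); split=> x //; by rewrite inE.
have [g [g1 g2 g3]] := IH ul.
pose Xj : finType := {x : X | pc x == j}.
pose used := g @: [set x | pc x \in l].
have [||g' [h1 h2 h3]] := @embed_group G B T f p w m R0 Xj (fun x => lb (val x))
    (fun x => cell B f (lb (val x)) :\: used) p1 w0 reg.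
- by rewrite card_sig; apply: leq_trans (cX j); apply: subset_leq_card; apply/subsetP=> x; rewrite !inE.
- move=> x; have [r1 r2] := room (val x); split=> //; first exact: subsetDl.
  apply: leq_trans r2 _; rewrite leq_mul2l; apply/orP; right; rewrite cardsD leq_sub2l //.
  apply: leq_trans (leq_imset_card g [set x' | lb x' == lb (val x)]).
  apply: subset_leq_card; apply/subsetP=> y; rewrite inE => /andP[yc /imsetP[x' x'l Ey]].
  apply/imsetP; exists x' => //; rewrite inE; rewrite inE in x'l.
  have := g2 _ x'l; rewrite -Ey inE => /andP[_ /eqP <-].
  by move: yc; rewrite inE => /andP[].
exists (fun x => if insub x is Some x' then g' (x' : Xj) else g x).
have new x (xj : pc x == j) : insub x = Some (Sub x xj : Xj) by rewrite insubT.
have old x : pc x \in l -> insub x = None :> option Xj.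
  by move=> xl; rewrite insubF //; apply: contraNF jl => /eqP <-.
have used_g x : pc x \in l -> g x \in used by move=> xl; apply: imset_f; rewrite inE.
have fresh x : g' x \notin used by have := h2 x; rewrite inE => /andP[].
split.
- move=> x x'; rewrite !inE => /orP[xj|xl] /orP[x'j|x'l].
  + by rewrite !new => /h1/(congr1 val).
  + by rewrite new old // => Eg; have := used_g x' x'l; rewrite -Eg (negPf (fresh _)).
  + by rewrite old // new => Eg; have := used_g x xl; rewrite Eg (negPf (fresh _)).
  by rewrite !old // => Eg; apply: g1 Eg; rewrite inE.
- move=> x; rewrite inE => /orP[xj|xl]; last by rewrite old //; apply: g2.
  by rewrite new; have := h2 (Sub x xj); rewrite inE => /andP[].
move=> x x'; rewrite inE => /orP[xj|xl] Epc nx r1 r2.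
  have x'j : pc x' == j by rewrite -Epc.
  by rewrite !new; apply: h3 => //; apply: contra nx => /eqP/(congr1 val)/= ->.
have x'l : pc x' \in l by rewrite -Epc.
by rewrite !old //; apply: g3.
Qed.

Lemma area_full (G : sgraph) (B : {set G}) (S : rel G) :
  area B S = (\sum_u \sum_v ([&& u \in B, v \in B & S u v] : nat))%N.
Proof.
rewrite areaE big_mkcond; apply: eq_bigr => u _; case: (u \in B) => /=; last by rewrite big1.
by rewrite big_mkcond; apply: eq_bigr => v _; case: (v \in B).
Qed.

Lemma area_regular (G : sgraph) (T : finType) (f : G -> T) (R0 : rel T) (B B1 : {set G}) :
  B1 \subset B ->
  (arcs [set: G] <= area B1 (fun u v => R0 (f u) (f v) && R0 (f v) (f u)) +
     2 * (num_vertices G * #|~: B1|) + 2 * area B (fun u v => ~~ R0 (f u) (f v) && adj u v))%N.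
Proof.
move=> B1B; have arcsE : arcs [set: G] = (\sum_(u : G) \sum_(v : G) (adj u v : nat))%N.
  rewrite /arcs; apply: eq_big => [u|u _]; first by rewrite inE.
  by rewrite -sum1_card big_mkcond; apply: eq_bigr => v _; rewrite !inE; case: (adj u v).
have outE : (\sum_(u : G) \sum_(v : G) (u \notin B1 : nat) = num_vertices G * #|~: B1|)%N.
  rewrite (eq_bigr (fun u => num_vertices G * (u \notin B1))%N); last by move=> u _; rewrite sum_nat_const.
  rewrite -big_distrr /= -sum1_card [in RHS]big_mkcond; congr (_ * _)%N; apply: eq_bigr => u _.
  by rewrite inE; case: (u \in B1).
have outE' : (\sum_(u : G) \sum_(v : G) (v \notin B1 : nat) = num_vertices G * #|~: B1|)%N.
  by rewrite exchange_big outE.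
pose S u v := ~~ R0 (f u) (f v) && adj u v.
have irrE' : area B S = (\sum_u \sum_v ([&& v \in B, u \in B & S v u] : nat))%N.
  by rewrite area_full exchange_big.
pose RR u v := R0 (f u) (f v) && R0 (f v) (f u).
have key : (\sum_(u : G) \sum_(v : G) (adj u v : nat) <=
    \sum_u \sum_v ([&& u \in B1, v \in B1 & RR u v] : nat) +
    (\sum_(u : G) \sum_(v : G) (u \notin B1 : nat) + \sum_(u : G) \sum_(v : G) (v \notin B1 : nat)) +
    (\sum_u \sum_v ([&& u \in B, v \in B & S u v] : nat) +
     \sum_u \sum_v ([&& v \in B, u \in B & S v u] : nat)))%N.
  rewrite -!big_split /=; apply: leq_sum => u _; rewrite -!big_split /=; apply: leq_sum => v _.
  rewrite /S /RR (adj_sym v u).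
  case: (boolP (u \in B1)) => [uB1|_]; last by case: (adj u v); lia.
  case: (boolP (v \in B1)) => [vB1|_]; last by case: (adj u v); lia.
  rewrite (subsetP B1B u uB1) (subsetP B1B v vB1) /=.
  by case: (adj u v); case: (R0 (f u) (f v)); case: (R0 (f v) (f u)).
by rewrite outE outE' -irrE' -(area_full B S) -(area_full B1 RR) !addnn -!mul2n -arcsE in key.
Qed.

Local Open Scope ring_scope.

(** * Balancing the models of the pieces over the cells *)

Lemma sum_by_label (R : realType) (I T : finType) (A : {set I}) (g : I -> T) (y : T -> R) :
  \sum_x y x * #|[set i in A | g i == x]|%:R = \sum_(i in A) y (g i).
Proof.
rewrite [RHS](partition_big g xpredT) //=; apply: eq_bigr => x _.
rewrite (eq_bigr (fun=> y x)); last by move=> i /andP[_ /eqP->].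
by rewrite sumr_const mulr_natr; congr (_ *+ _); apply: eq_card => i; rewrite !inE.
Qed.

(** A vertex in several pieces is charged once per piece; every charge beyond the first is at most
    [a], and there are as many of them as the total size of the pieces exceeds |H|. *)
Lemma sum_covering (R : realType) (H J : finType) (V : J -> {set H}) (F : H -> R) (a : R) :
  (forall u, exists j, u \in V j) -> (forall u, F u <= a) ->
  \sum_j \sum_(u in V j) F u + #|H|%:R * a <= \sum_u F u + (\sum_j #|V j|)%N%:R * a.
Proof.
move=> cov Fa; pose mult u := #|[set j | u \in V j]|.
have Em : (\sum_j #|V j| = \sum_u mult u)%N.
  under eq_bigr => j _ do rewrite -sum1_card big_mkcond /=.
  rewrite exchange_big /=; apply: eq_bigr => u _; rewrite -big_mkcond sum1_card.
  by apply: eq_card => j; rewrite !inE.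
have -> : \sum_j \sum_(u in V j) F u = \sum_u (mult u)%:R * F u.
  under eq_bigr => j _ do rewrite big_mkcond /=.
  rewrite exchange_big /=; apply: eq_bigr => u _; rewrite -big_mkcond sumr_const mulr_natl.
  by congr (_ *+ _); apply: eq_card => j; rewrite !inE.
rewrite Em natr_sum mulr_suml -[#|H|%:R * a](_ : \sum_(u : H) a = _); last by rewrite sumr_const mulr_natl.
rewrite -!big_split /=; apply: ler_sum => u _.
have m1 : (1 : R) <= (mult u)%:R.
  by have [j uj] := cov u; rewrite (ler_nat _ 1); apply/card_gt0P; exists j; rewrite inE.
have := Fa u; move: ((mult u)%:R : R) m1 => x x1; nra.
Qed.

(** A move of the approachability game is a single model used for all pieces at once, and the
    environment's weights are answered by [light]. The resulting average over moves is then rounded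
    to one move per piece. *)
Lemma choose_models (R : realType) (H G : sgraph) (T : finType) (f : G -> T) (R0 : rel T)
    (B : {set G}) (J : finType) (V : J -> {set H}) (r Q k E Tb : nat) :
  let n := num_vertices G in
  (1 < r)%N -> (0 < Q)%N -> (0 < n)%N -> (0 < Tb)%N -> (#|T| <= Tb)%N ->
  (8 * r * r.+1 * Q <= E)%N ->
  (forall x, cell B f x != set0 -> (n <= #|cell B f x| * (Q * Tb))%N) ->
  (forall j, (#|V j| <= k)%N) -> (forall u, exists j, u \in V j) -> (#|H| <= 4 * n)%N ->
  (E * \sum_j #|V j| <= E.+1 * #|H|)%N ->
  (#|J| * (Tb * (k * r.+1) ^ 2) * (8 * r * Q * Tb) ^ 2 <= n ^ 2)%N ->
  (forall y : T -> R, (forall x, 0 <= y x) ->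
     exists (lab : 'I_r.+1 -> G) (mu : H -> {set 'I_r.+1}),
     [/\ forall i, lab i \in B, label_model f R0 lab mu,
        forall i, y (f (lab i)) * n%:R <= Q%:R * \sum_(v in B) y (f v)
      & (r%:R + 4%:R) * (\sum_u \sum_(i in mu u) y (f (lab i))) <= r.+1%:R * \sum_(v in B) y (f v)]) ->
  exists (lab : J -> 'I_r.+1 -> G) (mu : J -> H -> {set 'I_r.+1}),
    [/\ forall j i, lab j i \in B, forall j, label_model f R0 (lab j) (mu j)
      & forall x, (4 * r * \sum_j \sum_(u in V j) #|[set i in mu j u | f (lab j i) == x]|
           <= (4 * r).-1 * #|cell B f x|)%N].
Proof.
move=> n r1 Q0 n0 Tb0 TTb EQ big_cell Vk cov Hn VE rnd light.
pose s := r.+1; pose nR : R := n%:R; have nR0 : 0 < nR by rewrite ltr0n.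
pose rR : R := r%:R; have rR2 : 2%:R <= rR by rewrite ler_nat.
have rR0 : 0 < rR by apply: lt_le_trans rR2.
pose M := {p : ('I_s -> G) * (H -> {set 'I_s}) | (forall i, p.1 i \in B) /\ label_model f R0 p.1 p.2}.
pose cnt (m : M) u x : nat := #|[set i in (sval m).2 u | f ((sval m).1 i) == x]|.
pose ld j (m : M) x : R := (\sum_(u in V j) cnt m u x)%N%:R.
pose load m x : R := \sum_j ld j m x.
(* The target load [b] leaves a share dl of each cell free. A cheap model costs at most (1 - 2 dl)
   Y, and the difference dl Y pays for the overlaps. Half of dl then pays for two errors [xi], one
   from the game and one from rounding, since nonempty cells have at least n / (Q Tb) vertices. *)
pose dl : R := (2%:R * rR)^-1.
have rdl : rR * dl = 2%:R^-1 by rewrite /dl; field; rewrite gt_eqF.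
have dl0 : 0 < dl by rewrite invr_gt0 mulr_gt0.
pose b x : R := (1 - dl) * #|cell B f x|%:R.
pose xi : R := nR / (8 * r * Q * Tb)%N%:R.
have D0 : (0 : R) < (8 * r * Q * Tb)%N%:R by rewrite ltr0n !muln_gt0 Q0 Tb0 (ltnW r1).
have xi0 : 0 < xi by rewrite divr_gt0.
pose S := (\sum_j #|V j|)%N.
have cnt_s m u x : (cnt m u x <= s)%N by apply: leq_trans (max_card _) _; rewrite card_ord.
have ld0 j m x : 0 <= ld j m x <= (k * s)%N%:R.
  rewrite ler0n ler_nat; apply: leq_trans (_ : \sum_(u in V j) s <= _)%N.
    by apply: leq_sum.
  by rewrite sum_nat_const leq_mul2r Vk orbT.
have bounded m x : `|load m x - b x| <= (#|J| * (k * s))%N%:R + nR.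
  have l0 : 0 <= load m x by apply: sumr_ge0 => j _; case/andP: (ld0 j m x).
  have l1 : load m x <= (#|J| * (k * s))%N%:R.
    apply: (le_trans (y := \sum_(j : J) (k * s)%N%:R)).
      by apply: ler_sum => j _; case/andP: (ld0 j m x).
    by rewrite sumr_const -[leLHS]mulr_natl -natrM.
  have c1 : #|cell B f x|%:R <= nR by rewrite ler_nat; apply: max_card.
  have c0 : (0 : R) <= #|cell B f x|%:R by apply: ler0n.
  have dl1 : dl <= 1 by rewrite /dl invf_le1 ?mulr_gt0 //; lra.
  have b0 : 0 <= b x by rewrite mulr_ge0 // subr_ge0.
  have b1 : b x <= nR.
    by apply: le_trans c1; rewrite -[leRHS]mul1r ler_wpM2r // lerBlDr lerDl ltW.
  by rewrite ler_norml; move: l0 l1 b0 b1; lra.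
have cnt_cost (m : M) u (y : T -> R) :
    \sum_x y x * (cnt m u x)%:R = \sum_(i in (sval m).2 u) y (f ((sval m).1 i)).
  exact: (sum_by_label ((sval m).2 u) (fun i => f ((sval m).1 i)) y).
have play (y : T -> R) : (forall x, 0 <= y x) -> exists m, \sum_x y x * (load m x - b x) <= 0.
  move=> y0; have [lab [mu [labB lm lt cost]]] := light y y0.
  pose m : M := exist _ (lab, mu) (conj labB lm); exists m.
  set Y := \sum_(v in B) y (f v) in lt cost.
  have Y0 : 0 <= Y by apply: sumr_ge0.
  pose F u := \sum_(i in mu u) y (f (lab i)).
  have Eload : \sum_x y x * load m x = \sum_j \sum_(u in V j) F u.
    under eq_bigr do rewrite mulr_sumr.
    rewrite exchange_big /=; apply: eq_bigr => j _.
    under eq_bigr do rewrite /ld natr_sum mulr_sumr.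
    by rewrite exchange_big /=; apply: eq_bigr => u _; exact: (cnt_cost m u y).
  have Eb : \sum_x y x * b x = (1 - dl) * Y.
    rewrite /Y -(sum_by_label B f y) mulr_sumr; apply: eq_bigr => x _; by rewrite mulrCA.
  under eq_bigr do rewrite mulrBr.
  rewrite big_split /= sumrN Eload Eb subr_le0.
  pose a : R := s%:R * (Q%:R * Y / nR).
  have Fa u : F u <= a.
    apply: (le_trans (y := \sum_(i in mu u) Q%:R * Y / nR)).
      by apply: ler_sum => i _; rewrite ler_pdivlMr.
    rewrite sumr_const -[leLHS]mulr_natl; apply: ler_wpM2r.
      by rewrite divr_ge0 ?mulr_ge0 ?ler0n // ltW.
    by rewrite ler_nat; apply: leq_trans (max_card _) _; rewrite card_ord.
  have a0 : 0 <= a by rewrite !mulr_ge0 ?ler0n // invr_ge0 ltW.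
  have main := sum_covering cov Fa.
  (* The overlap is at most 4n / E, and E >= 8 r (r + 1) Q is chosen so that its cost stays below dl
     Y. *)
  have ex : S%:R * a <= #|H|%:R * a + dl * Y.
    have h1 : (E * S <= E * #|H| + 4 * n)%N by apply: leq_trans VE _; rewrite mulSn addnC leq_add2l.
    have h2 : E%:R * S%:R <= E%:R * #|H|%:R + 4%:R * nR by rewrite -!natrM -natrD ler_nat.
    have E0 : (0 : R) < E%:R by rewrite ltr0n; apply: leq_trans EQ; rewrite !muln_gt0 Q0 (ltnW r1).
    rewrite -(ler_pM2l E0).
    have h3 : E%:R * (S%:R * a) <= (E%:R * #|H|%:R + 4%:R * nR) * a.
      have -> : E%:R * (S%:R * a) = (E%:R * S%:R) * a by ring.
      exact: ler_wpM2r.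
    apply: le_trans h3 _.
    have -> : E%:R * (#|H|%:R * a + dl * Y) = E%:R * #|H|%:R * a + E%:R * (dl * Y) by ring.
    rewrite mulrDl lerD2l.
    have -> : 4%:R * nR * a = (8 * r * s * Q)%N%:R * (dl * Y).
      rewrite /a /dl !natrM -/rR; field; by rewrite !gt_eqF.
    by apply: ler_wpM2r; [rewrite mulr_ge0 // ltW|rewrite ler_nat].
  have cost' : \sum_u F u <= (1 - 2%:R * dl) * Y.
    have r4 : 0 < rR + 4%:R by rewrite addr_gt0.
    rewrite -(ler_pM2l r4); apply: le_trans cost _; rewrite mulrA ler_wpM2r //.
    rewrite -natr1 -/rR; have : (rR + 4%:R) * (1 - 2%:R * dl) = rR + 4%:R - 1 - 8%:R * dl.
      have -> : (rR + 4%:R) * (1 - 2%:R * dl) = rR + 4%:R - 2%:R * (rR * dl) - 8%:R * dl by ring.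
      by rewrite rdl; field.
    have dl4 : 4%:R * dl <= 1 by rewrite -(ler_pM2l rR0) mulr1 mulrCA rdl; move: rR2; lra.
    by move=> ->; move: dl4; lra.
  by move: main ex cost'; rewrite -/S; move: (\sum_j _) (\sum_u _) (S%:R * a) (#|H|%:R * a) => x1 x2 x3 x4; rewrite !mulrBl !mul1r -mulrA; move: (dl * Y) => x5; lra.
have [[|m0 ms'] [// _ avg]] := approachability bounded play xi0.
set ms := m0 :: ms' in avg; pose T' := size ms'.
have [|||c Hc] := @round_choices R J T T' (fun j i x => ld j (nth m0 ms i) x) (k * s)%N%:R xi.
- by move=> j i x; apply: ld0.
- exact: ltW.
- rewrite /xi expr_div_n ler_pdivlMr ?exprn_gt0 // -!natrX -!natrM ler_nat.
  apply: leq_trans rnd; rewrite leq_mul2r; apply/orP; right; rewrite leq_mul2l; apply/orP; right.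
  by rewrite leq_mul2r TTb orbT.
exists (fun j => (sval (nth m0 ms (c j))).1), (fun j => (sval (nth m0 ms (c j))).2); split.
- by move=> j i; case: (svalP (nth m0 ms (c j))).
- by move=> j; case: (svalP (nth m0 ms (c j))).
move=> x; set tot := (\sum_j _)%N.
(* The bound on [xi] needs a nonempty cell; an empty one carries no load because all labels lie in
   [B]. *)
have [/eqP ce|cne] := boolP (cell B f x == set0).
  rewrite [tot](_ : _ = 0%N) ?muln0 // /tot big1 // => j _; rewrite big1 // => u _.
  apply/eqP; rewrite cards_eq0; apply/eqP/setP=> i; rewrite !inE; apply/negbTE; apply/negP=> /andP[_ fi].
  have [labB _] := svalP (nth m0 ms (c j)).
  have : (sval (nth m0 ms (c j))).1 i \in cell B f x by rewrite inE labB.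
  by rewrite ce inE.
have Etot : tot%:R = \sum_j ld j (nth m0 ms (c j)) x by rewrite /tot natr_sum.
have T0 : (0 : R) < T'.+1%:R by rewrite ltr0n.
have avg' : (\sum_j \sum_(i < T'.+1) ld j (nth m0 ms i) x) / T'.+1%:R <= b x + xi.
  rewrite ler_pdivrMr // mulrC; apply: le_trans (avg x).
  by rewrite exchange_big /= (big_nth m0) big_mkord.
have le1 : tot%:R <= b x + 2%:R * xi.
  have -> : b x + 2%:R * xi = b x + xi + xi by ring.
  by rewrite Etot; apply: le_trans (Hc x) _; rewrite lerD2r.
have xi_le : 4%:R * (2%:R * xi) <= 2%:R * dl * #|cell B f x|%:R.
  have : nR <= #|cell B f x|%:R * (Q * Tb)%N%:R by rewrite -natrM ler_nat; exact: big_cell.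
  have qt : (0 : R) < (Q * Tb)%N%:R by rewrite ltr0n muln_gt0 Q0.
  have -> : xi = nR / (Q * Tb)%N%:R * (dl / 4%:R).
    have QR : (0 : R) < Q%:R by rewrite ltr0n.
    have TR : (0 : R) < Tb%:R by rewrite ltr0n.
    rewrite /xi /dl !natrM -/rR; field.
    by rewrite !gt_eqF.
  rewrite -ler_pdivrMr // => h.
  have := ler_wpM2r (ltW dl0) h; move: (nR / _) (#|_|%:R) => p1 p2; lra.
have fin : 4%:R * rR * tot%:R <= (4%:R * rR - 1) * #|cell B f x|%:R.
  have e1 : 4%:R * rR * tot%:R <= rR * (4%:R * b x + 2%:R * dl * #|cell B f x|%:R).
    by rewrite -mulrA (mulrCA 4%:R) ler_pM2l //; move: le1 xi_le; lra.
  apply: le_trans e1 _; rewrite /b le_eqVlt; apply/orP; left; apply/eqP.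
  transitivity ((4%:R * rR - 2%:R * (rR * dl)) * #|cell B f x|%:R); first by ring.
  by rewrite rdl; congr (_ * _); field.
move: fin; rewrite -(ler_nat R) !natrM -/rR; congr (_ <= _ * _).
by rewrite -subn1 natrB ?natrM // !muln_gt0 (ltnW r1).
Qed.

(** One element per vertex of the host to be used. An index lying in the branch sets of several
    vertices occurs once for each of them: this is where overlapping branch sets become disjoint. *)
Definition host_index (H : sgraph) (J : finType) (V : J -> {set H}) (home : H -> J) s
    (mu : J -> H -> {set 'I_s}) : finType :=
  {t : clones V home * 'I_s | t.2 \in mu (val t.1).2 (val t.1).1}.

Lemma card_host_index (H : sgraph) (J : finType) (V : J -> {set H}) (home : H -> J) s
    (mu : J -> H -> {set 'I_s}) (P : clones V home -> 'I_s -> bool) :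
  (#|[set x : host_index V home mu | P (val x).1 (val x).2]| =
   \sum_(c : clones V home) #|[set i in mu (val c).2 (val c).1 | P c i]|)%N.
Proof.
rewrite [RHS](eq_bigr (fun c : clones V home => \sum_(i | (i \in mu (val c).2 (val c).1) && P c i) 1)%N).
  rewrite pair_big_dep /= sum1_card -(card_imset _ val_inj); apply: eq_card => t.
  apply/imsetP/idP => [[[[c i] h]]|].
    by rewrite inE /= => Px ->; rewrite unfold_in /= h.
  case: t => c i; rewrite unfold_in /= => /andP[h Pt].
  by exists (Sub (c, i) h : host_index V home mu); rewrite ?inE SubK.
by move=> c _; rewrite -sum1_card; apply: eq_bigl => i; rewrite inE.
Qed.

(* The clones of [H] are realised by the embedded models of the pieces; the
   edges joining a clone to its home clone are routed through [Z]. *)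
Lemma embedded_pieces_minor (G H : sgraph) (T : finType) (f : G -> T) (R0 : rel T)
    (Z : {set G}) (J : finType) (V : J -> {set H}) (p w m s l t : nat)
    (lab : J -> 'I_s -> G) (mu : J -> H -> {set 'I_s}) :
  (1 < p)%N -> (0 < w)%N -> lower_regular (~: Z) f p w R0 ->
  covering V -> (forall j, (#|V j| * s <= m)%N) ->
  (forall j, label_model f R0 (lab j) (mu j)) ->
  (forall j i, (2 * w <= #|cell (~: Z) f (f (lab j i))|)%N) ->
  (forall j i, let x := f (lab j i) in
     (#|cell (~: Z) f x| * (m * p ^ m) <= w * (#|cell (~: Z) f x| -
       \sum_j \sum_(u in V j) #|[set i in mu j u | f (lab j i) == x]|))%N) ->
  (forall (U : {set G}) x y, (#|U :&: Z| < t)%N -> x != y ->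
      exists I : {set G}, [/\ I \subset Z, [disjoint I & U], (#|I| <= l)%N & links I x y]) ->
  (l * (\sum_j #|V j| - #|H|) < t)%N ->
  minor H G.
Proof.
move=> p1 w0 reg covV Vs lm big room lk lt.
have ex_home u : exists j, u \in V j by case: covV => /(_ u).
pose home u := xchoose (ex_home u).
have hV u : u \in V (home u) by apply: xchooseP (ex_home u).
apply: minor_trans (minor_clones covV hV) _.
pose X := host_index V home mu.
pose pc (x : X) : J := (val (val x).1).2.
pose lb (x : X) : T := f (lab (pc x) (val x).2).
have [||g [ginj gcell gadj]] := @embed_groups G (~: Z) T f p w m R0 X J pc lb p1 w0 reg.
- move=> j; rewrite (@card_host_index H J V home s mu (fun c _ => (val c).2 == j)).
  apply: leq_trans (Vs j).
  have -> : #|V j| = #|[set c : clones V home | pred1 j (val c).2]|.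
    by rewrite (card_clones V home (pred1 j)) big_pred1_eq.
  rewrite -sum_nat_const [leqRHS]big_mkcond /=; apply: leq_sum => c _; rewrite inE.
  case: eqP => [_|_]; first by apply: leq_trans (max_card _) _; rewrite card_ord.
  by rewrite leqn0 cards_eq0; apply/eqP/setP=> i; rewrite !inE andbF.
- move=> x; split; first exact: big.
  have -> : #|[set x' | lb x' == lb x]| = (\sum_j \sum_(u in V j) #|[set i in mu j u | f (lab j i) == lb x]|)%N.
    rewrite (@card_host_index H J V home s mu (fun c i => f (lab (val c).2 i) == lb x)).
    exact: (sum_clones V home xpredT (fun u j => #|[set i in mu j u | f (lab j i) == lb x]|)).
  exact: room.
have mu_ne (c : clones V home) : exists i, i \in mu (val c).2 (val c).1.
  by have [h _] := lm (val c).2; have [/set0Pn] := h (val c).1.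
pose i0 (c : clones V home) := xchoose (mu_ne c).
have i0P c : i0 c \in mu (val c).2 (val c).1 by apply: xchooseP.
pose x0 (c : clones V home) : X := Sub (c, i0 c) (i0P c).
(* [insubd] makes this total; its default is used only for indices outside the branch set of [c]. *)
pose gi (c : clones V home) i : G := g (insubd (x0 c) (c, i)).
have giE c i (h : i \in mu (val c).2 (val c).1) : gi c i = g (Sub (c, i) h).
  by rewrite /gi; congr g; apply: val_inj; rewrite val_insubd h SubK.
pose host (c : clones V home) : {set G} := \bigcup_(i in mu (val c).2 (val c).1) [set gi c i].
have hostP c y : y \in host c -> exists2 x : X, (val x).1 = c & y = g x.
  by case/bigcupP=> i ic /set1P->; exists (Sub (c, i) ic); rewrite ?SubK ?giE.
have hostZ c : [disjoint host c & Z].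
  apply/pred0P=> y /=; apply/negP=> /andP[/hostP[x _ ->] gZ].
  by have := gcell x; rewrite !inE gZ.
have host_dis c d : c != d -> [disjoint host c & host d].
  move=> ncd; apply/pred0P=> y /=; apply/negP=> /andP[/hostP[x xc ->] /hostP[x' x'd]].
  by move/ginj => Ex; move: ncd; rewrite -xc -x'd Ex eqxx.
have gi_adj c d i j : (val c).2 = (val d).2 -> i \in mu (val c).2 (val c).1 ->
    j \in mu (val d).2 (val d).1 -> label_adj f R0 (lab (val c).2) i j -> adj (gi c i) (gi d j).
  move=> Ecd ic jd /andP[nij /andP[r1 r2]]; rewrite (giE c i ic) (giE d j jd); apply: gadj.
  - by rewrite /pc !SubK.
  - by apply: contra nij => /eqP/(congr1 (fun x => (val x).2)); rewrite !SubK /= => ->.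
  - by rewrite /lb /pc !SubK /= -Ecd.
  - by rewrite /lb /pc !SubK /= -Ecd.
pose pt (c : clones V home) := gi c (i0 c).
have ptP c : pt c \in host c by apply/bigcupP; exists (i0 c); rewrite ?inE.
pose hub (c : clones V home) : clones V home := Sub ((val c).1, home (val c).1) (hV _).
pose Rq : finType := {c : clones V home | c \in away V home}.
pose src (q : Rq) := pt (val q); pose tgt (q : Rq) := pt (hub (val q)).
have src_tgt q : src q != tgt q.
  have nh : val q != hub (val q).
    have := valP q; rewrite inE; apply: contra => /eqP E; by rewrite {1}E SubK.
  have h1 : src q \in host (val q) := ptP _.
  have h2 : tgt q \in host (hub (val q)) := ptP _.
  by apply/eqP => E; have := disjointFr (host_dis _ _ nh) h1; rewrite E h2.
have t0 : (0 < t)%N := leq_ltn_trans (leq0n _) lt.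
have [|q U Uq|j|I [IZ _ _ Il Idis]] := @greedy_links G Rq unit (fun=> tt) (fun=> Z) src tgt set0 t.-1 l.
- by case; case.
- by apply: lk => //; apply: leq_ltn_trans Uq _; rewrite prednK.
- rewrite set0I cards0 add0n -ltnS prednK //; apply: leq_ltn_trans lt.
  rewrite leq_mul2l; apply/orP; right; rewrite -(card_away hV) addnK.
  by apply: leq_trans (max_card _) _; rewrite card_sig; apply: subset_leq_card; apply/subsetP.
pose e : rel G := fun x y => adj x y ||
  [exists q : Rq, (src q == x) && (tgt q == y) || (src q == y) && (tgt q == x)].
have esym : symmetric e.
  by move=> x y; rewrite /e adj_sym; congr (_ || _); apply: eq_existsb => q; rewrite orbC.
apply: (@patch_minor G (clones V home) e host Rq src tgt I) => //.
- move=> c; apply: (rel_connected_bigcup (f := label_adj f R0 (lab (val c).2))) => //.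
  + by have [h _] := lm (val c).2; apply: h.
  + by move=> i _; apply: rel_connected1.
  move=> i j ic jc ij; exists (gi c i), (gi c j); rewrite !inE; split=> //.
  by rewrite /e (gi_adj c c i j) // orbT.
- move=> c d /orP[/andP[/eqP Ej uv]|/and3P[/eqP Eu nj /orP[/eqP hc|/eqP hd]]].
  + have [_ h] := lm (val c).2; have [i [j [ic jd ij]]] := h _ _ uv; rewrite Ej in jd.
    exists (gi c i), (gi d j); split; last by rewrite /e (gi_adj c d i j).
      by apply/bigcupP; exists i; rewrite ?inE.
    by apply/bigcupP; exists j; rewrite ?inE.
  + have da : d \in away V home by rewrite inE -Eu -hc eq_sym.
    have Ec : hub d = c by apply: val_inj; rewrite SubK -Eu -hc -surjective_pairing.
    exists (pt c), (pt d); split; rewrite ?ptP //; apply/orP; right; apply/existsP.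
    by exists (Sub d da : Rq); rewrite /src /tgt SubK Ec !eqxx orbT.
  have ca : c \in away V home by rewrite inE Eu -hd.
  have Ed : hub c = d by apply: val_inj; rewrite SubK Eu -hd -surjective_pairing.
  exists (pt c), (pt d); split; rewrite ?ptP //; apply/orP; right; apply/existsP.
  by exists (Sub c ca : Rq); rewrite /src /tgt SubK Ed !eqxx.
- move=> x y /orP[xy|/existsP[q /orP[] /andP[/eqP <- /eqP <-]]]; first by left.
  + by right; exists q; left.
  + by right; exists q; right.
by move=> q c; apply: disjointWl (IZ q) _; rewrite disjoint_sym.
Qed.

(** [E] depends on [K] and [r] alone, so that the covering, and with it [k], can be chosen
    afterwards; only the threshold [N0] depends on [k]. *)
Lemma dense_case (R : realType) (K r : nat) : (0 < K)%N -> (1 < r)%N ->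
  exists2 E : nat, (0 < E)%N & forall k : nat, exists N0 : nat,
  forall (G H : sgraph) (D b : nat) (c : R) (J : finType) (V : J -> {set H}),
  [/\ N0 <= num_vertices G, num_vertices G <= K * D, D <= K * b & 2 * b <= D]%N ->
  (forall x : G, (D <= #|nbhd setT x|)%N) ->
  (forall U : {set G}, (#|U| <= b)%N -> connected_in (~: U)) ->
  (#|H| <= 4 * num_vertices G)%N ->
  (frac_extremal R H < c%:E)%E -> 0 < c -> (num_vertices G)%:R <= K%:R * c ->
  (1 + 8%:R / r%:R) * (2%:R * c * (num_vertices G)%:R) <= (arcs [set: G])%:R ->
  covering V -> (forall j, (0 < #|V j| <= k)%N) -> (E * \sum_j #|V j| <= E.+1 * #|H|)%N ->
  minor H G.
Proof.
(* With q + 1 = 2Kr all losses, from the reserve, small cells, irregular pairs and heavy vertices,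
   total at most 12 n^2 / p arcs. By n <= K c this is at most half of the excess 8/r granted in the
   density hypothesis. *)
move=> K0 r1; pose q := (2 * K * r).-1; pose l := (3 * K * K)%N; pose s := r.+1.
have r0 : (0 < r)%N by apply: ltnW.
have QE : q.+1 = (2 * K * r)%N by rewrite prednK // !muln_gt0 K0 r0.
pose tau := (8 * K * K * l * q.+1 ^ l)%N.
have l0 : (0 < l)%N by rewrite !muln_gt0 K0.
have KK0 : (0 < K * K)%N by rewrite muln_gt0 K0.
have tau0 : (0 < tau)%N by rewrite !muln_gt0 ?K0 ?l0 ?expn_gt0.
pose E := (8 * r * s * q.+1 * (l * tau))%N.
have E0 : (0 < E)%N by rewrite !muln_gt0 ?r0 ?K0 ?expn_gt0.
(* In [w], the factor 4r stands for the share 1/(4r) of a cell left free, and m p^m for what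
   embedding a piece of [m] items consumes. *)
exists E => // k; pose m := (k * s).+1; pose p := q.+1; pose w := (4 * r * (m * p ^ m))%N.
have p0 : (0 < p)%N by [].
have p1 : (1 < p)%N by rewrite /p QE; move: K0 r1; clear; nia.
have w0 : (0 < w)%N by rewrite !muln_gt0 r0 expn_gt0.
pose Tb := label_bound (p * w * w).+1.
pose rnd := (8 * (Tb * (k * s) ^ 2) * (8 * r * p * Tb) ^ 2)%N.
(* The summands ensure in turn the union bound over pairs, l <= b, cells with at least 2w vertices,
   and the rounding error. *)
exists (24 * tau * tau + K * K * l + 2 * w * (p * Tb) + (rnd + 1))%N.
move=> G H D b c J V [nN nK DK bD] deg con Hn cfc c0 nc dense covV Vk VE; set n := num_vertices G in nN nK Hn nc dense *.
have n0 : (0 < n)%N by apply: leq_trans nN; rewrite !addn1 addnS.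
have lb_ : (l <= b)%N.
  rewrite -(leq_pmul2l KK0); apply: leq_trans (_ : n <= _)%N.
    by apply: leq_trans nN; rewrite -!addnA addnCA leq_addr.
  by apply: leq_trans nK _; rewrite -mulnA leq_mul2l DK orbT.
have big_n : (2 * (n * n) < 2 ^ (n %/ tau))%N.
  by apply: exp_dominates_square => //; apply: leq_trans nN; rewrite -!addnA leq_addr.
have [Z [cZ HZ]] := @reserve_links G K D b q K0 lb_ nK DK bD deg con big_n.
pose B := ~: Z.
have [T [f [R0 [cT reg ar]]]] := regularity B p w; rewrite -/Tb in cT.
have Tb0 : (0 < Tb)%N.
  by apply: leq_trans cT; have /card_gt0P[v _] := n0; apply/card_gt0P; exists (f v).
(* Vertices in cells that are not too small; at most [Tb] cells are discarded, with at most n / p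
   vertices in all. *)
pose B1 := [set v in B | n <= #|cell B f (f v)| * (p * Tb)]%N.
have B1B : B1 \subset B by apply/subsetP=> v; rewrite inE => /andP[].
have cellB1 x v : v \in cell B1 f x -> cell B1 f x = cell B f x /\ (n <= #|cell B f x| * (p * Tb))%N.
  rewrite !inE => /andP[/andP[vB h] /eqP fv]; rewrite fv in h; split=> //.
  by apply/setP=> v'; rewrite !inE; case: eqP => [->|_]; rewrite ?andbF // h !andbT.
have small : (p * #|B :\: B1| <= n)%N.
  rewrite -(leq_pmul2r Tb0); apply: leq_trans (_ : #|T| * n <= _)%N; last first.
    by rewrite mulnC leq_mul2l cT orbT.
  have -> : #|B :\: B1| = (\sum_x #|[set v in B :\: B1 | f v == x]|)%N.
    rewrite -sum1_card (partition_big f xpredT) //=; apply: eq_bigr => x _; rewrite sum1_card.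
    by apply: eq_card => v; rewrite [RHS]inE.
  rewrite mulnAC big_distrr -sum_nat_const; apply: leq_sum => x _ /=.
  have [->|/set0Pn[v]] := eqVneq [set v in B :\: B1 | f v == x] set0; first by rewrite cards0 muln0.
  rewrite !inE => /andP[/andP[+ vB] /eqP fv]; rewrite vB fv /= -ltnNge => h; apply: leq_trans (ltnW h).
  rewrite mulnC leq_mul2r; apply/orP; right; apply: subset_leq_card; apply/subsetP=> v'.
  by rewrite !inE => /andP[/andP[_ ->] ->].
pose RR u v := R0 (f u) (f v) && R0 (f v) (f u).
have area_big : (p * arcs [set: G] <= p * area B1 RR + 10 * (n * n))%N.
  have h1 := area_regular f R0 B1B.
  have h2 : (#|~: B1| <= #|Z| + #|B :\: B1|)%N.
    apply: leq_trans (leq_card_setU _ _); apply: subset_leq_card; apply/subsetP=> v.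
    by rewrite !inE; case: (v \in Z); rewrite //= andbT.
  have h3 : (p * #|~: B1| <= 3 * n)%N.
    apply: leq_trans (_ : p * (#|Z| + #|B :\: B1|) <= _)%N; first by rewrite leq_mul2l h2 orbT.
    by rewrite mulnDr; move: cZ small; rewrite -/n -/p; move: (p * _)%N (p * _)%N; clear; lia.
  have h4 : (#|B| * #|B| <= n * n)%N by apply: leq_mul; apply: max_card.
  have h5 : (n * (p * #|~: B1|) <= n * (3 * n))%N by rewrite leq_mul2l h3 orbT.
  apply: leq_trans (_ : p * (area B1 RR + 2 * (n * #|~: B1|) + 2 * area B (fun u v => ~~ R0 (f u) (f v) && adj u v)) <= _)%N.
    by rewrite leq_mul2l h1 orbT.
  have gen (P a1 a2 a3 a4 : nat) : (P * a1 <= 2 * a4 -> a4 <= n * n -> n * (P * a3) <= n * (3 * n) ->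
      P * (a2 + 2 * (n * a3) + 2 * a1) <= P * a2 + 10 * (n * n))%N.
    have -> : (P * (a2 + 2 * (n * a3) + 2 * a1) = P * a2 + 2 * (n * (P * a3)) + 2 * (P * a1))%N by ring.
    rewrite (mulnCA n 3%N); move: (P * a1)%N (n * (P * a3))%N (n * n)%N (P * a2)%N => x1 x2 x3 x4.
    by clear; lia.
  exact: gen ar h4 h5.
have rR0 : (0 : R) < r%:R by rewrite ltr0n.
have KR0 : (0 : R) < K%:R by rewrite ltr0n.
have nR0 : (0 : R) < n%:R by rewrite ltr0n.
have pR : p%:R = 2%:R * K%:R * r%:R :> R by rewrite /p QE !natrM.
have pR0 : (0 : R) < p%:R by rewrite ltr0n.
have light (y : T -> R) : (forall x : T, 0 <= y x) -> exists (lab : 'I_s -> G) (mu : H -> {set 'I_s}),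
     [/\ forall i, lab i \in B1, label_model f R0 lab mu,
        forall i, y (f (lab i)) * n%:R <= p%:R * \sum_(v in B1) y (f v)
      & (r%:R + 4%:R) * (\sum_u \sum_(i in mu u) y (f (lab i))) <= s%:R * \sum_(v in B1) y (f v)].
  move=> y0; have e0 : (0 : R) < 4%:R / r%:R by rewrite divr_gt0.
  have [|lab [mu [h1 h2 h3 h4]]] := @light_model R H G T f R0 B1 c (4%:R / r%:R) s p y cfc c0 e0 r0 p0 n0 y0.
    have -> : \sum_(u in B1) \sum_(v in B1) (R0 (f u) (f v) && R0 (f v) (f u))%:R = (area B1 RR)%:R :> R.
      by rewrite areaE natr_sum; apply: eq_bigr => u _; rewrite natr_sum.
    have ab : p%:R * (arcs [set: G])%:R <= p%:R * (area B1 RR)%:R + 10%:R * (n%:R * n%:R) :> R.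
      by rewrite -!natrM -natrD ler_nat.
    rewrite -/n; set nn : R := n%:R in nR0 nc dense ab *.
    have k1 : 12%:R * (nn * nn) <= p%:R * (4%:R / r%:R * (2%:R * c * nn)).
      have -> : p%:R * (4%:R / r%:R * (2%:R * c * nn)) = 16%:R * (K%:R * c * nn).
        by rewrite pR; field; rewrite gt_eqF.
      have : nn * nn <= K%:R * c * nn by rewrite ler_pM2r.
      have : 0 < nn * nn by rewrite mulr_gt0.
      by move: (nn * nn) (K%:R * c * nn); clear; move=> x z; lra.
    rewrite -(ler_pM2l pR0).
    have k2 := ler_wpM2l (ltW pR0) dense.
    have -> : p%:R * ((1 + 4%:R / r%:R) * (2%:R * c * nn) + 2%:R * nn ^+ 2 / p%:R) =
        p%:R * (2%:R * c * nn) + p%:R * (4%:R / r%:R * (2%:R * c * nn)) + 2%:R * (nn * nn).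
      by field; rewrite !gt_eqF.
    have E2 : p%:R * ((1 + 8%:R / r%:R) * (2%:R * c * nn)) =
        p%:R * (2%:R * c * nn) + 2%:R * (p%:R * (4%:R / r%:R * (2%:R * c * nn))).
      by field; rewrite gt_eqF.
    move: k1 k2 ab; rewrite E2; clear.
    move: (p%:R * (2%:R * c * nn)) (p%:R * (4%:R / r%:R * _)) (nn * nn) (p%:R * (arcs _)%:R) (p%:R * (area _ _)%:R).
    by move=> x1 x2 x3 x4 x5; lra.
  exists lab, mu; split=> //; move: h4; rewrite /s /= [_ * (1 + _)](_ : _ = r%:R + 4%:R) //.
  by field; rewrite gt_eqF.
have Hh : (\sum_j #|V j| <= 2 * #|H|)%N.
  rewrite -(leq_pmul2l E0); apply: leq_trans VE _; rewrite mulnCA mul2n -addnn mulSn leq_add2r.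
  by rewrite leq_pmull.
have J_le : (#|J| <= 8 * n)%N.
  apply: leq_trans (_ : \sum_j #|V j| <= _)%N.
    by rewrite -sum1_card; apply: leq_sum => j _; case/andP: (Vk j).
  by apply: leq_trans Hh _; move: Hn; clear; lia.
have [||||||||lab [mu [labB lm load]]] := @choose_models R H G T f R0 B1 J V r p k E Tb r1 p0 n0 Tb0 cT.
- by rewrite /E leq_pmulr // muln_gt0 l0.
- by move=> x /set0Pn[v] /cellB1[-> ].
- by move=> j; case/andP: (Vk j).
- by case: covV.
- exact: Hn.
- exact: VE.
- have rn : (rnd <= n)%N by apply: leq_trans nN; rewrite addnA -[X in (X <= _)%N]add0n -addnA leq_add // leq_addr.
  apply: leq_trans (_ : 8 * n * (Tb * (k * s) ^ 2) * (8 * r * p * Tb) ^ 2 <= _)%N.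
    by rewrite !leq_mul2r J_le !orbT.
  have -> : (8 * n * (Tb * (k * s) ^ 2) * (8 * r * p * Tb) ^ 2 = n * rnd)%N by rewrite /rnd; move: ((k * s) ^ 2)%N ((8 * r * p * Tb) ^ 2)%N => x1 x2; ring.
  by rewrite -mulnn leq_mul2l rn orbT.
- exact: light.
have lab_cell j i : cell B1 f (f (lab j i)) = cell B f (f (lab j i)) /\
    (n <= #|cell B f (f (lab j i))| * (p * Tb))%N.
  by apply: (cellB1 _ (lab j i)); rewrite inE labB eqxx.
(* The overlap is at most 4n / E, and the factor l tau in [E] brings the vertices used by its links
   below the tolerance n / tau of the reserve. *)
have cap : (l * (\sum_j #|V j| - #|H|) < n %/ tau)%N.
  have e1 : (E * (\sum_j #|V j| - #|H|) <= 4 * n)%N.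
    by rewrite mulnBr; apply: leq_trans Hn; rewrite leq_subLR addnC -mulSn.
  have e2 : (8 * (l * tau) * (\sum_j #|V j| - #|H|) <= 4 * n)%N.
    apply: leq_trans e1; rewrite leq_mul2r; apply/orP; right; rewrite /E leq_mul2r.
    by apply/orP; right; rewrite -!mulnA leq_pmulr // !muln_gt0 r0.
  have e3 : (4 * tau <= n)%N.
    apply: leq_trans nN; apply: leq_trans (_ : 24 * tau * tau <= _)%N; last by rewrite -!addnA leq_addr.
    by move: tau0; clear; nia.
  rewrite leq_divRL //; move: e2 e3; move: (\sum_j _ - _)%N => x.
  have -> : (8 * (l * tau) * x = 8 * (l * x * tau))%N by ring.
  have gen (a t' n' : nat) : (8 * a <= 4 * n' -> 4 * t' <= n' -> t' + a <= n')%N by clear; lia.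
  by rewrite mulSn; apply: gen.
apply: (@embedded_pieces_minor G H T f R0 Z J V p w m s l (n %/ tau) lab mu) => //.
- by move=> j; apply: leqW; rewrite leq_mul2r; case/andP: (Vk j) => _ ->; rewrite orbT.
- move=> j i; have [_ h] := lab_cell j i; rewrite -/B.
  have pT : (0 < p * Tb)%N by rewrite muln_gt0 p0.
  rewrite -(leq_pmul2r pT); apply: leq_trans h; apply: leq_trans nN.
  by rewrite -addnA addnCA leq_addr.
move=> j i; rewrite -/B /=; have [Ec _] := lab_cell j i.
have := load (f (lab j i)); rewrite Ec; set L := (\sum_j _)%N; move: #|cell _ _ _| => N ld.
have h : (N <= 4 * r * (N - L))%N.
  by rewrite mulnBr; move: ld r0; clear; rewrite -subn1 mulnBl mul1n; move: (4 * r * L)%N => z; nia.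
by rewrite /w; move: (m * p ^ m)%N => X; rewrite mulnAC leq_mul2r h orbT.
Qed.

(** * The two extremal functions are finite *)

Lemma density_arcs (R : realType) (G : sgraph) : (0 < num_vertices G)%N ->
  2%:R * density R G * (num_vertices G)%:R = (arcs [set: G])%:R.
Proof.
move=> v0; rewrite -num_edges_arcs natrM /density -mulrA divfK //.
by rewrite pnatr_eq0 -lt0n.
Qed.

Lemma lt_density (R : realType) (G : sgraph) (c : R) : (0 < num_vertices G)%N ->
  (2%:R * c * (num_vertices G)%:R < (arcs [set: G])%:R) = (c < density R G).
Proof.
move=> v0; have n0 : (0 : R) < (num_vertices G)%:R by rewrite ltr0n.
by rewrite -density_arcs // ltr_pM2r // ltr_pM2l.
Qed.

(** Tested on a single edge: density 1/2, and every model uses at least v(H) incidences on two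
    vertices, so the volume is at most 2 / v(H). Hence c_f grows with v(H). *)
Lemma frac_extremal_lower (R : realType) (H : sgraph) : (0 < num_vertices H)%N ->
  (((num_vertices H)%:R / 4%:R)%:E <= frac_extremal R H)%E.
Proof.
move=> h0; set h : R := (num_vertices H)%:R; have hp : 0 < h by rewrite ltr0n.
pose K2 := complete 2.
have v2 : num_vertices K2 = 2%N by rewrite /num_vertices card_ord.
have a2 : arcs [set: K2] = 2%N.
  rewrite /arcs (eq_bigr (fun=> 1%N)); first by rewrite sum1_card cardsT -[#|_|]/(num_vertices K2) v2.
  move=> i _; transitivity #|predC1 i|; last by have := cardC1 i; rewrite card_ord.
  by apply: eq_card => j; rewrite !inE /= /complete_adj eq_sym.
have d2 : density R K2 = 2%:R^-1.
  have := density_arcs R (_ : 0 < num_vertices K2)%N; rewrite v2 a2 => /(_ isT) E.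
  by apply: (mulfI (_ : 2%:R * 2%:R != 0 :> R)); [rewrite mulf_neq0 // pnatr_eq0|move: E; lra].
have vol : (volume R H K2 <= (2%:R / h)%:E)%E.
  apply: ge_ereal_sup => _ [n [al [mu [al0 jm load ->]]]]; rewrite lee_fin ler_pdivlMr // mulr_suml.
  apply: (le_trans (y := \sum_(x : K2) \sum_(i < n) al i * (multiplicity (mu i) x)%:R)); last first.
    apply: le_trans (ler_sum _ (fun x _ => load x)) _.
    by rewrite sumr_const -[#|_|]/(num_vertices K2) v2.
  rewrite exchange_big /=; apply: ler_sum => i _; rewrite -mulr_sumr ler_wpM2l //.
  have := multiplicity_sum (mu i) (fun=> 1 : R).
  under [X in _ = X]eq_bigr do rewrite mul1r.
  move=> <-; apply: (le_trans (y := \sum_(u : H) 1)); first by rewrite sumr_const.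
  apply: ler_sum => u _; rewrite sumr_const (ler_nat _ 1); have [con _] := jm i.
  by have [] := con u; rewrite -card_gt0.
apply: (le_trans (y := ((density R K2)%:E / volume R H K2)%E)); last first.
  by apply: ereal_sup_ubound; exists K2; rewrite v2.
rewrite d2; have := volume_ge0 R H K2; move: vol; case: (volume R H K2) => [v| |] //.
rewrite !lee_fin => vh v0; have [->|vn0] := eqVneq v 0.
  by rewrite inve0 gt0_muley ?leey // lte_fin invr_gt0.
have vp : 0 < v by rewrite lt_neqAle eq_sym vn0.
rewrite inver (negPf vn0) -EFinM lee_fin ler_pdivlMr //.
apply: le_trans (ler_wpM2l (ltW (divr_gt0 hp (ltr0Sn _ 3))) vh) _.
by rewrite le_eqVlt; apply/orP; left; apply/eqP; field; rewrite gt_eqF.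
Qed.

Lemma frac_extremal_fin_num (R : realType) (H : sgraph) : (0 < num_vertices H)%N ->
  frac_extremal R H \is a fin_num.
Proof.
move=> h0; have [D HD] := minor_dense H.
(* With eps = 1/4 the condition 2 <= eps^3 c reads c >= 128. *)
pose c : R := D%:R + 128%:R.
have D0 : (0 : R) <= D%:R by apply: ler0n.
have up : (frac_extremal R H <= (c * (1 + 7%:R * 4%:R^-1))%:E)%E.
  apply: frac_extremal_upper.
  - by rewrite invr_gt0.
  - by [].
  - have -> : 4%:R^-1 ^+ 3 = 64%:R^-1 :> R by field.
    by rewrite /c; lra.
  move=> G v0 lt; apply: HD => //; rewrite -(ltr_nat R) !natrM; apply: le_lt_trans lt.
  by rewrite ler_wpM2r // ler_wpM2l // /c; lra.
rewrite fin_real //; apply/andP; split; last by apply: le_lt_trans up _; rewrite ltry.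
by apply: lt_le_trans (frac_extremal_lower R h0); rewrite ltNyr.
Qed.

Lemma extremal_fin_num (R : realType) (H : sgraph) : (1 < num_vertices H)%N ->
  extremal R H \is a fin_num.
Proof.
move=> h1; have [D HD] := minor_dense H.
have up : (extremal R H <= D%:R%:E)%E.
  apply: ge_ereal_sup => _ [G [v0 nm ->]]; rewrite lee_fin leNgt -lt_density //.
  by apply/negP=> lt; apply: nm; apply: HD => //; rewrite -(ltr_nat R) !natrM.
rewrite fin_real //; apply/andP; split; last by apply: le_lt_trans up _; rewrite ltry.
apply: (lt_le_trans (y := (density R (complete 1))%:E)); first by rewrite ltNyr.
apply: ereal_sup_ubound; exists (complete 1); split=> //; first by rewrite /num_vertices card_ord.
move=> [mu [con _] dis].
have [u [v nuv]] : exists u v : H, u != v.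
  move: h1; rewrite /num_vertices => /card_gt1P[u [v [_ _ nuv]]]; by exists u, v.
have mem w : ord0 \in mu w.
  by have [/set0Pn[i iw] _] := con w; rewrite (ord1 i) in iw.
by have := disjointFr (dis u v nuv) (mem u); rewrite mem.
Qed.

Lemma extremal_minor (R : realType) (H G : sgraph) : (1 < num_vertices H)%N ->
  (0 < num_vertices G)%N -> fine (extremal R H) < density R G -> minor H G.
Proof.
move=> h1 v0 lt; apply/asboolP; apply/negPn/negP => /asboolPn nm.
have : ((density R G)%:E <= extremal R H)%E by apply: ereal_sup_ubound; exists G.
by rewrite -(fineK (extremal_fin_num R h1)) lee_fin leNgt lt.
Qed.

(** [frac_extremal_upper] needs c >= 2 / eps^3, hence the maximum with [c0]. If the maximum were
    [c0], then c_f <= 3 c0, and v(H) <= 4 c_f would bound v(H) by 12 c0. *)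
Lemma frac_extremal_asymptotic (R : realType) (eps : R) : 0 < eps -> eps <= 4%:R^-1 ->
  exists N : nat, forall H : sgraph, (N <= num_vertices H)%N -> (1 < num_vertices H)%N ->
    fine (frac_extremal R H) <= fine (extremal R H) * (1 + 7%:R * eps).
Proof.
move=> e0 e4; have e3 : 0 < eps ^+ 3 by rewrite exprn_gt0.
pose c0 : R := 2%:R / eps ^+ 3; have c00 : 0 < c0 by rewrite divr_gt0.
have E0 : 0 < 1 + 7%:R * eps by rewrite addr_gt0 // mulr_gt0.
exists (Num.trunc (12%:R * c0)).+1 => H hN h1.
have h0 : (0 < num_vertices H)%N by apply: ltnW.
set ce := fine (extremal R H); pose c := Num.max ce c0.
have cc0 : c0 <= c by rewrite le_max lexx orbT.
have cce : ce <= c by rewrite le_max lexx.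
have : (frac_extremal R H <= (c * (1 + 7%:R * eps))%:E)%E.
  apply: frac_extremal_upper => //.
    by have := ler_wpM2l (ltW e3) cc0; rewrite /c0 mulrCA divff ?mulr1 // gt_eqF.
  by move=> G v0; rewrite lt_density // => lt; apply: (extremal_minor (R := R)) => //; apply: le_lt_trans lt.
rewrite -(fineK (frac_extremal_fin_num R h0)) lee_fin => up; apply: le_trans up _.
rewrite ler_pM2r // /c ge_max lexx /=; apply: contraLR hN; rewrite -ltNge -ltnNge => lt.
have Ec : c = c0 by rewrite /c; apply/max_idPr; apply: ltW.
have low := frac_extremal_lower R h0.
have up : (frac_extremal R H <= (c * (1 + 7%:R * eps))%:E)%E.
  apply: frac_extremal_upper => //.
    by have := ler_wpM2l (ltW e3) cc0; rewrite /c0 mulrCA divff ?mulr1 // gt_eqF.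
  by move=> G v0; rewrite lt_density // => lt'; apply: (extremal_minor (R := R)) => //; apply: le_lt_trans lt'.
have := le_trans low up; rewrite lee_fin Ec => le.
have h12 : (num_vertices H)%:R <= 12%:R * c0.
  have : c0 * (1 + 7%:R * eps) <= c0 * 3%:R by rewrite ler_pM2l //; move: e4; lra.
  by move: le; lra.
have /andP[_ lt12] := @truncn_itv R (12%:R * c0) (mulr_ge0 (ler0n _ 12) (ltW c00)).
by rewrite -(ltr_nat R); apply: le_lt_trans h12 lt12.
Qed.

(** * Comparing the two extremal functions *)

Lemma connected_in_induced (G : sgraph) (A : {set G}) (X : {set induced_graph A}) :
  connected_in (G := G) (val @: X) -> connected_in X.
Proof.
move=> con; have X0 : X != set0.
  by have [/set0Pn[_ /imsetP[x xX _]] _] := con; apply/set0Pn; exists x.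
apply: (cut_rel_connected (@adj_sym (induced_graph A)) X0) => C CX C0 nCX.
have [|||_ [_ [/imsetP[x xC ->] /imsetP[y yX ->] nyC xy]]] :=
    @rel_connected_cut G (@adj G) (val @: X) (val @: C) con.
- exact: imsetS.
- by have /set0Pn[x xC] := C0; apply/set0Pn; exists (val x); apply: imset_f.
- by apply: contra nCX => /eqP/(imset_inj val_inj)->.
by exists x, y; split=> //; apply: contra nyC; apply: imset_f.
Qed.

Lemma covering_sparse (F : sgraph -> Prop) (C0 : nat) (H : sgraph) (A : {set H}) :
  subgraph_closed F -> (forall K, F K -> arcs [set: K] <= 2 * C0 * num_vertices K)%N -> F H ->
  (arcs A <= 2 * C0 * #|A|)%N.
Proof.
move=> clF sp FH; rewrite -arcs_induced -num_vertices_induced.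
exact/sp/(clF _ H)/induced_subgraph.
Qed.

(** Both outcomes of [dense_dichotomy] are resolved with the same covering of [H]. In the second one
    the dense subgraph has lost the connectivity of the critical graph, so a minimal surplus subset
    is taken once more inside it. *)
Lemma minor_of_surplus (R : realType) (F : sgraph -> Prop) (r : nat) :
  strongly_sublinear_separators R F -> (16 <= r)%N ->
  exists N : nat, forall (H G0 : sgraph) (D : nat) (c : R),
  F H -> (N <= D)%N -> (frac_extremal R H < c%:E)%E -> D%:R <= 3%:R * c -> 0 < c ->
  (#|H| <= 4 * (D - (3 * D) %/ r).-1)%N ->
  (1 + 8%:R / r%:R) * c * r%:R <= (D - (3 * D) %/ r).-1%:R * r.-1%:R ->
  surplus D (D %/ r) [set: G0] -> minor H G0.
Proof.
move=> hF r16; have r0 : (0 < r)%N by apply: leq_trans r16.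
have [C0 sparse] := sublinear_sparse hF; have [clF _] := hF.
pose g := (r * r)%N; pose l := (576 * g)%N; pose c1 := (1 + 2 * C0 * l)%N.
pose L := (2048 * g * c1).+2; pose K := (16 * L * r.+1)%N.
have g0 : (0 < g)%N by rewrite muln_gt0 r0.
have K0 : (0 < 3 * K)%N by rewrite !muln_gt0.
have [E E0 dense] := @dense_case R (3 * K) r K0 (leq_trans (isT : 1 < 16)%N r16).
(* [E1] makes the overlap small against [b] and [d] in the case of many pieces, [E] against the
   reserve in the dense case; the product serves both. *)
pose E1 := (16 * r * (256 * g * (4 + 5 * l)))%N; pose EE := (E * E1)%N.
have E10 : (0 < E1)%N by rewrite !muln_gt0 r0.
have g8 : (0 < 8 * g)%N by rewrite !muln_gt0 r0.
have EE0 : (0 < EE)%N by rewrite muln_gt0 E0.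
have EEr : (0 : R) < EE%:R by rewrite ltr0n.
have eta0 : (0 : R) < EE%:R^-1 by rewrite invr_gt0.
have eta1 : EE%:R^-1 <= 1 :> R by rewrite invf_le1 // (ler_nat _ 1).
have [k cover] := sublinear_covering hF eta0 eta1.
have [N0 {}dense] := dense k.
exists (2 * r + 16 * g + 64 * g * (c1 * k) + 4 * N0 + 16)%N => H G0 D c FH ND cfc Dc c0 Hn edges crit0.
(* The degree D - 3D/r left by [dense_dichotomy]; the predecessor pays for the floor. *)
set D' := (D - _).-1 in Hn edges.
have [J [V [covV Vk Vtot]]] := cover H FH.
have VE : (EE * \sum_j #|V j| <= EE.+1 * #|H|)%N.
  rewrite -(ler_nat R) (natrM _ EE) (natrM _ EE.+1); apply: le_trans (ler_wpM2l (ltW EEr) Vtot) _.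
  rewrite le_eqVlt; apply/orP; left; apply/eqP; rewrite -natr1 /num_vertices; field.
  by rewrite gt_eqF.
set S := (\sum_j #|V j|)%N in Vtot VE.
have D2r : (2 * r <= D)%N by move: ND; clear; lia.
have D16g : (16 * g <= D)%N by move: ND; clear; lia.
have Dk : (64 * g * (c1 * k) <= D)%N by move: ND; clear; lia.
have DN : (4 * N0 + 16 <= D)%N by move: ND; clear; lia.
pose t := ((3 * D) %/ r)%N.
have t16 : (16 * t <= 3 * D)%N.
  by apply: leq_trans (leq_trunc_div (3 * D) r); rewrite mulnC leq_mul2l r16 orbT.
have tr : (3 * D < r * t.+1)%N by rewrite (mulnC r); apply: ltn_ceil.
have D'E : (D' + t.+1 = D)%N by rewrite /D' -/t; move: t16 DN; clear; lia.
have D'2 : (D <= 2 * D')%N by move: D'E t16 DN; clear; lia.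
have D'N : (N0 <= D')%N by move: D'2 DN; clear; lia.
have rD : (r <= D)%N by move: D2r; clear; lia.
pose b := (D %/ r)%N.
have rb : (r * b <= D)%N by rewrite mulnC leq_trunc_div.
have rb2 : (D < r * b.+1)%N by rewrite mulnC; apply: ltn_ceil.
have b0 : (0 < b)%N by rewrite divn_gt0.
have b2 : (2 * b <= D)%N by apply: leq_trans rb; rewrite leq_mul2r (leq_trans _ r16) ?orbT.
have [G [mG crit deg con [tri up]]] := critical_minor b2 b0 crit0.
apply: minor_trans mG.
have S2 : (S <= 2 * #|H|)%N.
  by rewrite -(leq_pmul2l EE0); apply: leq_trans VE _; rewrite mulnCA mul2n -addnn mulSn leq_add2r leq_pmull.
have HS : (#|H| <= S)%N.
  have [cov1 _] := covV; rewrite -cardsT.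
  apply: leq_trans (_ : #|\bigcup_j V j| <= _)%N.
    by apply: subset_leq_card; apply/subsetP=> u _; have [j uj] := cov1 u; apply/bigcupP; exists j.
  apply: (big_ind2 (fun (A : {set H}) n => #|A| <= n)%N); rewrite ?cards0 //.
  by move=> A n B m An Bm; apply: leq_trans (leq_card_setU _ _) (leq_add An Bm).
have SE : (EE * (S - #|H|) <= #|H|)%N by rewrite mulnBr leq_subLR addnC -mulSn.
have HD : (#|H| <= 4 * D)%N by move: Hn D'E; clear; lia.
have [||[P [dP disP]]|[W [W0 WK Wedges]]] := @dense_dichotomy G D b r L _ rD rb _ crit deg tri up => //.
- by apply: leq_trans r16.
- pose d := (D %/ (8 * g))%N; pose x := ((4 * D) %/ EE)%N.
  have xE : (EE * x <= 4 * D)%N by rewrite mulnC leq_trunc_div.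
  have dlow : (8 * g * d <= D)%N by rewrite mulnC leq_trunc_div.
  have dhigh : (D < 8 * g * d.+1)%N by rewrite mulnC; apply: ltn_ceil; rewrite muln_gt0.
  have div8 y : (64 * g * y <= D -> y <= d %/ 8)%N.
    move=> h; rewrite !leq_divRL //; apply: leq_trans h.
    by have -> : (y * 8 * (8 * g) = 64 * g * y)%N by ring.
  have x4 : (4 * (r * x) <= D)%N.
    have h : (16 * r * x <= EE * x)%N.
      by rewrite leq_mul2r; apply/orP; right; rewrite /EE /E1 mulnCA leq_pmulr // !muln_gt0 ?E0 ?r0.
    by move: h xE; rewrite -mulnA; move: (r * x)%N (EE * x)%N; clear; lia.
  apply: (@linked_pieces_minor G H J V D b g d C0 k x) => //.
  + by rewrite /d leq_divRL // mulnA; exact: D16g.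
  + apply: leq_trans (ltnW dhigh) _; rewrite mulnS.
    have d0 : (0 < d)%N.
      by rewrite divn_gt0 //; apply: leq_trans D16g; rewrite leq_mul2r; apply/orP; right.
    have h : (8 * g <= 8 * g * d)%N by rewrite leq_pmulr.
    by apply: leq_trans (leq_add h (leqnn _)) _; rewrite addnn -mul2n !mulnA.
  + rewrite leqNgt; apply/negP=> lt.
    have : (r * b.+1 <= r * (2 * x))%N by rewrite leq_mul2l lt orbT.
    by move: rb2 x4; rewrite mulnCA; move: (r * b.+1)%N (r * x)%N; clear; lia.
  + apply: div8; have h : (256 * g * ((4 + 5 * (576 * g)) * x) <= EE * x)%N.
      rewrite mulnA leq_mul2r; apply/orP; right.
      apply: leq_trans (_ : 16 * r * (256 * g * (4 + 5 * l)) <= _)%N.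
        by rewrite leq_pmull // muln_gt0 r0.
      by rewrite /EE leq_pmull.
    have e (a : nat) : (256 * g * a <= 4 * D -> 64 * g * a <= D)%N.
      by rewrite -!mulnA; move: (g * a)%N => z; clear; lia.
    exact: e (leq_trans h xE).
  + exact: div8.
  + by exists P.
  + by move=> j; case/andP: (Vk j).
  + by move=> j; apply: (covering_sparse _ clF sparse FH).
  + by apply: leq_trans S2 _; move: HD; clear; lia.
  rewrite -leq_subLR /x leq_divRL // mulnC.
  by apply: leq_trans SE HD.
pose b' := (D' %/ r)%N.
have D'r : (r <= D')%N by move: D2r D'2; clear; lia.
have b'0 : (0 < b')%N by rewrite divn_gt0.
have rb' : (r * b' <= D')%N by rewrite mulnC leq_trunc_div.
have rb'2 : (D' < r * b'.+1)%N by rewrite mulnC; apply: ltn_ceil.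
have b'2 : (2 * b' <= D')%N by apply: leq_trans rb'; rewrite leq_mul2r (leq_trans _ r16) ?orbT.
have D'0 : (0 < D')%N by apply: leq_trans D'r.
have dW : (2 * D' * #|W| <= arcs W)%N.
  rewrite -(leq_pmul2l r0).
  have h : (r * D' + 3 * D <= r * D)%N by rewrite -{2}D'E mulnDr leq_add2l ltnW.
  have : ((r * D' + 3 * D) * #|W| <= r * D * #|W|)%N by rewrite leq_mul2r h orbT.
  move: Wedges; have -> : (r * (2 * D' * #|W|) = 2 * (r * D' * #|W|))%N by ring.
  have -> : (2 * r * D * #|W| = 2 * (r * D * #|W|))%N by ring.
  have -> : ((r * D' + 3 * D) * #|W| = r * D' * #|W| + 3 * (D * #|W|))%N by ring.
  have -> : (6 * D * #|W| = 6 * (D * #|W|))%N by ring.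
  by move: (r * D' * #|W|)%N (r * D * #|W|)%N (D * #|W|)%N (r * arcs W)%N; clear; lia.
have crW : surplus D' b' W.
  apply/andP; split; last first.
    by apply: leq_ltn_trans dW _; rewrite -[X in (X < _)%N]addn0 ltn_add2l !muln_gt0 D'0.
  have : (#|W| * (2 * D') <= #|W| * #|W|.-1)%N by rewrite mulnC; apply: leq_trans dW (arcs_leq _).
  by rewrite leq_pmul2l //; move: #|W| W0; clear; lia.
have [W1 [W1W crW1 deg1 con1]] := surplus_subset b'2 crW.
apply: minor_trans (minor_subgraph (induced_subgraph W1)).
have [D'W1 arW1] := andP crW1.
have W1K : (#|W1| <= K * D')%N.
  apply: leq_trans (subset_leq_card W1W) _; apply: leq_trans WK _.
  apply: leq_trans (_ : 8 * L * r.+1 * (2 * D') <= _)%N; first by rewrite leq_mul2l D'2 orbT.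
  by rewrite mulnA leq_mul2r; apply/orP; right; rewrite /K (mulnC _ 2%N) !mulnA leqnn.
apply: (dense (induced_graph W1) H D' b' c J V) => //.
- rewrite num_vertices_induced; split.
  + exact: leq_trans D'N D'W1.
  + by apply: leq_trans W1K _; rewrite leq_mul2r leq_pmull ?orbT.
  + apply: leq_trans (ltnW rb'2) _; apply: leq_trans (_ : r * (2 * b') <= _)%N.
      by rewrite leq_mul2l mul2n -addnn -addn1 leq_add2l b'0 orbT.
    rewrite mulnA leq_mul2r; apply/orP; right; rewrite /K.
    have Lr : (r <= L * r)%N by rewrite leq_pmull.
    by move: Lr; rewrite -mulnA (mulnS L r); move: (L * r)%N; clear; lia.
  exact: b'2.
- by move=> x; rewrite card_nbhd_induced; apply: ltnW; apply: deg1; apply: (valP x).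
- move=> U Ub; apply: connected_in_induced.
  have -> : val @: (~: U) = W1 :\: (val @: U : {set G}).
    apply/setP=> y; rewrite inE; apply/imsetP/andP => [[x]|[ny yW]].
      rewrite inE => nx ->; split; last exact: (valP x).
      by apply: contra nx => /imsetP[x' x'U /val_inj->].
    exists (Sub y yW : induced_graph W1); rewrite ?SubK // inE; apply: contra ny => yU.
    by apply/imsetP; exists (Sub y yW : induced_graph W1).
  apply: con1; apply: leq_trans Ub; apply: leq_trans (leq_imset_card val U).
  by apply: subset_leq_card; apply: subsetIl.
- by rewrite num_vertices_induced; apply: leq_trans Hn _; rewrite leq_mul2l D'W1 orbT.
- rewrite num_vertices_induced; apply: (le_trans (y := K%:R * D%:R)).
    rewrite -natrM ler_nat; apply: leq_trans W1K _; rewrite leq_mul2l.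
    by apply/orP; right; move: D'E; clear; lia.
  have -> : (3 * K)%N%:R * c = K%:R * (3%:R * c) by rewrite (natrM _ 3%N K); ring.
  by apply: ler_wpM2l.
- rewrite num_vertices_induced arcs_induced.
  have rR0 : (0 : R) < r%:R by rewrite ltr0n.
  (* The surplus allows a deficit of 2 D' b' arcs, at most 2 D' |W1| / r because r b' <= D' <= |W1|;
     hence the factor r - 1. *)
  have h1 : (2 * (D' * (r.-1 * #|W1|)) <= r * arcs W1)%N.
    have h2 : (r * (2 * D' * #|W1|) <= r * (arcs W1 + 2 * D' * b'))%N by rewrite leq_mul2l ltnW ?orbT.
    have h3 : (D' * (r * b') <= D' * #|W1|)%N.
      by rewrite leq_mul2l (leq_trans rb' D'W1) orbT.
    have Er : (r * (2 * D' * #|W1|) = 2 * (D' * (r.-1 * #|W1|)) + 2 * (D' * #|W1|))%N.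
      by rewrite -{1}(prednK r0); ring.
    move: h2 h3; rewrite Er mulnDr; have -> : (r * (2 * D' * b') = 2 * (D' * (r * b')))%N by ring.
    by move: (D' * (r.-1 * _))%N (D' * #|W1|)%N (D' * (r * b'))%N (r * arcs W1)%N; clear; lia.
  rewrite -(ler_pM2l rR0); apply: (le_trans (y := (2 * (D' * (r.-1 * #|W1|)))%N%:R)); last first.
    by rewrite -natrM ler_nat.
  have -> : r%:R * ((1 + 8%:R / r%:R) * (2%:R * c * #|W1|%:R)) =
      2%:R * #|W1|%:R * ((1 + 8%:R / r%:R) * c * r%:R) by ring.
  have -> : (2 * (D' * (r.-1 * #|W1|)))%N%:R = 2%:R * #|W1|%:R * (D'%:R * r.-1%:R) :> R.
    by rewrite !natrM; ring.
  by rewrite ler_wpM2l // mulr_ge0.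
rewrite -/S -(leq_pmul2l E10).
have -> : (E1 * (E * S) = EE * S)%N by rewrite mulnA (mulnC E1).
apply: leq_trans VE _; rewrite mulSn [X in (_ <= _ * X)%N]mulSn mulnDr; apply: leq_add.
  by rewrite leq_pmull.
by rewrite mulnA (mulnC E1).
Qed.

(** The 20 covers to first order 8/r from [dense_case], 3/r from the dichotomy, 1/r from the surplus
    deficit and 1/r for taking [c] strictly above [cf]; the rest absorbs rounding and second-order
    terms, as ep <= 1/16 and 2 <= ep cf. *)
Lemma extremal_asymptotic (R : realType) (F : sgraph -> Prop) (r : nat) :
  strongly_sublinear_separators R F -> (16 <= r)%N ->
  exists N : nat, forall H : sgraph, F H -> (N <= num_vertices H)%N -> (1 < num_vertices H)%N ->
    fine (extremal R H) <= (1 + 20%:R / r%:R) * fine (frac_extremal R H).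
Proof.
move=> hF r16; have [N1 main] := minor_of_surplus hF r16.
exists (4 * N1 + 8 * r + 4)%N => H FH hN h1; set cf := fine (frac_extremal R H).
have h0 : (0 < num_vertices H)%N by apply: ltnW.
have Ecf := fineK (frac_extremal_fin_num R h0).
have rR16 : (16%:R : R) <= r%:R by rewrite ler_nat.
have rR0 : (0 : R) < r%:R by apply: lt_le_trans rR16.
have r0 : (0 < r)%N by rewrite -(ltr_nat R).
have low : (num_vertices H)%:R <= 4%:R * cf.
  have := frac_extremal_lower R h0; rewrite -Ecf lee_fin -/cf ler_pdivrMr // mulrC; exact: le_trans.
have big : 4%:R * N1%:R + 8%:R * r%:R + 4%:R <= 4%:R * cf.
  by apply: le_trans low; rewrite -!natrM -!natrD ler_nat.
pose ep : R := r%:R^-1; have ep0 : 0 < ep by rewrite invr_gt0.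
have rep : r%:R * ep = 1 by rewrite /ep divff // gt_eqF.
have ep16 : 16%:R * ep <= 1 by rewrite -[leRHS]rep ler_pM2r.
have N10 : (0 : R) <= N1%:R by apply: ler0n.
have cf0 : 0 < cf by move: big N10 rR0; lra.
have epcf : 2%:R <= ep * cf.
  have h : ep * (8%:R * r%:R) <= ep * (4%:R * cf).
    by rewrite ler_pM2l //; move: big N10; lra.
  by move: h; rewrite mulrCA (mulrC ep) rep; lra.
pose a := (1 + 20%:R * ep) * cf; have a0 : 0 < a by rewrite mulr_gt0 // addr_gt0 // mulr_gt0.
have -> : (1 + 20%:R / r%:R) * cf = a by [].
rewrite leNgt; apply/negP=> lt.
have {lt} : (a%:E < extremal R H)%E by rewrite -(fineK (extremal_fin_num R h1)) lte_fin.
case/ereal_sup_gt => _ [G0 [v0 nm ->]]; rewrite lte_fin => lt; apply: nm.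
pose D := Num.trunc a; have /andP[Da aD] := truncn_itv (ltW a0); rewrite -/D in Da aD.
rewrite -natr1 in aD.
have DN : (N1 <= D)%N.
  rewrite -ltnS -(ltr_nat R) -natr1; move: aD big ep0 epcf rR0; rewrite /a mulrDl mul1r -mulrA.
  by move: (ep * cf) => ec; lra.
pose t := ((3 * D) %/ r)%N.
have tR : t%:R <= 3%:R * ep * D%:R.
  rewrite -(ler_pM2l rR0); have -> : r%:R * (3%:R * ep * D%:R) = (r%:R * ep) * (3%:R * D%:R) by ring.
  by rewrite rep mul1r -!natrM ler_nat mulnC leq_trunc_div.
have Dpos : (0 : R) <= D%:R by apply: ler0n.
pose D' := (D - t).-1.
have D'R : D%:R - t%:R - 1 <= D'%:R :> R.
  have : (D <= D' + t + 1)%N by rewrite /D'; clear; lia.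
  by rewrite -(ler_nat R) !natrD => h; rewrite !lerBlDr addrAC.
have e16 : 0 <= ep * (1 - 16%:R * ep) by rewrite mulr_ge0 ?subr_ge0 // ltW.
have D'low : (1 + 19%:R * ep) * cf * (1 - 3%:R * ep) <= D'%:R + 1.
  have p0 : 0 < 1 - 3%:R * ep by move: ep16; lra.
  apply: (le_trans (y := D%:R * (1 - 3%:R * ep))).
    rewrite ler_pM2r //; apply: (le_trans (y := a - 1)); last by move: aD; lra.
    by rewrite /a !mulrDl -!mulrA !mul1r; move: epcf; move: (ep * cf); clear => x; lra.
  have -> : D%:R * (1 - 3%:R * ep) = D%:R - 3%:R * ep * D%:R by ring.
  by move: tR D'R; move: (3%:R * ep * D%:R) => x; lra.
have ratio : (1 + 95%:R / 10%:R * ep) * cf <= D'%:R * (1 - ep).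
  have k1 : (1 + 19%:R * ep) * cf * (1 - 3%:R * ep) - 1 <= D'%:R by rewrite lerBlDr.
  have ep1 : 0 < 1 - ep by move: ep16 ep0; lra.
  apply: (le_trans (y := ((1 + 19%:R * ep) * cf * (1 - 3%:R * ep) - 1) * (1 - ep))); last by rewrite ler_pM2r.
  have k2 : 1 + 10%:R * ep <= (1 + 19%:R * ep) * (1 - 3%:R * ep) * (1 - ep).
    have e3 : 0 <= ep * ep * ep by rewrite !mulr_ge0 // ltW.
    have -> : (1 + 19%:R * ep) * (1 - 3%:R * ep) * (1 - ep) =
      1 + 10%:R * ep + (7%:R / 16%:R * ep + 73%:R / 16%:R * (ep * (1 - 16%:R * ep)) + 57%:R * (ep * ep * ep)) by field.
    by move: e16 e3 ep0; move: (ep * (1 - _)) (ep * ep * ep) => x z; lra.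
  have k3 : (1 + 10%:R * ep) * cf <= (1 + 19%:R * ep) * (1 - 3%:R * ep) * (1 - ep) * cf by rewrite ler_pM2r.
  have k4 : 1 * (1 - ep) <= 1 by move: ep0; lra.
  have -> : ((1 + 19%:R * ep) * cf * (1 - 3%:R * ep) - 1) * (1 - ep) =
     (1 + 19%:R * ep) * (1 - 3%:R * ep) * (1 - ep) * cf - 1 * (1 - ep) by ring.
  apply: le_trans (lerB k3 k4).
  have -> : (1 + 10%:R * ep) * cf - 1 = (1 + 95%:R / 10%:R * ep) * cf + (2%:R^-1 * (ep * cf) - 1) by field.
  by rewrite lerDl; move: (ep * cf) epcf; clear => x x2; lra.
have D'cf : cf <= D'%:R.
  have k1 : D'%:R * (1 - ep) <= D'%:R.
    by rewrite ler_piMr ?ler0n // lerBlDr lerDl ltW.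
  apply: le_trans k1; apply: le_trans ratio; rewrite -{1}[cf]mul1r ler_pM2r //; move: ep0; lra.
apply: (main H G0 D ((1 + ep) * cf)) => //.
- by rewrite -Ecf lte_fin -/cf mulrDl mul1r ltrDl mulr_gt0.
- apply: le_trans Da _; rewrite /a mulrA ler_pM2r //; move: ep16; lra.
- by rewrite mulr_gt0 // addr_gt0.
- rewrite -[#|H|]/(num_vertices H) -(ler_nat R) natrM -/t -/D'.
  by apply: le_trans low _; rewrite ler_pM2l.
- rewrite -/t -/D'.
  have Er : r.-1%:R = r%:R * (1 - ep) by rewrite mulrBr mulr1 rep -subn1 natrB.
  rewrite Er (mulrC _ r%:R) (mulrCA D'%:R) ler_pM2l //; apply: le_trans ratio.
  rewrite -/ep mulrA ler_pM2r //.
  have -> : (1 + 8%:R * ep) * (1 + ep) = 1 + 95%:R / 10%:R * ep - 2%:R^-1 * (ep * (1 - 16%:R * ep)) by field.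
  by move: e16; move: (ep * (1 - _)) => x; lra.
have lt2 : (2 * D * num_vertices G0 < arcs [set: G0])%N.
  rewrite -(ltr_nat R) !natrM lt_density //; exact: le_lt_trans lt.
apply/andP; split; last by rewrite cardsT; apply: leq_trans lt2 (leq_addr _ _).
have a2 := arcs_leq [set: G0]; rewrite cardsT -/(num_vertices G0) in a2.
have := leq_trans lt2 a2; rewrite (mulnC (2 * D)%N (num_vertices G0)) ltn_pmul2l //.
by rewrite cardsT -/(num_vertices G0); move: (num_vertices G0) => v; clear; lia.
Qed.

Theorem theorem2p1 (R : realType) (F : sgraph -> Prop)
    (hF : strongly_sublinear_separators R F) :
  exists o : sgraph -> R,
    (forall eps : R, 0 < eps ->
       exists N : nat, forall H : sgraph,
         F H -> (N <= num_vertices H)%N -> `|o H| <= eps) /\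
    (forall H : sgraph, F H -> (2 <= num_vertices H)%N ->
       extremal R H = ((1 + o H)%:E * frac_extremal R H)%E).
Proof.
(* The relative error itself; [fine] is harmless since both values are finite, and the denominator
   is positive by [frac_extremal_lower]. *)
exists (fun H => fine (extremal R H) / fine (frac_extremal R H) - 1).
have cf_gt0 H : (1 < num_vertices H)%N -> 0 < fine (frac_extremal R H).
  move=> h1; have h0 := ltnW h1; rewrite -lte_fin (fineK (frac_extremal_fin_num R h0)).
  by apply: lt_le_trans (frac_extremal_lower R h0); rewrite lte_fin divr_gt0 ?ltr0n.
split=> [eps eps0|H _ h1]; last first.
  rewrite -(fineK (extremal_fin_num R h1)) -{2}(fineK (frac_extremal_fin_num R (ltnW h1))) -EFinM.
  by congr (_%:E); rewrite addrC subrK divfK // gt_eqF // cf_gt0.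
pose r := ((Num.trunc (20%:R / eps)).+1 + 16)%N.
have r16 : (16 <= r)%N by rewrite leq_addl.
have r_big : 20%:R / r%:R <= eps.
  rewrite ler_pdivrMr ?ltr0n ?(leq_trans _ r16) // mulrC -ler_pdivrMr //; apply: ltW.
  by apply: lt_le_trans (truncnS_gt _) _; rewrite ler_nat leq_addr.
pose e := Num.min (eps / 7%:R) 4%:R^-1.
have e0 : 0 < e by rewrite lt_min divr_gt0 //= invr_gt0.
have e4 : e <= 4%:R^-1 by rewrite ge_min lexx orbT.
have e7 : 7%:R * e <= eps by rewrite mulrC -ler_pdivlMr // ge_min lexx.
have [N1 up] := extremal_asymptotic hF r16; have [N2 lo] := frac_extremal_asymptotic e0 e4.
exists (N1 + N2 + 2)%N => H FH hN.
have h1 : (1 < num_vertices H)%N by apply: leq_trans hN; rewrite addn2.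
have hN1 : (N1 <= num_vertices H)%N by apply: leq_trans hN; rewrite -addnA leq_addr.
have hN2 : (N2 <= num_vertices H)%N by apply: leq_trans hN; rewrite addnAC leq_addl.
have {up} := up H FH hN1 h1; have {lo} := lo H hN2 h1; have := cf_gt0 H h1.
move: (fine _) (fine _) => x y y0 lo up.
rewrite ler_norml; apply/andP; split.
  rewrite lerBrDr ler_pdivlMr //; have x0 : 0 <= x.
    rewrite leNgt; apply/negP=> x0; have : x * (1 + 7%:R * e) < 0 by rewrite nmulr_rlt0 // addr_gt0 // mulr_gt0.
    by move: lo y0; lra.
  have [h|h] := leP y x.
    have n1 : - eps + 1 <= 1 by rewrite gerDr oppr_le0 ltW.
    by apply: (le_trans _ h); rewrite ler_piMl // ltW.
  have h2 : x * (7%:R * e) <= y * eps by apply: ler_pM => //; [rewrite mulr_ge0 // ltW|exact: ltW].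
  by rewrite mulrDl mul1r mulNr mulrC; move: lo h2; rewrite mulrDr mulr1; lra.
rewrite lerBlDl ler_pdivrMr //; apply: le_trans up _; rewrite ler_pM2r //.
by rewrite lerD2l.
Qed.
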